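(* Let $(a_n)_{n=1}^\infty$ and $(k_n)_{n=1}^\infty$ be sequences with $a_n,k_n\in[1..n]$ such that $a_n,k_n$ are computable in $\mathrm{poly}(n)$ time. Unless the Orthogonal Vectors Conjecture fails, there is no algorithm that, for some fixed $\epsilon>0$, for every $n\in\mathbb{Z}_{+}$ and all strings $X,Y$ with $|X|+|Y|\le n$, in $O\big((n+k_n\cdot\min(n,a_nk_n))^{1-\epsilon}\big)$ time computes $\mathtt{ED}_{a_n}(X,Y)$ or reports that $\mathtt{ED}_{a_n}(X,Y)>k_n$.
   Context: For $a\ge 1$, $\mathtt{ED}_a(X,Y)$ denotes the minimum total cost of a sequence of edit operations transforming $X$ into $Y$, where each character insertion and each character deletion costs $1$ and each character substitution costs $\frac1a$. The Orthogonal Vectors problem: given a set $V\subseteq\{0,1\}^d$ of $n$ vectors, decide whether there exist $u,v\in V$ with $\langle u,v\rangle=\sum_{i=1}^d u_iv_i=0$. The Orthogonal Vectors Conjecture asserts that for every constant $\epsilon>0$ there exists a constant $c\ge1$ such that Orthogonal Vectors cannot be solved in $O(n^{2-\epsilon})$ time on instances with $d=c\log n$. *)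

(* Defs.v *)
From Stdlib Require Import Reals List Arith.
Import ListNotations.

(** * Word RAM

    The machine is given by a structured language over [w]-bit words with
    finitely many variables and finitely many random-access arrays per program.
    Every assignment, array store and test costs one unit.  Expressions may be
    nested, but their size is a constant of the program, so up to constant
    factors this is the usual word RAM with unit-cost operations on words. *)

Inductive binop :=
  Add | Sub | Mul | Div | Mod | And | Or | Xor | Shl | Shr | Eq | Lt.

Inductive expr :=
| Const (m : nat)
| Var (x : nat)
| Get (A : nat) (i : expr)
| Bin (o : binop) (e1 e2 : expr).

Inductive cmd :=
| Skip
| Assign (x : nat) (e : expr)
| Put (A : nat) (i e : expr)
| Seq (p q : cmd)
| If (e : expr) (p q : cmd)
| While (e : expr) (p : cmd).

Record state := State { var : nat -> nat; arr : nat -> nat -> nat }.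

Definition upd {T : Type} (f : nat -> T) (x : nat) (v : T) : nat -> T :=
  fun y => if Nat.eqb y x then v else f y.

Definition set_var (s : state) (x v : nat) : state :=
  State (upd (var s) x v) (arr s).

Definition set_arr (s : state) (A i v : nat) : state :=
  State (var s) (upd (arr s) A (upd (arr s A) i v)).

Definition eval_binop (o : binop) (x y : nat) : nat :=
  match o with
  | Add => x + y
  | Sub => x - y
  | Mul => x * y
  | Div => x / y
  | Mod => x mod y
  | And => Nat.land x y
  | Or => Nat.lor x y
  | Xor => Nat.lxor x y
  | Shl => Nat.shiftl x y
  | Shr => Nat.shiftr x y
  | Eq => Nat.b2n (x =? y)
  | Lt => Nat.b2n (x <? y)
  end.

(** The reduction modulo [2 ^ w] at every node keeps all constants, addresses
    and intermediate results inside one word. *)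
Fixpoint eval (w : nat) (s : state) (e : expr) : nat :=
  (match e with
   | Const m => m
   | Var x => var s x
   | Get A i => arr s A (eval w s i)
   | Bin o e1 e2 => eval_binop o (eval w s e1) (eval w s e2)
   end) mod 2 ^ w.

(** [exec w p s t s']: with word size [w], program [p] started in [s] halts in
    [s'] after [t] time units. *)
Inductive exec (w : nat) : cmd -> state -> nat -> state -> Prop :=
| exec_skip s : exec w Skip s 1 s
| exec_assign s x e : exec w (Assign x e) s 1 (set_var s x (eval w s e))
| exec_put s A i e :
    exec w (Put A i e) s 1 (set_arr s A (eval w s i) (eval w s e))
| exec_seq p q s1 s2 s3 t1 t2 :
    exec w p s1 t1 s2 -> exec w q s2 t2 s3 -> exec w (Seq p q) s1 (t1 + t2) s3
| exec_if_true e p q s t s' :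
    eval w s e <> 0 -> exec w p s t s' -> exec w (If e p q) s (S t) s'
| exec_if_false e p q s t s' :
    eval w s e = 0 -> exec w q s t s' -> exec w (If e p q) s (S t) s'
| exec_while_false e p s :
    eval w s e = 0 -> exec w (While e p) s 1 s
| exec_while_true e p s1 s2 s3 t1 t2 :
    eval w s1 e <> 0 -> exec w p s1 t1 s2 -> exec w (While e p) s2 t2 s3 ->
    exec w (While e p) s1 (S (t1 + t2)) s3.

(** The input is preloaded, so it can be read in sublinear time; all remaining
    memory is zero. *)
Definition init (vs : list nat) (As : list (list nat)) : state :=
  State (fun x => nth x vs 0) (fun A i => nth i (nth A As []) 0).

(** Words have [Theta(log n)] bits; the constant [c] is chosen by the
    algorithm. *)
Definition word_size (c n : nat) : nat := c * (Nat.log2 n + 1).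

Definition halts_within (w : nat) (p : cmd) (s : state) (T : R)
    (post : state -> Prop) : Prop :=
  exists (t : nat) (s' : state), exec w p s t s' /\ (INR t <= T)%R /\ post s'.

Definition poly_time_computable (f : nat -> nat) : Prop :=
  exists (p : cmd) (c C e : nat), 1 <= c /\
    forall n : nat, 1 <= n ->
      halts_within (word_size c n) p (init [n] []) (INR (C * n ^ e))
        (fun s => var s 0 = f n).

(** * Orthogonal Vectors *)

Definition inner (u v : list bool) : nat :=
  list_sum (map (fun xy => Nat.b2n (fst xy) * Nat.b2n (snd xy)) (combine u v)).

Definition is_OV_instance (n d : nat) (V : list (list bool)) : Prop :=
  NoDup V /\ length V = n /\ Forall (fun v => length v = d) V.

Definition has_orthogonal_pair (V : list (list bool)) : Prop :=
  exists u v, In u V /\ In v V /\ inner u v = 0.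

(** [d] is [c * log2 n] rounded up to an integer. *)
Definition log_dim (c : R) (n d : nat) : Prop :=
  let x := (c * (ln (INR n) / ln 2))%R in (x <= INR d < x + 1)%R.

(** Coordinate [j] of the [i]-th vector is in cell [i * d + j] of array 0. *)
Definition OV_input (n d : nat) (V : list (list bool)) : state :=
  init [n; d] [map Nat.b2n (concat V)].

Definition OV_solvable (c : R) (T : nat -> R) : Prop :=
  exists (p : cmd) (b : nat) (C : R), 1 <= b /\
    forall (n d : nat) (V : list (list bool)),
      1 <= n -> log_dim c n d -> is_OV_instance n d V ->
      halts_within (word_size b n) p (OV_input n d V) (C * T n)%R
        (fun s => var s 0 <> 0 <-> has_orthogonal_pair V).

Definition OV_conjecture : Prop :=
  forall eps : R, (0 < eps)%R ->
    exists c : R, (1 <= c)%R /\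
      ~ OV_solvable c (fun n => Rpower (INR n) (2 - eps)).

(** * Edit distance *)

Inductive edit_op {A : Type} (a : R) : list A -> list A -> R -> Prop :=
| edit_ins u v x : edit_op a (u ++ v) (u ++ x :: v) 1%R
| edit_del u v x : edit_op a (u ++ x :: v) (u ++ v) 1%R
| edit_sub u v x y : edit_op a (u ++ x :: v) (u ++ y :: v) (1 / a)%R.

Inductive edit_seq {A : Type} (a : R) : list A -> list A -> R -> Prop :=
| edit_seq_nil X : edit_seq a X X 0%R
| edit_seq_cons X Y Z r1 r2 :
    edit_op a X Y r1 -> edit_seq a Y Z r2 -> edit_seq a X Z (r1 + r2)%R.

Definition is_ED {A : Type} (a : R) (X Y : list A) (r : R) : Prop :=
  edit_seq a X Y r /\ forall r', edit_seq a X Y r' -> (r <= r')%R.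

(** Since [|X| + |Y| <= n], at most [n] distinct characters occur, so up to
    renaming the alphabet is [0 .. n-1]. *)
Definition is_ED_instance (n : nat) (X Y : list nat) : Prop :=
  length X + length Y <= n /\ Forall (fun x => x < n) (X ++ Y).

Definition ED_input (n : nat) (X Y : list nat) : state :=
  init [n; length X; length Y] [X; Y].

(** A nonzero variable 0 reports [ED > k]; otherwise the distance is output as
    the fraction (variable 1) / (variable 2). *)
Definition ED_output (a k : nat) (X Y : list nat) (s : state) : Prop :=
  exists r : R, is_ED (INR a) X Y r /\
    ((var s 0 <> 0 /\ (r > INR k)%R) \/
     (var s 0 = 0 /\ var s 2 <> 0 /\ r = (INR (var s 1) / INR (var s 2))%R)).

Definition ED_solvable (a k : nat -> nat) (T : nat -> R) : Prop :=
  exists (p : cmd) (b : nat) (C : R), 1 <= b /\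
    forall (n : nat) (X Y : list nat),
      1 <= n -> is_ED_instance n X Y ->
      halts_within (word_size b n) p (ED_input n X Y) (C * T n)%R
        (ED_output (a n) (k n) X Y).

(* Main.v *)
Require Import Defs.
From Stdlib Require Import Reals Arith Bool List ZArith Lia Lra Classical.
Import Defs ListNotations.

(** If [k n * min n (a n * k n) < n ^ (1 + eps / 2)] for infinitely many [n], the
    assumed solver is sublinear for these [n]: on [X = Y = 0 ... 0] it leaves a letter
    of [Y] unread, and changing that letter changes the distance.

    Otherwise the solver yields an algorithm for Orthogonal Vectors.  Given [N]
    vectors, take [n] about [N ^ (1 / g)], with [g] so large that [a n] and [k n] are
    computed in time [O(N)].  The [N * N] pairs are covered by rectangles of [N1] by
    [N2] vectors, where [N1] is about [k n / d] and [N2] about [min n (a n * k n) / d],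
    and each rectangle is decided by one run of the solver.

    For a rectangle, [X] and [Y] consist of blocks of length [4 * d + 1].  The blocks of
    [X] repeat the [N1] vectors [u] periodically; those of [Y] are the [N2] vectors [v]
    between [N1] dummy blocks on either side.  [X] has [N1] blocks more than [Y], so an
    alignment has to drift from offset [0] to offset [N1 * L].  All letters encode their
    position within the block, so that matches occur only at offsets [t * L], where
    the [d] separators of each block match, and at offsets [t * L + d], where a block of
    [Y] is compared with a block of [X]; the latter comparison gives [d] matches for a
    dummy block, at most [d] for a non-orthogonal pair and [d + 1] for an orthogonal one.
    Passing through each of the [N1] offsets [t * L + d] costs nothing beyond the forced
    deletions and gains [d] matches there, or [d + 1] matches at one orthogonal pair.
    Returning to an earlier offset takes [d] insertions and staying for another block
    gives up [d] separators, so that neither is profitable even for [a = 1]. *)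

(** * Alignments *)

Local Open Scope R_scope.

Inductive align {A : Type} (a : R) : list A -> list A -> R -> Prop :=
| align_nil : align a [] [] 0
| align_del x X Y r : align a X Y r -> align a (x :: X) Y (1 + r)
| align_ins y X Y r : align a X Y r -> align a X (y :: Y) (1 + r)
| align_sub x y X Y r : align a X Y r -> align a (x :: X) (y :: Y) (1 / a + r)
| align_match x X Y r : align a X Y r -> align a (x :: X) (x :: Y) r.

Lemma align_refl {A} (a : R) (X : list A) : align a X X 0.
Proof. induction X; constructor; auto. Qed.

Lemma align_insert {A} (a : R) (u v : list A) x Y Z r :
  0 < 1 / a -> align a Y Z r -> Y = u ++ x :: v ->
  exists r', r' <= 1 + r /\ align a (u ++ v) Z r'.
Proof.
  intros Ha H; revert u; induction H; intros u E.
  - destruct u; discriminate.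
  - destruct u as [|c u]; injection E as -> ->; simpl.
    + exists r; split; [lra|auto].
    + destruct (IHalign u eq_refl) as (r' & L & B).
      exists (1 + r'); split; [lra|constructor; auto].
  - destruct (IHalign u E) as (r' & L & B).
    exists (1 + r'); split; [lra|constructor; auto].
  - destruct u as [|c u]; injection E as -> ->; simpl.
    + exists (1 + r); split; [lra|constructor; auto].
    + destruct (IHalign u eq_refl) as (r' & L & B).
      exists (1 / a + r'); split; [lra|constructor; auto].
  - destruct u as [|c u]; injection E as -> ->; simpl.
    + exists (1 + r); split; [lra|constructor; auto].
    + destruct (IHalign u eq_refl) as (r' & L & B).
      exists r'; split; [lra|constructor; auto].
Qed.

Lemma align_delete {A} (a : R) (u v : list A) x Y Z r :
  align a Y Z r -> Y = u ++ v -> align a (u ++ x :: v) Z (1 + r).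
Proof.
  intros H; revert u; induction H; intros u E.
  - destruct u; [|discriminate]. simpl in *; subst v. repeat constructor.
  - destruct u as [|c u]; simpl in *.
    + subst v. repeat constructor; auto.
    + injection E as -> ->. apply align_del; auto.
  - replace (1 + (1 + r)) with (1 + (1 + r)) by ring. apply align_ins; auto.
  - destruct u as [|c u]; simpl in *.
    + subst v. apply align_del. apply align_sub; auto.
    + injection E as -> ->.
      replace (1 + (1 / a + r)) with (1 / a + (1 + r)) by ring.
      apply align_sub; auto.
  - destruct u as [|c u]; simpl in *.
    + subst v. apply align_del. apply align_match; auto.
    + injection E as -> ->. apply align_match; auto.
Qed.

Lemma align_substitute {A} (a : R) (u v : list A) x y Y Z r :
  0 < 1 / a -> align a Y Z r -> Y = u ++ y :: v ->
  exists r', r' <= 1 / a + r /\ align a (u ++ x :: v) Z r'.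
Proof.
  intros Ha H; revert u; induction H; intros u E.
  - destruct u; discriminate.
  - destruct u as [|c u]; injection E as -> ->; simpl.
    + exists (1 + r); split; [lra|constructor; auto].
    + destruct (IHalign u eq_refl) as (r' & L & B).
      exists (1 + r'); split; [lra|constructor; auto].
  - destruct (IHalign u E) as (r' & L & B).
    exists (1 + r'); split; [lra|constructor; auto].
  - destruct u as [|c u]; injection E as -> ->; simpl.
    + exists (1 / a + r); split; [lra|constructor; auto].
    + destruct (IHalign u eq_refl) as (r' & L & B).
      exists (1 / a + r'); split; [lra|constructor; auto].
  - destruct u as [|c u]; injection E as -> ->; simpl.
    + exists (1 / a + r); split; [lra|constructor; auto].
    + destruct (IHalign u eq_refl) as (r' & L & B).
      exists r'; split; [lra|constructor; auto].
Qed.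

Lemma edit_seq_align {A} (a : R) (X Y : list A) r :
  0 < 1 / a -> edit_seq a X Y r -> exists r', r' <= r /\ align a X Y r'.
Proof.
  intros Ha H; induction H as [X|X Y Z r1 r2 Hop _ (r' & L & B)].
  - exists 0; split; [lra|apply align_refl].
  - destruct Hop.
    + destruct (align_insert a u v x _ Z r' Ha B eq_refl) as (r'' & ? & ?).
      exists r''; split; [lra|auto].
    + exists (1 + r'); split; [lra|]. eapply align_delete; eauto.
    + destruct (align_substitute a u v x y _ Z r' Ha B eq_refl) as (r'' & ? & ?).
      exists r''; split; [lra|auto].
Qed.

Lemma edit_seq_lift {A} (a : R) c (X Y : list A) r :
  edit_seq a X Y r -> edit_seq a (c :: X) (c :: Y) r.
Proof.
  induction 1 as [|X Y Z r1 r2 Hop _ IH]; [constructor|].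
  econstructor; [|exact IH].
  destruct Hop.
  - exact (edit_ins a (c :: u) v x).
  - exact (edit_del a (c :: u) v x).
  - exact (edit_sub a (c :: u) v x y).
Qed.

Lemma align_edit_seq {A} (a : R) (X Y : list A) r :
  align a X Y r -> edit_seq a X Y r.
Proof.
  induction 1.
  - constructor.
  - econstructor; [exact (edit_del a [] X x)|auto].
  - econstructor; [exact (edit_ins a [] X y)|]. now apply edit_seq_lift.
  - econstructor; [exact (edit_sub a [] X x y)|]. now apply edit_seq_lift.
  - now apply edit_seq_lift.
Qed.

Lemma align_app {A} (a : R) (X1 X2 Y1 Y2 : list A) r1 r2 :
  align a X1 Y1 r1 -> align a X2 Y2 r2 -> align a (X1 ++ X2) (Y1 ++ Y2) (r1 + r2).
Proof.
  intros H1 H2; induction H1; simpl; try rewrite Rplus_assoc;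
    try (constructor; assumption).
  now rewrite Rplus_0_l.
Qed.

Definition seg {A : Type} (f : nat -> A) (x m : nat) : list A := map f (seq x m).

Lemma seg_app {A} (f : nat -> A) x m1 m2 :
  seg f x (m1 + m2) = seg f x m1 ++ seg f (x + m1) m2.
Proof. unfold seg. now rewrite seq_app, map_app. Qed.

Fixpoint mismatches (f g : nat -> nat) (x y m : nat) : nat :=
  match m with
  | O => O
  | S m => Nat.b2n (negb (f x =? g y)%nat) + mismatches f g (S x) (S y) m
  end.

Lemma align_hamming (a : R) (f g : nat -> nat) x y m :
  align a (seg f x m) (seg g y m) (INR (mismatches f g x y m) / a).
Proof.
  revert x y; induction m as [|m IH]; intros x y; cbn -[INR].
  - replace (INR 0 / a) with 0 by (simpl; unfold Rdiv; ring). constructor.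
  - destruct (Nat.eqb_spec (f x) (g y)) as [->|].
    + cbn [negb Nat.b2n plus]. apply align_match, IH.
    + cbn [negb Nat.b2n]. rewrite plus_INR.
      replace ((INR 1 + _) / a) with (1 / a + INR (mismatches f g (S x) (S y) m) / a)
        by (simpl INR; unfold Rdiv; ring).
      apply align_sub, IH.
Qed.

Lemma align_delete_all {A} (a : R) (X : list A) : align a X [] (INR (length X)).
Proof.
  induction X as [|x X IH]; [constructor|].
  cbn [length]. rewrite S_INR, Rplus_comm. now constructor.
Qed.

Lemma align_drop (a : R) (f : nat -> nat) x m : align a (seg f x m) [] (INR m).
Proof.
  pose proof (align_delete_all a (seg f x m)) as H.
  unfold seg in *. now rewrite length_map, length_seq in H.
Qed.

Lemma mismatches_le f g x y m : (mismatches f g x y m <= m)%nat.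
Proof.
  revert x y; induction m as [|m IH]; intros x y; cbn; [lia|].
  specialize (IH (S x) (S y)). destruct (f x =? g y)%nat; cbn; lia.
Qed.

Lemma mismatches_app f g x y m1 m2 :
  mismatches f g x y (m1 + m2) =
  (mismatches f g x y m1 + mismatches f g (x + m1) (y + m1) m2)%nat.
Proof.
  revert x y; induction m1 as [|m1 IH]; intros x y; cbn [mismatches plus].
  - now rewrite !Nat.add_0_r.
  - rewrite IH, !Nat.add_succ_r. cbn. lia.
Qed.

Lemma mismatches_0 f g x y m :
  (forall i, (i < m)%nat -> f (x + i)%nat = g (y + i)%nat) -> mismatches f g x y m = 0%nat.
Proof.
  revert x y; induction m as [|m IH]; intros x y H; cbn; auto.
  rewrite IH.
  - specialize (H 0%nat ltac:(lia)). rewrite !Nat.add_0_r in H.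
    rewrite H, Nat.eqb_refl. reflexivity.
  - intros i Hi. specialize (H (S i) ltac:(lia)). now rewrite !Nat.add_succ_r in H.
Qed.

(** Multiplied by [a], a cost is [a] times the forced deletions, plus [|Y|], minus the
    matches, plus at least one per insertion; so it suffices to bound matches minus
    insertions by a potential [F] of the remaining suffixes. *)
Lemma align_potential (a : R) (f g : nat -> nat) (F : nat -> nat -> Z) (NX NY : nat) :
  1 <= a ->
  (forall x y, (y <= NY)%nat -> (F (S x) y <= F x y)%Z) ->
  (forall x y, (y < NY)%nat -> (F x (S y) <= F x y + 1)%Z) ->
  (forall x y, (y < NY)%nat ->
     (F (S x) (S y) + Z.b2z (f x =? g y)%nat <= F x y)%Z) ->
  (0 <= F NX NY)%Z ->
  forall r, align a (seg f 0 NX) (seg g 0 NY) r ->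
  a * (INR NX - INR NY) + INR NY - IZR (F 0%nat 0%nat) <= a * r.
Proof.
  intros Ha Hdel Hins Hdiag Hend.
  assert (Haa : a * (1 / a) = 1) by (field; lra).
  assert (G : forall X Y r, align a X Y r ->
    forall x y m n, X = seg f x m -> Y = seg g y n ->
    (x + m = NX)%nat -> (y + n = NY)%nat ->
    a * (INR m - INR n) + INR n - IZR (F x y) <= a * r).
  { induction 1; intros i j m n EX EY Hm Hn.
    - destruct m; [|discriminate]. destruct n; [|discriminate].
      rewrite Nat.add_0_r in *; subst. apply IZR_le in Hend. simpl. lra.
    - destruct m; [discriminate|]. injection EX as -> EX.
      specialize (IHalign (S i) j m n EX EY ltac:(lia) Hn).
      specialize (Hdel i j ltac:(lia)). apply IZR_le in Hdel.
      rewrite S_INR. lra.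
    - destruct n; [discriminate|]. injection EY as -> EY.
      specialize (IHalign i (S j) m n EX EY Hm ltac:(lia)).
      specialize (Hins i j ltac:(lia)). apply IZR_le in Hins. rewrite plus_IZR in Hins.
      rewrite S_INR. lra.
    - destruct m; [discriminate|]. injection EX as -> EX.
      destruct n; [discriminate|]. injection EY as -> EY.
      specialize (IHalign (S i) (S j) m n EX EY ltac:(lia) ltac:(lia)).
      specialize (Hdiag i j ltac:(lia)). apply IZR_le in Hdiag. rewrite plus_IZR in Hdiag.
      assert (0 <= IZR (Z.b2z (f i =? g j)%nat)) by (destruct (f i =? g j)%nat; simpl; lra).
      rewrite !S_INR. lra.
    - destruct m; [discriminate|]. injection EX as -> EX.
      destruct n; [discriminate|]. injection EY as E1 EY.
      specialize (IHalign (S i) (S j) m n EX EY ltac:(lia) ltac:(lia)).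
      specialize (Hdiag i j ltac:(lia)). rewrite E1, Nat.eqb_refl in Hdiag.
      apply IZR_le in Hdiag. rewrite plus_IZR in Hdiag. simpl Z.b2z in Hdiag.
      rewrite !S_INR. lra. }
  intros r Hr. apply (G _ _ _ Hr 0%nat 0%nat NX NY); auto.
Qed.

Local Close Scope R_scope.

Local Open Scope nat_scope.

(** * Block strings *)

Definition blk (d : nat) : nat := 4 * d + 1.

(** Layout of a block, with [e] an extra letter that only vector blocks of [Y] match:
    [X: separators (d), junk (d), coordinates (2 d), e] and
    [Y: separators (d), coordinates (2 d), e, junk (d)].
    A coordinate takes two letters: the first one matches iff [v_p = 0], the second one
    iff [v_p = 1] and [u_p = 0].  The junk letters are [blk d] in [X] and [blk d + 1] in [Y]. *)
Definition text_sym (d : nat) (U : nat -> nat -> bool) (x : nat) : nat :=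
  let i := x / blk d in
  let p := x mod blk d in
  if p <? d then p
  else if p <? 2 * d then blk d
  else let s := p - 2 * d in
    if (s mod 2 =? 1) && U i (s / 2) then blk d else p - d.

Definition pattern_sym (d : nat) (E : nat -> bool) (V : nat -> nat -> bool) (y : nat) : nat :=
  let q := y / blk d in
  let p := y mod blk d in
  if p <? d then p
  else if p <? 3 * d + 1 then
    let s := p - d in
    if (if s =? 2 * d then E q else if s mod 2 =? 1 then V q (s / 2) else negb (V q (s / 2)))
    then p else blk d + 1
  else blk d + 1.

Lemma block_divmod L i p : p < L -> (i * L + p) / L = i /\ (i * L + p) mod L = p.
Proof.
  intros H. split.
  - rewrite Nat.div_add_l by lia. rewrite Nat.div_small; lia.
  - rewrite Nat.add_comm, Nat.Div0.mod_add. now apply Nat.mod_small.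
Qed.

Lemma text_sym_block d U i p : p < blk d ->
  text_sym d U (i * blk d + p) =
  if p <? d then p
  else if p <? 2 * d then blk d
  else let s := p - 2 * d in
    if (s mod 2 =? 1) && U i (s / 2) then blk d else p - d.
Proof. intros H. unfold text_sym. destruct (block_divmod _ i p H) as [-> ->]. reflexivity. Qed.

Lemma pattern_sym_block d E V q p : p < blk d ->
  pattern_sym d E V (q * blk d + p) =
  if p <? d then p
  else if p <? 3 * d + 1 then
    let s := p - d in
    if (if s =? 2 * d then E q else if s mod 2 =? 1 then V q (s / 2) else negb (V q (s / 2)))
    then p else blk d + 1
  else blk d + 1.
Proof. intros H. unfold pattern_sym. destruct (block_divmod _ q p H) as [-> ->]. reflexivity. Qed.

Lemma text_sym_lt d U x : text_sym d U x < blk d + 2.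
Proof.
  unfold text_sym. pose proof (Nat.mod_upper_bound x (blk d)).
  unfold blk in *. repeat match goal with |- context [if ?b then _ else _] => destruct b end; lia.
Qed.

Lemma pattern_sym_lt d E V x : pattern_sym d E V x < blk d + 2.
Proof.
  unfold pattern_sym. pose proof (Nat.mod_upper_bound x (blk d)).
  unfold blk in *. repeat match goal with |- context [if ?b then _ else _] => destruct b end; lia.
Qed.

Definition dot (d : nat) (u v : nat -> bool) : nat :=
  list_sum (map (fun p => Nat.b2n (u p && v p)) (seq 0 d)).

Section Cells.
Variables (d : nat) (U : nat -> nat -> bool) (E : nat -> bool) (V : nat -> nat -> bool).
Notation L := (blk d).
Notation xs := (text_sym d U).
Notation ys := (pattern_sym d E V).

Lemma cell_mismatches_pairs i q s m : s + m <= d ->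
  mismatches xs ys (i * L + (2 * d + 2 * s)) (q * L + (d + 2 * s)) (2 * m) =
  m + list_sum (map (fun p => Nat.b2n (U i p && V q p)) (seq s m)).
Proof.
  revert s; induction m as [|m IH]; intros s Hs; [reflexivity|].
  replace (2 * S m) with (S (S (2 * m))) by lia. cbn [mismatches seq map list_sum fold_right].
  replace (S (S (i * L + (2 * d + 2 * s)))) with (i * L + (2 * d + 2 * S s)) by lia.
  replace (S (S (q * L + (d + 2 * s)))) with (q * L + (d + 2 * S s)) by lia.
  rewrite IH by lia.
  replace (S (i * L + (2 * d + 2 * s))) with (i * L + (2 * d + 2 * s + 1)) by lia.
  replace (S (q * L + (d + 2 * s))) with (q * L + (d + 2 * s + 1)) by lia.
  rewrite !text_sym_block, !pattern_sym_block by (unfold blk; lia).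
  repeat match goal with
  | |- context [?a <? ?b] => destruct (Nat.ltb_spec a b); [lia|] || (destruct (Nat.ltb_spec a b); [|lia])
  end.
  cbv zeta.
  replace (2 * d + 2 * s - 2 * d) with (2 * s) by lia.
  replace (d + 2 * s - d) with (2 * s) by lia.
  replace (2 * d + 2 * s + 1 - 2 * d) with (2 * s + 1) by lia.
  replace (d + 2 * s + 1 - d) with (2 * s + 1) by lia.
  replace ((2 * s) mod 2) with 0 by (rewrite Nat.mul_comm; now rewrite Nat.Div0.mod_mul).
  replace ((2 * s + 1) mod 2) with 1
    by (rewrite Nat.add_comm, Nat.mul_comm, Nat.Div0.mod_add; reflexivity).
  replace ((2 * s) / 2) with s by (rewrite Nat.mul_comm, Nat.div_mul; lia).
  replace ((2 * s + 1) / 2) with s by (rewrite Nat.mul_comm, Nat.div_add_l, Nat.add_0_r; lia).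
  destruct (Nat.eqb_spec (2 * s) (2 * d)); [lia|].
  destruct (Nat.eqb_spec (2 * s + 1) (2 * d)); [lia|].
  cbn [Nat.eqb andb negb]. unfold list_sum.
  unfold blk.
  destruct (U i s), (V q s); cbn [negb andb Nat.b2n];
  repeat match goal with
  | |- context [?a =? ?b] => destruct (Nat.eqb_spec a b); [lia|] || (destruct (Nat.eqb_spec a b); [|lia])
  end; cbn [negb Nat.b2n]; lia.
Qed.

Lemma cell_mismatches i q :
  mismatches xs ys (i * L + 2 * d) (q * L + d) (2 * d + 1) =
  d + dot d (U i) (V q) + (if E q then 0 else 1).
Proof.
  rewrite mismatches_app. pose proof (cell_mismatches_pairs i q 0 d ltac:(lia)) as H.
  rewrite Nat.mul_0_r, !Nat.add_0_r in H. rewrite H. unfold dot.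
  cbn [mismatches].
  rewrite <- !Nat.add_assoc.
  rewrite text_sym_block, pattern_sym_block by (unfold blk; lia).
  destruct (Nat.ltb_spec (2 * d + 2 * d) d); [lia|].
  destruct (Nat.ltb_spec (2 * d + 2 * d) (2 * d)); [lia|].
  destruct (Nat.ltb_spec (d + 2 * d) d); [lia|].
  destruct (Nat.ltb_spec (d + 2 * d) (3 * d + 1)); [|lia].
  cbv zeta.
  replace (2 * d + 2 * d - 2 * d) with (2 * d) by lia.
  replace (d + 2 * d - d) with (2 * d) by lia.
  replace ((2 * d) mod 2) with 0 by (rewrite Nat.mul_comm; now rewrite Nat.Div0.mod_mul).
  rewrite Nat.eqb_refl. cbn [Nat.eqb andb].
  replace (2 * d + 2 * d - d) with (d + 2 * d) by lia.
  destruct (E q); [rewrite Nat.eqb_refl|destruct (Nat.eqb_spec (d + 2 * d) (L + 1)); [unfold blk in *; lia|]];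
    cbn; lia.
Qed.

Lemma separator_match i q p : p < d -> xs (i * L + p) = ys (q * L + p).
Proof.
  intros H. rewrite text_sym_block, pattern_sym_block by (unfold blk; lia).
  destruct (Nat.ltb_spec p d); lia.
Qed.

Lemma sym_match i p q p' : p < L -> p' < L ->
  xs (i * L + p) = ys (q * L + p') ->
  (p = p' /\ p < d) \/ (p = p' + d /\ d <= p' < 3 * d + 1).
Proof.
  intros Hp Hp'. rewrite text_sym_block, pattern_sym_block by auto. unfold blk in *.
  cbv zeta.
  repeat match goal with
  | |- context [?a <? ?b] => destruct (Nat.ltb_spec a b)
  | |- context [if ?b then _ else _] => destruct b
  end; lia.
Qed.

Lemma align_skip_block a i q :
  align a (seg xs (i * L) L) (seg ys (q * L) L) (INR (mismatches xs ys (i * L) (q * L) L) / a) /\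
  mismatches xs ys (i * L) (q * L) L <= 3 * d + 1.
Proof.
  split; [apply align_hamming|].
  assert (EL : L = d + (3 * d + 1)) by (unfold blk; lia). rewrite EL at 3.
  rewrite mismatches_app, mismatches_0 by (intros; now apply separator_match).
  apply mismatches_le.
Qed.

Lemma align_visit_block (a : R) i q : (1 <= a)%R ->
  exists r, align a (seg xs (i * L) (2 * L)) (seg ys (q * L) L) r /\
  (r <= INR L + INR (2 * d + dot d (U i) (V q) + (if E q then 0 else 1)) / a)%R.
Proof.
  intros Ha. assert (0 < / a)%R by (apply Rinv_0_lt_compat; lra).
  replace (2 * L) with (d + (d + ((2 * d + 1) + (d + (L - d))))) by (unfold blk; lia).
  replace (seg ys (q * L) L) with (seg ys (q * L) (d + (0 + ((2 * d + 1) + (d + 0)))))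
    by (f_equal; unfold blk; lia).
  remember (2 * d + 1) as w eqn:Ew.
  rewrite !(seg_app xs), !(seg_app ys).
  eexists; split.
  - apply align_app; [apply align_hamming|].
    apply align_app; [apply align_drop|].
    apply align_app; [apply align_hamming|].
    apply align_app; [apply align_hamming|].
    apply align_drop.
  - rewrite mismatches_0 by (intros; now apply separator_match).
    replace (i * L + d + d) with (i * L + 2 * d) by lia.
    rewrite Nat.add_0_r, Ew, cell_mismatches.
    match goal with |- context [mismatches ?f ?g ?x ?y d] =>
      pose proof (mismatches_le f g x y d) as Hm; apply le_INR in Hm;
      set (M := mismatches f g x y d) in * end.
    replace (2 * d + dot d (U i) (V q) + (if E q then 0 else 1))
      with (d + (d + dot d (U i) (V q) + (if E q then 0 else 1))) by lia.
    rewrite (plus_INR d (_ + _)). rewrite minus_INR by (unfold blk; lia).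
    unfold Rdiv. simpl (INR 0). nra.
Qed.
End Cells.

Section LowerBound.
Variables (d : nat) (U : nat -> nat -> bool) (E : nat -> bool) (V : nat -> nat -> bool).
Notation L := (blk d).
Notation xs := (text_sym d U).
Notation ys := (pattern_sym d E V).
Hypothesis no_orth : forall i q, E q = true -> 1 <= dot d (U i) (V q).

Definition cell_rest (i q s : nat) : nat :=
  2 * d + 1 - s - mismatches xs ys (i * L + 2 * d + s) (q * L + d + s) (2 * d + 1 - s).

Lemma cell_rest_0 i q : cell_rest i q 0 <= d.
Proof.
  unfold cell_rest. rewrite !Nat.add_0_r, Nat.sub_0_r, cell_mismatches.
  specialize (no_orth i q). destruct (E q); [specialize (no_orth eq_refl)|]; lia.
Qed.

Lemma cell_rest_S i q s : s < 2 * d + 1 ->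
  cell_rest i q s =
  Nat.b2n (xs (i * L + 2 * d + s) =? ys (q * L + d + s)) + cell_rest i q (S s).
Proof.
  intros Hs. unfold cell_rest.
  replace (2 * d + 1 - s) with (S (2 * d + 1 - S s)) by lia.
  cbn [mismatches]. rewrite !Nat.add_succ_r.
  match goal with |- context [mismatches ?f ?g ?x ?y ?m] =>
    pose proof (mismatches_le f g x y m) end.
  destruct (_ =? _); cbn [negb Nat.b2n]; lia.
Qed.

Lemma cell_rest_le i q s : s <= 2 * d + 1 -> cell_rest i q s <= d.
Proof.
  induction s as [|s IH]; intros Hs; [apply cell_rest_0|].
  pose proof (cell_rest_S i q s ltac:(lia)). specialize (IH ltac:(lia)). lia.
Qed.

Definition seps_before (y : nat) : nat := y / L * d + Nat.min (y mod L) d.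

Definition gain (t : Z) (y : nat) : nat :=
  let q := y / L in
  let p := y mod L in
  if p <? d then p
  else if p <? 3 * d + 1 then cell_rest (Z.to_nat (Z.of_nat q + t)) q (p - d)
  else 0.

Lemma gain_le t y : gain t y <= d.
Proof.
  unfold gain. destruct (Nat.ltb_spec (y mod L) d); [lia|].
  destruct (Nat.ltb_spec (y mod L) (3 * d + 1)); [|lia]. apply cell_rest_le; lia.
Qed.

Lemma divmod_S y :
  (S y mod L = S (y mod L) /\ S y / L = y / L /\ S (y mod L) < L) \/
  (S y mod L = 0 /\ S y / L = S (y / L) /\ S (y mod L) = L).
Proof.
  assert (HL : L <> 0) by (unfold blk; lia).
  pose proof (Nat.div_mod y L HL) as Ey. pose proof (Nat.mod_upper_bound y L HL).
  set (q := y / L) in *. set (p := y mod L) in *.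
  destruct (Nat.lt_ge_cases (S p) L).
  - left. replace (S y) with (q * L + S p) by lia.
    destruct (block_divmod L q (S p)); auto.
  - right. replace (S y) with (S q * L + 0) by lia.
    destruct (block_divmod L (S q) 0); [lia|]. repeat split; auto. lia.
Qed.

Lemma gain_step y : exists sg,
  seps_before (S y) = seps_before y + sg /\ (sg = 0 \/ sg = 1) /\
  (forall t, gain t (S y) <= gain t y + sg) /\
  (forall x, xs x = ys y ->
     let o := (Z.of_nat x - Z.of_nat y)%Z in
     (sg = 1 /\ (o mod Z.of_nat L = 0)%Z) \/
     ((o mod Z.of_nat L = Z.of_nat d)%Z /\
      gain (o / Z.of_nat L) (S y) + 1 <= gain (o / Z.of_nat L) y)).
Proof.
  assert (HL : L <> 0) by (unfold blk; lia).
  pose proof (Nat.mod_upper_bound y L HL) as Hp.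
  pose proof (Nat.div_mod y L HL) as Ey.
  exists (if y mod L <? d then 1 else 0).
  assert (Estep : forall t, gain t (S y) <= gain t y + (if y mod L <? d then 1 else 0) /\
     (d <= y mod L < 3 * d + 1 ->
      gain t y = Nat.b2n (xs (Z.to_nat (Z.of_nat (y / L) + t) * L + y mod L + d) =? ys y)
                 + gain t (S y))).
  { intros t. unfold gain. destruct (divmod_S y) as [(-> & -> & Hs)|(-> & -> & Hs)].
    - set (q := y / L) in *; set (p := y mod L) in *.
      destruct (Nat.ltb_spec p d), (Nat.ltb_spec (S p) d); try lia.
      + destruct (Nat.ltb_spec (S p) (3 * d + 1)); [|lia]. replace (S p - d) with 0 by lia.
        pose proof (cell_rest_0 (Z.to_nat (Z.of_nat q + t)) q). lia.
      + destruct (Nat.ltb_spec p (3 * d + 1)).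
        * pose proof (cell_rest_S (Z.to_nat (Z.of_nat q + t)) q (p - d) ltac:(lia)) as Hc.
          replace (q * L + d + (p - d)) with y in Hc by lia.
          replace (Z.to_nat (Z.of_nat q + t) * L + 2 * d + (p - d))
            with (Z.to_nat (Z.of_nat q + t) * L + p + d) in Hc by lia.
          rewrite Hc.
          replace (S (p - d)) with (S p - d) by lia.
          destruct (Nat.ltb_spec (S p) (3 * d + 1)); [lia|].
          assert (cell_rest (Z.to_nat (Z.of_nat q + t)) q (S p - d) = 0) by (unfold cell_rest; lia).
          lia.
        * destruct (Nat.ltb_spec (S p) (3 * d + 1)); lia.
    - set (p := y mod L) in *. assert (S p = 4 * d + 1) by exact Hs. clear Hs.
      destruct (Nat.ltb_spec 0 d), (Nat.ltb_spec p d); try lia.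
      destruct (Nat.ltb_spec p (3 * d + 1)), (Nat.ltb_spec 0 (3 * d + 1)); try lia.
        assert (d = 0) by lia.
        pose proof (cell_rest_le (Z.to_nat (Z.of_nat (S (y / L)) + t)) (S (y / L)) 0 ltac:(lia)).
        pose proof (cell_rest_le (Z.to_nat (Z.of_nat (y / L) + t)) (y / L) (p - d) ltac:(lia)).
        pose proof (cell_rest_S (Z.to_nat (Z.of_nat (y / L) + t)) (y / L) (p - d) ltac:(lia)) as Hc.
        replace (y / L * L + d + (p - d)) with y in Hc by lia.
        replace (Z.to_nat (Z.of_nat (y / L) + t) * L + 2 * d + (p - d))
            with (Z.to_nat (Z.of_nat (y / L) + t) * L + p + d) in Hc by lia.
        replace (0 - d) with 0 by lia. lia. }
  split; [|split; [|split]].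
  - unfold seps_before. destruct (divmod_S y) as [(-> & -> & Hs)|(-> & -> & Hs)].
    + destruct (Nat.ltb_spec (y mod L) d); lia.
    + assert (S (y mod L) = 4 * d + 1) by exact Hs. destruct (Nat.ltb_spec (y mod L) d); lia.
  - destruct (_ <? _); auto.
  - intros t. apply Estep.
  - intros x Hxy o.
    pose proof (Nat.mod_upper_bound x L HL) as Hp'.
    pose proof (Nat.div_mod x L HL) as Ex.
    assert (Hxy' : xs (x / L * L + x mod L) = ys (y / L * L + y mod L)).
    { rewrite (Nat.mul_comm (x / L)), (Nat.mul_comm (y / L)), <- Ex, <- Ey. exact Hxy. }
    destruct (sym_match _ _ _ _ _ _ _ _ Hp' Hp Hxy') as [[E1 E2]|[E1 E2]].
    + left. split; [destruct (Nat.ltb_spec (y mod L) d); lia|].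
      unfold o. replace (Z.of_nat x - Z.of_nat y)%Z
        with ((Z.of_nat (x / L) - Z.of_nat (y / L)) * Z.of_nat L)%Z by nia.
      apply Z_mod_mult.
    + right.
      assert (Eo : o = (Z.of_nat d + (Z.of_nat (x / L) - Z.of_nat (y / L)) * Z.of_nat L)%Z)
        by (unfold o; nia).
      assert (Em : (o mod Z.of_nat L = Z.of_nat d)%Z).
      { rewrite Eo, Z_mod_plus_full. apply Z.mod_small. unfold blk; lia. }
      assert (Ed : (o / Z.of_nat L = Z.of_nat (x / L) - Z.of_nat (y / L))%Z).
      { rewrite Eo, Z_div_plus_full by lia. rewrite Z.div_small; [lia|unfold blk; lia]. }
      split; [exact Em|]. rewrite Ed.
      destruct (Estep (Z.of_nat (x / L) - Z.of_nat (y / L))%Z) as [_ ->]; [|auto].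
      replace (Z.to_nat _) with (x / L) by lia.
      replace (x / L * L + y mod L + d) with x by lia.
      rewrite Hxy, Nat.eqb_refl. cbn. lia.
Qed.

(** Best gain on the current period of offsets: at distance [rho] past the separator
    offset one can either return to it by [rho] insertions and then collect [d] matches, or
    collect the [e] matches left in the current cell, at offset [d]. *)
Definition offset_gain (rho e : Z) : Z :=
  Z.max 0 (Z.max (Z.of_nat d - rho) (Z.min e (e - (rho - Z.of_nat d)))).

Definition potential (N1 NY x y : nat) : Z :=
  let o := (Z.of_nat x - Z.of_nat y)%Z in
  let t := (o / Z.of_nat L)%Z in
  (Z.of_nat (NY * d) - Z.of_nat (seps_before y)
   + Z.of_nat d * (Z.of_nat N1 - t - 1)
   + offset_gain (o mod Z.of_nat L) (Z.of_nat (gain t y)))%Z.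

Lemma Zdivmod_succ (o : Z) :
  let l := Z.of_nat L in
  ((o + 1) mod l = o mod l + 1 /\ (o + 1) / l = o / l /\ o mod l + 1 < l)%Z \/
  ((o + 1) mod l = 0 /\ (o + 1) / l = o / l + 1 /\ o mod l + 1 = l)%Z.
Proof.
  intros l. assert (Hl : (0 < l)%Z) by (unfold l, blk; lia).
  pose proof (Z.div_mod o l ltac:(lia)) as Eo. pose proof (Z.mod_pos_bound o l Hl).
  set (q := (o / l)%Z) in *. set (p := (o mod l)%Z) in *.
  destruct (Z.lt_ge_cases (p + 1) l).
  - left. assert (o + 1 = l * q + (p + 1))%Z as E1 by lia.
    split; [|split; [|lia]].
    + symmetry. apply (Z.mod_unique_pos _ _ q); lia.
    + symmetry. apply (Z.div_unique_pos _ _ _ (p + 1)); lia.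
  - right. assert (o + 1 = l * (q + 1) + 0)%Z as E1 by lia.
    split; [|split; [|lia]].
    + symmetry. apply (Z.mod_unique_pos _ _ (q + 1)); lia.
    + symmetry. apply (Z.div_unique_pos _ _ _ 0); lia.
Qed.

Lemma pattern_lower_bound (a : R) (N1 NY : nat) r :
  (1 <= a)%R ->
  align a (seg xs 0 ((NY + N1) * L)) (seg ys 0 (NY * L)) r ->
  (a * INR (N1 * L) + INR (NY * L) - INR (NY * d + d * N1) <= a * r)%R.
Proof.
  intros Ha Hr.
  assert (HL : (0 < Z.of_nat L)%Z) by (unfold blk; lia).
  assert (HLd : (Z.of_nat L = 4 * Z.of_nat d + 1)%Z) by (unfold blk; lia).
  assert (H := align_potential a xs ys (potential N1 NY) ((NY + N1) * L) (NY * L) Ha).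
  cut (a * (INR ((NY + N1) * L) - INR (NY * L)) + INR (NY * L) - IZR (potential N1 NY 0 0) <= a * r)%R.
  { intros C.
    assert (EP : IZR (potential N1 NY 0 0) = INR (NY * d + d * N1)).
    { rewrite INR_IZR_INZ. f_equal. unfold potential.
      change (Z.of_nat 0 - Z.of_nat 0)%Z with 0%Z. rewrite Z.div_0_l, Z.mod_0_l by lia.
      unfold seps_before. rewrite Nat.Div0.div_0_l, Nat.Div0.mod_0_l.
      pose proof (gain_le 0 0). unfold offset_gain. nia. }
    rewrite EP in C. replace (INR (N1 * L)) with (INR ((NY + N1) * L) - INR (NY * L))%R; [exact C|].
    rewrite Nat.mul_add_distr_r, plus_INR. ring. }
  apply H; [| | | |exact Hr]; clear H Hr.
  - intros x y _. unfold potential.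
    replace (Z.of_nat (S x) - Z.of_nat y)%Z with (Z.of_nat x - Z.of_nat y + 1)%Z by lia.
    set (o := (Z.of_nat x - Z.of_nat y)%Z).
    pose proof (Z.mod_pos_bound o _ HL).
    pose proof (gain_le (o / Z.of_nat L) y). pose proof (gain_le (o / Z.of_nat L + 1) y).
    unfold offset_gain.
    destruct (Zdivmod_succ o) as [(-> & -> & ?)|(-> & -> & ?)]; nia.
  - intros x y _. unfold potential.
    replace (Z.of_nat x - Z.of_nat y)%Z with (Z.of_nat x - Z.of_nat (S y) + 1)%Z by lia.
    set (o := (Z.of_nat x - Z.of_nat (S y))%Z).
    pose proof (Z.mod_pos_bound o _ HL).
    destruct (gain_step y) as (sg & -> & Hsg & Hg & _).
    pose proof (Hg (o / Z.of_nat L)%Z).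
    pose proof (gain_le (o / Z.of_nat L) (S y)). pose proof (gain_le (o / Z.of_nat L + 1) y).
    unfold offset_gain.
    destruct (Zdivmod_succ o) as [(-> & -> & ?)|(-> & -> & ?)]; nia.
  - intros x y _. unfold potential.
    replace (Z.of_nat (S x) - Z.of_nat (S y))%Z with (Z.of_nat x - Z.of_nat y)%Z by lia.
    set (o := (Z.of_nat x - Z.of_nat y)%Z).
    pose proof (Z.mod_pos_bound o _ HL).
    destruct (gain_step y) as (sg & -> & Hsg & Hg & Hm). specialize (Hm x).
    pose proof (Hg (o / Z.of_nat L)%Z).
    pose proof (gain_le (o / Z.of_nat L) (S y)). pose proof (gain_le (o / Z.of_nat L) y).
    unfold offset_gain.
    destruct (Nat.eqb_spec (xs x) (ys y)) as [Exy|]; cbn [Z.b2z]; [|nia].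
    cbv zeta in Hm. fold o in Hm. destruct (Hm Exy) as [[-> ->]|[-> Hm']]; nia.
  - unfold potential.
    replace (Z.of_nat ((NY + N1) * L) - Z.of_nat (NY * L))%Z with (Z.of_nat N1 * Z.of_nat L)%Z by nia.
    rewrite Z_div_mult, Z_mod_mult by lia.
    replace (NY * L) with (NY * L + 0) by lia.
    unfold seps_before. destruct (block_divmod L NY 0 ltac:(unfold blk; lia)) as [-> ->].
    unfold offset_gain. nia.
Qed.
End LowerBound.

Section UpperBound.
Variables (a : R) (d : nat) (U : nat -> nat -> bool) (E : nat -> bool) (V : nat -> nat -> bool).
Notation L := (blk d).
Notation xs := (text_sym d U).
Notation ys := (pattern_sym d E V).
Hypothesis Ha : (1 <= a)%R.

(** Some alignment consumes [q] blocks of [Y] after passing [t] cells, gaining [d]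
    matches at each of them and [b] more. *)
Definition reach (t q b : nat) : Prop :=
  exists r, align a (seg xs 0 ((q + t) * L)) (seg ys 0 (q * L)) r /\
  (a * r <= a * INR (t * L) + INR (q * (3 * d + 1)) - INR (d * t) - INR b)%R.

Lemma reach_skip t q b : reach t q b -> reach t (S q) b.
Proof.
  intros (r & H & Hr).
  destruct (align_skip_block d U E V a (q + t) q) as [H1 H2].
  eexists; split.
  - replace ((S q + t) * L) with ((q + t) * L + L) by lia.
    replace (S q * L) with (q * L + L) by lia.
    rewrite !(seg_app _ 0). apply align_app; [exact H|exact H1].
  - apply le_INR in H2. rewrite Nat.mul_succ_l, (plus_INR (q * _)).
    set (m := INR (mismatches _ _ _ _ _)) in *.
    replace (a * (r + m / a))%R with (a * r + m)%R by (field; lra). lra.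
Qed.

Lemma reach_visit t q b b' :
  dot d (U (q + t)) (V q) + (if E q then 0 else 1) + b' <= 1 + b ->
  reach t q b -> reach (S t) (S q) b'.
Proof.
  intros Hb (r & H & Hr).
  destruct (align_visit_block d U E V a (q + t) q Ha) as (r1 & H1 & H2).
  exists (r + r1)%R; split.
  - replace ((S q + S t) * L) with ((q + t) * L + 2 * L) by lia.
    replace (S q * L) with (q * L + L) by lia.
    rewrite !(seg_app _ 0). apply align_app; [exact H|exact H1].
  - rewrite <- Nat.add_assoc in H2. apply le_INR in Hb.
    set (c := dot d _ _ + _) in *.
    rewrite !plus_INR in *.
    replace (S t * L) with (t * L + L) by lia.
    replace (S q * (3 * d + 1)) with (q * (3 * d + 1) + (2 * d + d + 1)) by lia.
    replace (d * S t) with (d * t + d) by lia.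
    rewrite !plus_INR.
    apply (Rmult_le_compat_l a) in H2; [|lra].
    replace (a * (INR L + (INR (2 * d) + INR c) / a))%R
      with (a * INR L + INR (2 * d) + INR c)%R in H2 by (field; lra).
    simpl (INR 1) in *. lra.
Qed.

Lemma reach_skips m t q b : reach t q b -> reach t (q + m) b.
Proof.
  intros H; induction m as [|m IH]; [now rewrite Nat.add_0_r|].
  rewrite Nat.add_succ_r. now apply reach_skip.
Qed.

Lemma reach_visits m t q b :
  (forall q', q <= q' < q + m -> E q' = false /\ forall p, V q' p = false) ->
  reach t q b -> reach (t + m) (q + m) b.
Proof.
  intros HE H; induction m as [|m IH]; [now rewrite !Nat.add_0_r|].
  rewrite !Nat.add_succ_r. destruct (HE (q + m) ltac:(lia)) as [H1 H2].
  apply (reach_visit _ _ b).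
  - rewrite H1. unfold dot. erewrite map_ext.
    2:{ intros p. rewrite H2, andb_false_r. reflexivity. }
    enough (forall l : list nat, list_sum (map (fun _ => Nat.b2n false) l) = 0) as -> by lia.
    induction l; auto.
  - apply IH. intros; apply HE; lia.
Qed.

Lemma pattern_upper_bound N1 N2 t j :
  t < N1 -> j < N2 ->
  (forall q, q < N1 \/ N1 + N2 <= q -> E q = false /\ forall p, V q p = false) ->
  E (N1 + j) = true -> dot d (U (N1 + j + t)) (V (N1 + j)) = 0 ->
  let NY := N2 + 2 * N1 in
  exists r, align a (seg xs 0 ((NY + N1) * L)) (seg ys 0 (NY * L)) r /\
  (a * r <= a * INR (N1 * L) + INR (NY * L) - INR (NY * d + d * N1) - 1)%R.
Proof.
  intros Ht Hj HW HE Hdot NY.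
  assert (H0 : reach 0 0 0).
  { exists 0%R. split; [constructor|]. rewrite Nat.mul_0_r. simpl. lra. }
  apply (reach_visits t) in H0; [|intros; apply HW; lia]. cbn [plus] in H0.
  apply (reach_skips (N1 + j - t)) in H0.
  replace (t + (N1 + j - t)) with (N1 + j) in H0 by lia.
  apply (reach_visit _ _ _ 1) in H0; [|rewrite HE, Hdot; lia].
  apply (reach_skips (N2 - S j)) in H0.
  replace (S (N1 + j) + (N2 - S j)) with (N1 + N2) in H0 by lia.
  apply (reach_visits (N1 - S t)) in H0; [|intros; apply HW; lia].
  replace (S t + (N1 - S t)) with N1 in H0 by lia.
  apply (reach_skips (S t)) in H0.
  replace (N1 + N2 + (N1 - S t) + S t) with NY in H0 by (unfold NY; lia).
  destruct H0 as (r & H & Hr). exists r. split; [exact H|].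
  replace (INR (NY * L)) with (INR (NY * (3 * d + 1)) + INR (NY * d))%R
    by (rewrite <- plus_INR; f_equal; unfold blk; lia).
  rewrite plus_INR. simpl (INR 1) in Hr. lra.
Qed.
End UpperBound.

Local Open Scope nat_scope.

Lemma exec_det w p s t1 s1 : exec w p s t1 s1 ->
  forall t2 s2, exec w p s t2 s2 -> s1 = s2.
Proof.
  induction 1; intros t' s'' H'; inversion H'; subst; try congruence.
  - match goal with H : exec w p s1 _ _ |- _ => apply IHexec1 in H; subst end.
    eapply IHexec2; eauto.
  - eapply IHexec; eauto.
  - eapply IHexec; eauto.
  - match goal with H : exec w p s1 _ _ |- _ => apply IHexec1 in H; subst end.
    eapply IHexec2; eauto.
Qed.

Lemma eval_lt w s e : eval w s e < 2 ^ w.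
Proof. destruct e; apply Nat.mod_upper_bound, Nat.pow_nonzero; lia. Qed.

Lemma exec_var_lt w p s t s' : exec w p s t s' ->
  (forall x, var s x < 2 ^ w) -> forall x, var s' x < 2 ^ w.
Proof.
  induction 1; simpl; intros Hs y; auto.
  unfold upd. destruct (y =? x); auto using eval_lt.
Qed.

(** * Locality of reads *)

Fixpoint esize (e : expr) : nat :=
  match e with
  | Const _ | Var _ => 0
  | Get _ i => S (esize i)
  | Bin _ e1 e2 => esize e1 + esize e2
  end.

Fixpoint csize (p : cmd) : nat :=
  match p with
  | Skip => 0
  | Assign _ e => esize e
  | Put _ i e => esize i + esize e
  | Seq p q => csize p + csize q
  | If e p q => esize e + csize p + csize q
  | While e p => esize e + csize p
  end.

Fixpoint reads (B w : nat) (s : state) (e : expr) : list nat :=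
  match e with
  | Const _ | Var _ => []
  | Get A i => (if A =? B then [eval w s i] else []) ++ reads B w s i
  | Bin _ e1 e2 => reads B w s e1 ++ reads B w s e2
  end.

Lemma length_reads B w s e : length (reads B w s e) <= esize e.
Proof.
  induction e; simpl; auto.
  - rewrite length_app. destruct (A =? B); simpl; lia.
  - rewrite length_app. lia.
Qed.

Definition agree (B j : nat) (s s' : state) : Prop :=
  (forall x, var s x = var s' x) /\
  (forall A i, A <> B \/ i <> j -> arr s A i = arr s' A i).

Lemma eval_agree B j w s s' e : agree B j s s' -> ~ In j (reads B w s e) ->
  eval w s e = eval w s' e.
Proof.
  intros [Hv Ha]; induction e; simpl; intros Hj.
  - reflexivity.
  - now rewrite Hv.
  - rewrite in_app_iff in Hj. rewrite <- IHe by tauto. rewrite Ha; auto.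
    destruct (Nat.eqb_spec A B); [|auto]. simpl in Hj. right. intros E. tauto.
  - rewrite in_app_iff in Hj. rewrite IHe1, IHe2 by tauto. reflexivity.
Qed.

Lemma exec_agree B w p s t s1 : exec w p s t s1 ->
  exists l, length l <= csize p * t /\
  forall j s', ~ In j l -> agree B j s s' ->
  exists s1', exec w p s' t s1' /\ agree B j s1 s1'.
Proof.
  induction 1 as [s|s x e|s A i e|p q s1 s2 s3 t1 t2 H1 (l1 & L1 & I1) H2 (l2 & L2 & I2)
    |e p q s t s1 He H (l & Ll & I)|e p q s t s1 He H (l & Ll & I)|e p s He
    |e p s1 s2 s3 t1 t2 He H1 (l1 & L1 & I1) H2 (l2 & L2 & I2)]; simpl in *.
  - exists []; simpl; split; [lia|]. intros j s' _ Ha. exists s'; split; [constructor|auto].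
  - exists (reads B w s e). split; [pose proof (length_reads B w s e); lia|].
    intros j s' Hj Ha. exists (set_var s' x (eval w s' e)). split; [constructor|].
    rewrite <- (eval_agree _ _ _ _ _ _ Ha Hj). destruct Ha as [Hv Hr].
    split; [|exact Hr]. intros y. simpl. unfold upd. destruct (y =? x); auto.
  - exists (reads B w s i ++ reads B w s e).
    split; [rewrite length_app; pose proof (length_reads B w s e); pose proof (length_reads B w s i); lia|].
    intros j s' Hj Ha. rewrite in_app_iff in Hj.
    exists (set_arr s' A (eval w s' i) (eval w s' e)). split; [constructor|].
    rewrite <- (eval_agree _ _ _ _ _ i Ha), <- (eval_agree _ _ _ _ _ e Ha) by tauto.
    destruct Ha as [Hv Hr]. split; [exact Hv|]. intros C k Hk. simpl. unfold upd.
    destruct (Nat.eqb_spec C A); [|auto]. subst. destruct (k =? _); auto.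
  - exists (l1 ++ l2). split; [rewrite length_app; nia|].
    intros j s' Hj Ha. rewrite in_app_iff in Hj.
    destruct (I1 j s' ltac:(tauto) Ha) as (s2' & E1 & A1).
    destruct (I2 j s2' ltac:(tauto) A1) as (s3' & E2 & A2).
    exists s3'; split; [econstructor; eauto|auto].
  - exists (reads B w s e ++ l).
    split; [rewrite length_app; pose proof (length_reads B w s e); nia|].
    intros j s' Hj Ha. rewrite in_app_iff in Hj.
    destruct (I j s' ltac:(tauto) Ha) as (s1' & E1 & A1).
    exists s1'; split; [|auto]. apply exec_if_true; auto.
    rewrite <- (eval_agree _ _ _ _ _ _ Ha); tauto.
  - exists (reads B w s e ++ l).
    split; [rewrite length_app; pose proof (length_reads B w s e); nia|].
    intros j s' Hj Ha. rewrite in_app_iff in Hj.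
    destruct (I j s' ltac:(tauto) Ha) as (s1' & E1 & A1).
    exists s1'; split; [|auto]. apply exec_if_false; auto.
    rewrite <- (eval_agree _ _ _ _ _ _ Ha); tauto.
  - exists (reads B w s e). split; [pose proof (length_reads B w s e); nia|].
    intros j s' Hj Ha. exists s'; split; [|auto]. apply exec_while_false.
    rewrite <- (eval_agree _ _ _ _ _ _ Ha); tauto.
  - exists (reads B w s1 e ++ l1 ++ l2).
    split; [rewrite !length_app; pose proof (length_reads B w s1 e); nia|].
    intros j s' Hj Ha. rewrite !in_app_iff in Hj.
    destruct (I1 j s' ltac:(tauto) Ha) as (s2' & E1 & A1).
    destruct (I2 j s2' ltac:(tauto) A1) as (s3' & E2 & A2).
    exists s3'; split; [|auto]. eapply exec_while_true; eauto.
    rewrite <- (eval_agree _ _ _ _ _ _ Ha); tauto.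
Qed.

(** * Running a program inside another one

    The host has a larger word size: variable [vM] holds the modulus [2 ^ w] of
    the guest, whose memory is the window of host memory starting at the address
    in variable [vB]. *)

Section Embed.
Variables (vo ao vM vB : nat).

Fixpoint embed_expr (e : expr) : expr :=
  Bin Mod
    (match e with
     | Const m => Const m
     | Var x => Var (vo + x)
     | Get A i => Get (ao + A) (Bin Add (embed_expr i) (Var vB))
     | Bin o e1 e2 => Bin o (embed_expr e1) (embed_expr e2)
     end) (Var vM).

Fixpoint embed (p : cmd) : cmd :=
  match p with
  | Skip => Skip
  | Assign x e => Assign (vo + x) (embed_expr e)
  | Put A i e => Put (ao + A) (Bin Add (embed_expr i) (Var vB)) (embed_expr e)
  | Seq p q => Seq (embed p) (embed q)
  | If e p q => If (embed_expr e) (embed p) (embed q)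
  | While e p => While (embed_expr e) (embed p)
  end.

Fixpoint expr_bound (e : expr) : nat :=
  match e with
  | Const _ => 0
  | Var x => S x
  | Get _ i => expr_bound i
  | Bin _ e1 e2 => Nat.max (expr_bound e1) (expr_bound e2)
  end.

Fixpoint var_bound (p : cmd) : nat :=
  match p with
  | Skip => 0
  | Assign x e => Nat.max (S x) (expr_bound e)
  | Put _ i e => Nat.max (expr_bound i) (expr_bound e)
  | Seq p q => Nat.max (var_bound p) (var_bound q)
  | If e p q => Nat.max (expr_bound e) (Nat.max (var_bound p) (var_bound q))
  | While e p => Nat.max (expr_bound e) (var_bound p)
  end.

Definition embedded (m W base : nat) (s s' : state) : Prop :=
  (forall x, x < m -> var s' (vo + x) = var s x) /\
  (forall A i, i < W -> arr s' (ao + A) (base + i) = arr s A i).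

Definition frame (lim : nat) (s s' : state) : Prop :=
  (forall x, x < vo -> var s' x = var s x) /\
  (forall A i, A < ao \/ lim <= i -> arr s' A i = arr s A i).

Variables (w w' m base : nat).
Hypothesis (Hw : w < w') (HM : vM < vo) (HB : vB < vo) (Hbase : base + 2 ^ w <= 2 ^ w').

Lemma eval_embed_expr e s s' : expr_bound e <= m -> var s' vM = 2 ^ w -> var s' vB = base ->
  embedded m (2 ^ w) base s s' -> eval w' s' (embed_expr e) = eval w s e.
Proof.
  intros Hm EM EB [Hv Hr].
  assert (H0 : 2 ^ w <> 0) by (apply Nat.pow_nonzero; lia).
  assert (H0' : 2 ^ w' <> 0) by (apply Nat.pow_nonzero; lia).
  assert (Hlt : 2 ^ w < 2 ^ w') by (apply Nat.pow_lt_mono_r; lia).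
  assert (Hmod : forall z, (z mod 2 ^ w') mod 2 ^ w = z mod 2 ^ w).
  { intros z. replace w' with (w + (w' - w)) by lia. rewrite Nat.pow_add_r.
    rewrite Nat.Div0.mod_mul_r, (Nat.mul_comm (2 ^ w)), Nat.Div0.mod_add.
    apply Nat.Div0.mod_mod. }
  assert (Hfin : forall z, (z mod 2 ^ w' mod (2 ^ w mod 2 ^ w')) mod 2 ^ w' = z mod 2 ^ w).
  { intros z. rewrite (Nat.mod_small (2 ^ w)) by auto. rewrite Hmod.
    apply Nat.mod_small. pose proof (Nat.mod_upper_bound z (2 ^ w) H0). lia. }
  revert Hm; induction e; simpl; intros Hm; rewrite EM.
  - apply Hfin.
  - rewrite Hfin, Hv by lia. reflexivity.
  - rewrite Hfin, IHe, EB by auto. pose proof (eval_lt w s e).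
    rewrite (Nat.mod_small base), (Nat.mod_small (eval w s e + base)) by lia.
    rewrite (Nat.add_comm (eval w s e)), Hr by auto. reflexivity.
  - rewrite Hfin, IHe1, IHe2 by lia. reflexivity.
Qed.

Lemma exec_embed p s t s1 : exec w p s t s1 -> var_bound p <= m ->
  forall h, var h vM = 2 ^ w -> var h vB = base -> embedded m (2 ^ w) base s h ->
  exists h1, exec w' (embed p) h t h1 /\ embedded m (2 ^ w) base s1 h1 /\
    frame (base + 2 ^ w) h h1.
Proof.
  assert (Ftrans : forall s1 s2 s3, frame (base + 2 ^ w) s1 s2 -> frame (base + 2 ^ w) s2 s3 ->
    frame (base + 2 ^ w) s1 s3).
  { intros ? ? ? [F1 F2] [G1 G2]. split; intros; [rewrite G1|rewrite G2]; auto. }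
  assert (Frefl : forall s, frame (base + 2 ^ w) s s) by (split; auto).
  induction 1; cbn [var_bound embed]; intros Hm h EM EB Hs.
  - exists h; repeat split; try apply Hs; auto. constructor.
  - exists (set_var h (vo + x) (eval w' h (embed_expr e))). split; [constructor|].
    rewrite (eval_embed_expr e s h) by (auto; lia). destruct Hs as [Hv Hr].
    split; [split|split]; simpl; auto.
    + intros y Hy. unfold upd.
      destruct (Nat.eqb_spec y x), (Nat.eqb_spec (vo + y) (vo + x)); auto; lia.
    + intros y Hy. unfold upd. destruct (Nat.eqb_spec y (vo + x)); auto; lia.
  - exists (set_arr h (ao + A) (eval w' h (Bin Add (embed_expr i) (Var vB))) (eval w' h (embed_expr e))).
    split; [constructor|].
    pose proof (eval_lt w s i).
    assert (EI : eval w' h (Bin Add (embed_expr i) (Var vB)) = eval w s i + base).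
    { cbn [eval eval_binop]. rewrite (eval_embed_expr i s h), EB by (auto; lia).
      rewrite (Nat.mod_small base), Nat.mod_small by lia. reflexivity. }
    rewrite EI, (eval_embed_expr e s h) by (auto; lia).
    destruct Hs as [Hv Hr].
    split; [split|split]; simpl; auto.
    + intros C k Hk. unfold upd.
      destruct (Nat.eqb_spec C A), (Nat.eqb_spec (ao + C) (ao + A)); try lia; auto. subst C.
      destruct (Nat.eqb_spec k (eval w s i)), (Nat.eqb_spec (base + k) (eval w s i + base)); try lia; auto.
    + intros C k Hk. unfold upd.
      destruct (Nat.eqb_spec C (ao + A)); auto. subst C.
      destruct (Nat.eqb_spec k (eval w s i + base)); auto; lia.
  - destruct (IHexec1 ltac:(lia) h EM EB Hs) as (h2 & E1 & R1 & F1).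
    destruct (IHexec2 ltac:(lia) h2) as (h3 & E2 & R2 & F2); auto.
    1,2: destruct F1 as [-> _]; auto.
    exists h3; repeat split; eauto; try apply R2. econstructor; eauto.
    1,2: eapply Ftrans; eauto.
  - destruct (IHexec ltac:(lia) h EM EB Hs) as (h2 & E1 & R1 & F1).
    exists h2; split; [|auto]. apply exec_if_true; auto.
    rewrite (eval_embed_expr e s h) by (auto; lia). auto.
  - destruct (IHexec ltac:(lia) h EM EB Hs) as (h2 & E1 & R1 & F1).
    exists h2; split; [|auto]. apply exec_if_false; auto.
    rewrite (eval_embed_expr e s h) by (auto; lia). auto.
  - exists h; split; [|auto]. apply exec_while_false.
    rewrite (eval_embed_expr e s h) by (auto; lia). auto.
  - destruct (IHexec1 ltac:(lia) h EM EB Hs) as (h2 & E1 & R1 & F1).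
    destruct (IHexec2 ltac:(cbn [var_bound]; lia) h2) as (h3 & E2 & R2 & F2); auto.
    1,2: destruct F1 as [-> _]; auto.
    exists h3; split; [|split; [auto|eapply Ftrans; eauto]]. eapply exec_while_true; eauto.
    rewrite (eval_embed_expr e s1 h) by (auto; lia). auto.
Qed.
End Embed.

(** * Running time bounds *)

Definition runs (w : nat) (p : cmd) (s : state) (T : nat) (Q : state -> Prop) : Prop :=
  exists t s', exec w p s t s' /\ t <= T /\ Q s'.

Lemma runs_weaken w p s T T' (Q Q' : state -> Prop) :
  runs w p s T Q -> T <= T' -> (forall s', Q s' -> Q' s') -> runs w p s T' Q'.
Proof. intros (t & s' & H & Ht & HQ) HT HQQ. exists t, s'. repeat split; auto; lia. Qed.

Lemma runs_skip w s (Q : state -> Prop) : Q s -> runs w Skip s 1 Q.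
Proof. intros H. exists 1, s. repeat split; auto. constructor. Qed.

Lemma runs_assign w x e v s (Q : state -> Prop) :
  eval w s e = v -> Q (set_var s x v) -> runs w (Assign x e) s 1 Q.
Proof. intros <- H. do 2 eexists. repeat split; [constructor|auto|auto]. Qed.

Lemma runs_put w A i e k v s (Q : state -> Prop) :
  eval w s i = k -> eval w s e = v -> Q (set_arr s A k v) -> runs w (Put A i e) s 1 Q.
Proof. intros <- <- H. do 2 eexists. repeat split; [constructor|auto|auto]. Qed.

Lemma runs_seq w p q s T1 T2 (Q : state -> Prop) :
  runs w p s T1 (fun s1 => runs w q s1 T2 Q) -> runs w (Seq p q) s (T1 + T2) Q.
Proof.
  intros (t1 & s1 & H1 & Ht1 & t2 & s2 & H2 & Ht2 & HQ).
  exists (t1 + t2), s2. repeat split; [econstructor; eauto|lia|auto].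
Qed.

Lemma runs_if w e p q s T (Q : state -> Prop) :
  (eval w s e <> 0 -> runs w p s T Q) -> (eval w s e = 0 -> runs w q s T Q) ->
  runs w (If e p q) s (S T) Q.
Proof.
  intros H1 H2. destruct (Nat.eq_dec (eval w s e) 0) as [E|E].
  - destruct (H2 E) as (t & s' & H & Ht & HQ). exists (S t), s'.
    repeat split; [now apply exec_if_false|lia|auto].
  - destruct (H1 E) as (t & s' & H & Ht & HQ). exists (S t), s'.
    repeat split; [now apply exec_if_true|lia|auto].
Qed.

Lemma runs_while w e p s N T (Inv : nat -> state -> Prop) :
  (forall z s, z < N -> Inv z s -> eval w s e <> 0 /\ runs w p s T (Inv (S z))) ->
  (forall s, Inv N s -> eval w s e = 0) ->
  Inv 0 s -> runs w (While e p) s (N * (S T) + 1) (Inv N).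
Proof.
  intros Hstep Hend.
  enough (G : forall m z s, z + m = N -> Inv z s -> runs w (While e p) s (m * S T + 1) (Inv N)).
  { intros H0. apply (G N 0); auto. }
  intros m; induction m as [|m IH]; intros z s0 Hz H.
  - rewrite Nat.add_0_r in Hz; subst z. exists 1, s0.
    repeat split; auto. apply exec_while_false; auto.
  - destruct (Hstep z s0 ltac:(lia) H) as (He & t1 & s1 & H1 & Ht1 & I1).
    destruct (IH (S z) s1 ltac:(lia) I1) as (t2 & s2 & H2 & Ht2 & I2).
    exists (S (t1 + t2)), s2. repeat split; [eapply exec_while_true; eauto|lia|auto].
Qed.

Fixpoint reset (vo m : nat) : cmd :=
  match m with
  | O => Skip
  | S m => Seq (reset vo m) (Assign (vo + m) (Const 0))
  end.

Lemma runs_reset w vo m s :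
  runs w (reset vo m) s (S m) (fun s' =>
    (forall x, x < vo -> var s' x = var s x) /\
    (forall x, x < m -> var s' (vo + x) = 0) /\ arr s' = arr s).
Proof.
  induction m as [|m IH].
  - apply runs_skip. repeat split; auto; lia.
  - cbn [reset]. replace (S (S m)) with (S m + 1) by lia. apply runs_seq.
    eapply runs_weaken; [exact IH|lia|]. intros s1 (H1 & H2 & H3).
    eapply runs_assign; [cbn; apply Nat.Div0.mod_0_l|]. cbn. unfold upd. repeat split; auto.
    + intros x Hx. destruct (Nat.eqb_spec x (vo + m)); [lia|auto].
    + intros x Hx. destruct (Nat.eqb_spec (vo + x) (vo + m)); [auto|apply H2; lia].
Qed.

(** * Evaluation without overflow *)

Lemma eval_const w s m : m < 2 ^ w -> eval w s (Const m) = m.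
Proof. apply Nat.mod_small. Qed.

Lemma eval_var w s x v : var s x = v -> v < 2 ^ w -> eval w s (Var x) = v.
Proof. intros <-. apply Nat.mod_small. Qed.

Lemma eval_get w s A i k v :
  eval w s i = k -> arr s A k = v -> v < 2 ^ w -> eval w s (Get A i) = v.
Proof. intros <- <-. apply Nat.mod_small. Qed.

Lemma eval_bin w s o e1 e2 x y :
  eval w s e1 = x -> eval w s e2 = y -> eval_binop o x y < 2 ^ w ->
  eval w s (Bin o e1 e2) = eval_binop o x y.
Proof. intros <- <-. apply Nat.mod_small. Qed.

Lemma eval_add w s e1 e2 x y :
  eval w s e1 = x -> eval w s e2 = y -> x + y < 2 ^ w -> eval w s (Bin Add e1 e2) = x + y.
Proof. apply (eval_bin w s Add). Qed.

Lemma eval_mul w s e1 e2 x y :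
  eval w s e1 = x -> eval w s e2 = y -> x * y < 2 ^ w -> eval w s (Bin Mul e1 e2) = x * y.
Proof. apply (eval_bin w s Mul). Qed.

Lemma eval_pow2 w s e1 e2 y :
  eval w s e1 = 1 -> eval w s e2 = y -> 2 ^ y < 2 ^ w -> eval w s (Bin Shl e1 e2) = 2 ^ y.
Proof.
  intros H1 H2 H. rewrite (eval_bin _ _ Shl _ _ _ _ H1 H2); cbn [eval_binop];
  rewrite Nat.shiftl_1_l; auto.
Qed.

Lemma eval_sub w s e1 e2 x y :
  eval w s e1 = x -> eval w s e2 = y -> eval w s (Bin Sub e1 e2) = x - y.
Proof.
  intros H1 H2. apply (eval_bin _ _ Sub _ _ _ _ H1 H2). cbn.
  pose proof (eval_lt w s e1). lia.
Qed.

Lemma eval_div w s e1 e2 x y :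
  eval w s e1 = x -> eval w s e2 = y -> eval w s (Bin Div e1 e2) = x / y.
Proof.
  intros H1 H2. apply (eval_bin _ _ Div _ _ _ _ H1 H2). cbn [eval_binop].
  pose proof (eval_lt w s e1). destruct y as [|y]; [cbn; lia|].
  pose proof (Nat.Div0.div_le_upper_bound x (S y) x). nia.
Qed.

Lemma eval_mod w s e1 e2 x y :
  eval w s e1 = x -> eval w s e2 = y -> eval w s (Bin Mod e1 e2) = x mod y.
Proof.
  intros H1 H2. apply (eval_bin _ _ Mod _ _ _ _ H1 H2). cbn [eval_binop].
  pose proof (eval_lt w s e1). pose proof (Nat.Div0.mod_le x y). lia.
Qed.

Lemma eval_ltb w s e1 e2 x y : 0 < w ->
  eval w s e1 = x -> eval w s e2 = y -> eval w s (Bin Lt e1 e2) = Nat.b2n (x <? y).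
Proof.
  intros Hw H1 H2. apply (eval_bin _ _ Lt _ _ _ _ H1 H2). cbn [eval_binop].
  pose proof (Nat.pow_le_mono_r 2 1 w). change (2 ^ 1) with 2 in *. destruct (x <? y); cbn; lia.
Qed.

Lemma eval_eqb w s e1 e2 x y : 0 < w ->
  eval w s e1 = x -> eval w s e2 = y -> eval w s (Bin Eq e1 e2) = Nat.b2n (x =? y).
Proof.
  intros Hw H1 H2. apply (eval_bin _ _ Eq _ _ _ _ H1 H2). cbn [eval_binop].
  pose proof (Nat.pow_le_mono_r 2 1 w). change (2 ^ 1) with 2 in *. destruct (x =? y); cbn; lia.
Qed.

Lemma runs_if_lt w e1 e2 x y p q s T (Q : state -> Prop) : 0 < w ->
  eval w s e1 = x -> eval w s e2 = y ->
  (x < y -> runs w p s T Q) -> (y <= x -> runs w q s T Q) ->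
  runs w (If (Bin Lt e1 e2) p q) s (S T) Q.
Proof.
  intros Hw H1 H2 Hp Hq. apply runs_if; rewrite (eval_ltb _ _ _ _ _ _ Hw H1 H2);
  destruct (Nat.ltb_spec x y); cbn; auto; lia.
Qed.

Lemma runs_if_eq w e1 e2 x y p q s T (Q : state -> Prop) : 0 < w ->
  eval w s e1 = x -> eval w s e2 = y ->
  (x = y -> runs w p s T Q) -> (x <> y -> runs w q s T Q) ->
  runs w (If (Bin Eq e1 e2) p q) s (S T) Q.
Proof.
  intros Hw H1 H2 Hp Hq. apply runs_if; rewrite (eval_eqb _ _ _ _ _ _ Hw H1 H2);
  destruct (Nat.eqb_spec x y); cbn; auto; lia.
Qed.

Lemma runs_if_nonzero w e v p q s T (Q : state -> Prop) : eval w s e = v ->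
  (v <> 0 -> runs w p s T Q) -> (v = 0 -> runs w q s T Q) ->
  runs w (If e p q) s (S T) Q.
Proof. intros <-. apply runs_if. Qed.

Ltac lookup := cbn [var arr set_var set_arr upd Nat.eqb]; first [eassumption | reflexivity].

Ltac evaluate :=
  lazymatch goal with
  | |- eval _ _ (Const _) = _ => apply eval_const
  | |- eval _ _ (Var _) = _ => eapply eval_var; [lookup|]
  | |- eval _ _ (Get _ _) = _ => eapply eval_get; [evaluate|lookup|]
  | |- eval _ _ (Bin Add _ _) = _ => eapply eval_add; [evaluate|evaluate|]
  | |- eval _ _ (Bin Mul _ _) = _ => eapply eval_mul; [evaluate|evaluate|]
  | |- eval _ _ (Bin Sub _ _) = _ => eapply eval_sub; [evaluate|evaluate]
  | |- eval _ _ (Bin Div _ _) = _ => eapply eval_div; [evaluate|evaluate]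
  | |- eval _ _ (Bin Mod _ _) = _ => eapply eval_mod; [evaluate|evaluate]
  | |- eval _ _ (Bin Lt _ _) = _ => eapply eval_ltb; [|evaluate|evaluate]
  | |- eval _ _ (Bin Eq _ _) = _ => eapply eval_eqb; [|evaluate|evaluate]
  | |- eval _ _ (Bin Shl _ _) = _ => eapply eval_pow2; [evaluate|evaluate|]
  | _ => idtac
  end.

Lemma runs_le w p s T T' (Q : state -> Prop) : runs w p s T Q -> T <= T' -> runs w p s T' Q.
Proof. intros H HT. eapply runs_weaken; eauto. Qed.

(** * The reduction *)

(** Host variables.  [vmod] and [vbase] are the modulus and the memory window of the
    current guest, successive windows being [vstride] apart; [vtheta] is [a] times the
    largest distance that certifies an orthogonal pair. *)
Local Notation vN := 0 (only parsing).
Local Notation vd := 1 (only parsing).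
Local Notation vfound := 2 (only parsing).
Local Notation vlog := 3 (only parsing).
Local Notation vtmp := 4 (only parsing).
Local Notation vmod := 5 (only parsing).
Local Notation vbase := 6 (only parsing).
Local Notation vstride := 7 (only parsing).
Local Notation vn := 8 (only parsing).
Local Notation va := 9 (only parsing).
Local Notation vk := 10 (only parsing).
Local Notation vL := 11 (only parsing).
Local Notation vN1 := 12 (only parsing).
Local Notation vN2 := 13 (only parsing).
Local Notation vcols := 14 (only parsing).
Local Notation vcalls := 15 (only parsing).
Local Notation vz := 16 (only parsing).
Local Notation vi := 17 (only parsing).
Local Notation vj := 18 (only parsing).
Local Notation vLX := 19 (only parsing).
Local Notation vLY := 20 (only parsing).
Local Notation vx := 21 (only parsing).
Local Notation vq := 22 (only parsing).
Local Notation vp := 23 (only parsing).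
Local Notation vs := 24 (only parsing).
Local Notation vsym := 25 (only parsing).
Local Notation vtheta := 26 (only parsing).
Local Notation vbit := 27 (only parsing).
Local Notation vmin := 28 (only parsing).
Local Notation guest := 29 (only parsing).

Definition text_code : cmd :=
  Seq (Assign vq (Bin Div (Var vx) (Var vL)))
  (Seq (Assign vp (Bin Mod (Var vx) (Var vL)))
  (If (Bin Lt (Var vp) (Var vd)) (Assign vsym (Var vp))
  (If (Bin Lt (Var vp) (Bin Mul (Const 2) (Var vd))) (Assign vsym (Var vL))
  (Seq (Assign vs (Bin Sub (Var vp) (Bin Mul (Const 2) (Var vd))))
  (If (Bin Mul (Bin Eq (Bin Mod (Var vs) (Const 2)) (Const 1))
        (Get 0 (Bin Add (Bin Mul (Bin Mod (Bin Add (Var vi) (Bin Mod (Var vq) (Var vN1))) (Var vN))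
                                 (Var vd))
                        (Bin Div (Var vs) (Const 2)))))
    (Assign vsym (Var vL)) (Assign vsym (Bin Sub (Var vp) (Var vd)))))))).

Definition pattern_code : cmd :=
  Seq (Assign vq (Bin Div (Var vx) (Var vL)))
  (Seq (Assign vp (Bin Mod (Var vx) (Var vL)))
  (Seq (Assign vsym (Bin Add (Var vL) (Const 1)))
  (If (Bin Lt (Var vp) (Var vd)) (Assign vsym (Var vp))
  (If (Bin Lt (Var vp) (Bin Add (Bin Mul (Const 3) (Var vd)) (Const 1)))
    (Seq (Assign vs (Bin Sub (Var vp) (Var vd)))
    (Seq (Assign vbit (Bin Mul (Bin Sub (Const 1) (Bin Lt (Var vq) (Var vN1)))
                               (Bin Lt (Var vq) (Bin Add (Var vN1) (Var vN2)))))
    (If (Bin Eq (Var vs) (Bin Mul (Const 2) (Var vd)))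
      (If (Var vbit) (Assign vsym (Var vp)) Skip)
      (Seq (Assign vbit (Bin Mul (Var vbit)
        (Get 0 (Bin Add (Bin Mul (Bin Mod (Bin Add (Var vj) (Bin Sub (Var vq) (Var vN1))) (Var vN))
                                 (Var vd))
                        (Bin Div (Var vs) (Const 2))))))
      (If (Bin Eq (Var vbit) (Bin Mod (Var vs) (Const 2))) (Assign vsym (Var vp)) Skip)))))
    Skip)))).

Definition scratch : list nat := [vx; vq; vp; vs; vsym; vbit].

Definition fill (A vlen : nat) (code : cmd) : cmd :=
  Seq (Assign vx (Const 0))
  (While (Bin Lt (Var vx) (Var vlen))
    (Seq code
    (Seq (Put A (Bin Add (Var vbase) (Var vx)) (Var vsym))
         (Assign vx (Bin Add (Var vx) (Const 1)))))).

Lemma runs_fill w A vlen code f len base T s0 :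
  0 < w -> base + len < 2 ^ w -> ~ In vlen scratch -> A <> 0 ->
  var s0 vlen = len -> var s0 vbase = base -> (forall z, z < len -> f z < 2 ^ w) ->
  (forall s z, z < len ->
    (forall x, ~ In x scratch -> var s x = var s0 x) ->
    (forall i, arr s 0 i = arr s0 0 i) -> var s vx = z ->
    runs w code s T (fun s' => var s' vsym = f z /\ arr s' = arr s /\
      forall x, ~ In x [vq; vp; vs; vsym; vbit] -> var s' x = var s x)) ->
  runs w (fill A vlen code) s0 (len * (T + 3) + 2) (fun s' =>
    (forall x, ~ In x scratch -> var s' x = var s0 x) /\
    (forall i, i < len -> arr s' A (base + i) = f i) /\
    (forall C i, C <> A \/ i < base \/ base + len <= i -> arr s' C i = arr s0 C i)).
Proof.
  intros Hw Hb Hlen HA El Eb Hf Hcode.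
  replace (len * (T + 3) + 2) with (1 + (len * S (T + 2) + 1)) by lia.
  apply runs_seq. eapply runs_assign; [apply eval_const; lia|].
  eapply runs_weaken; [eapply runs_while with (N := len) (Inv := fun z s' =>
    (forall x, ~ In x scratch -> var s' x = var s0 x) /\
    (forall i, i < z -> arr s' A (base + i) = f i) /\
    (forall C i, C <> A \/ i < base \/ base + z <= i -> arr s' C i = arr s0 C i) /\
    var s' vx = z)|apply le_n|].
  - intros z s Hz (K & R1 & R2 & Ex). split.
    + rewrite (eval_ltb w s _ _ z len); auto.
      * destruct (Nat.ltb_spec z len); cbn; lia.
      * apply eval_var; [auto|lia].
      * apply eval_var; [rewrite K; auto|lia].
    + apply runs_seq. eapply runs_weaken; [apply (Hcode s z Hz K)| |].
      * intros i. apply R2. auto.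
      * exact Ex.
      * apply le_n.
      * intros s1 (Es & Ea & K1). apply runs_le with (T := 1 + 1); [|lia]. apply runs_seq.
        assert (Ex1 : var s1 vx = z) by (rewrite K1; [auto|simpl; lia]).
        assert (Eb1 : var s1 vbase = base) by (rewrite K1, K; simpl; auto; lia).
        eapply runs_put.
        { apply eval_add with (x := base) (y := z); try lia; apply eval_var; auto; lia. }
        { apply eval_var; [exact Es|auto]. }
        eapply runs_assign.
        { apply eval_add with (x := z) (y := 1); try lia;
          [apply eval_var; [exact Ex1|lia]|apply eval_const; lia]. }
        cbn [var arr set_var set_arr]. rewrite Ea. unfold upd. repeat split.
        -- intros x Hx. destruct (Nat.eqb_spec x vx); [subst; simpl in Hx; lia|].
           rewrite K1; [apply K; auto|]. intros HH; apply Hx; simpl in *; lia.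
        -- intros i Hi. rewrite Nat.eqb_refl.
           destruct (Nat.eqb_spec (base + i) (base + z)).
           ++ f_equal; lia.
           ++ apply R1; lia.
        -- intros C i HC. destruct (Nat.eqb_spec C A) as [->|].
           ++ destruct (Nat.eqb_spec i (base + z)); [lia|]. apply R2; lia.
           ++ apply R2; auto.
        -- rewrite Nat.eqb_refl. lia.
  - intros s (K & R1 & R2 & Ex). rewrite (eval_ltb w s _ _ len len); auto.
    + now rewrite Nat.ltb_irrefl.
    + apply eval_var; [auto|lia].
    + apply eval_var; [rewrite K; auto|lia].
  - cbn. repeat split; auto; try lia. intros x Hx. unfold upd.
    destruct (Nat.eqb_spec x vx); [subst; simpl in Hx; lia|auto].
  - intros s' (K & R1 & R2 & _). auto.
Qed.

Section Symbols.
Variables (w N d N1 N2 i0 j0 : nat) (bits : list nat).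
Hypothesis (Hw : 0 < w) (Hbits : forall i, nth i bits 0 <= 1).
Hypothesis (HN : 0 < N) (HN1 : 0 < N1).
Hypothesis HW : (N + 10) * (d + 2) + i0 + j0 + N1 + N2 < 2 ^ w.

Definition bit (i p : nat) : bool := nth (i * d + p) bits 0 =? 1.
Definition text_bit (i p : nat) : bool := bit ((i0 + i mod N1) mod N) p.
Definition is_vector (q : nat) : bool := negb (q <? N1) && (q <? N1 + N2).
Definition pattern_bit (q p : nat) : bool := is_vector q && bit ((j0 + (q - N1)) mod N) p.

Ltac bound := try lia; try nia.
Ltac keep := intros; unfold upd;
  repeat match goal with
  | |- context [?a =? ?b] => destruct (Nat.eqb_spec a b); [subst; simpl in *; lia|]
  end; reflexivity.

Lemma nth_bits i p : nth (i * d + p) bits 0 = Nat.b2n (bit i p).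
Proof.
  unfold bit. specialize (Hbits (i * d + p)).
  destruct (Nat.eqb_spec (nth (i * d + p) bits 0) 1); cbn; lia.
Qed.

Lemma runs_text_code s z :
  z < 2 ^ w ->
  var s vN = N -> var s vd = d -> var s vL = blk d -> var s vN1 = N1 -> var s vi = i0 ->
  (forall i, arr s 0 i = nth i bits 0) -> var s vx = z ->
  runs w text_code s 8 (fun s' => var s' vsym = text_sym d text_bit z /\ arr s' = arr s /\
    forall x, ~ In x [vq; vp; vs; vsym; vbit] -> var s' x = var s x).
Proof.
  intros Hz EN Ed EL E1 Ei Eb Ex.
  pose proof (Nat.mod_upper_bound z (blk d) ltac:(unfold blk; lia)) as Hp.
  assert (HL : blk d < 2 ^ w) by (unfold blk; nia).
  assert (Hzd : z / blk d <= z) by (apply Nat.Div0.div_le_upper_bound; unfold blk; nia).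
  unfold text_sym. cbv zeta.
  set (i := z / blk d) in *. set (p := z mod blk d) in *.
  unfold text_code.
  apply runs_le with (T := 1 + (1 + 6)); [|lia].
  apply runs_seq. eapply runs_assign; [evaluate; bound|].
  apply runs_seq. eapply runs_assign; [evaluate; bound|]. fold p. fold i.
  eapply runs_if_lt; [auto|evaluate; bound|evaluate; bound| |]; intros Hd.
  { eapply runs_le; [eapply runs_assign; [evaluate; bound|]|lia]. cbn [var arr set_var upd Nat.eqb].
    destruct (Nat.ltb_spec p d); [|lia]. repeat split. keep. }
  destruct (Nat.ltb_spec p d); [lia|].
  eapply runs_if_lt; [auto|evaluate; bound|evaluate; bound| |]; intros Hd2.
  { eapply runs_le; [eapply runs_assign; [evaluate; bound|]|lia]. cbn [var arr set_var upd Nat.eqb].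
    destruct (Nat.ltb_spec p (2 * d)); [|lia]. repeat split. keep. }
  destruct (Nat.ltb_spec p (2 * d)); [lia|].
  apply runs_le with (T := 1 + 3); [|lia].
  apply runs_seq. eapply runs_assign; [evaluate; bound|].
  set (r := p - 2 * d).
  assert (Hi : i mod N1 < N1) by (apply Nat.mod_upper_bound; lia).
  assert (Hu : (i0 + i mod N1) mod N < N) by (apply Nat.mod_upper_bound; lia).
  assert (Hr : r / 2 <= d) by (apply Nat.Div0.div_le_upper_bound; unfold r, blk in *; lia).
  set (u := (i0 + i mod N1) mod N) in *.
  assert (Hud : u * d + r / 2 < 2 ^ w) by nia.
  eapply runs_if_nonzero.
  { eapply eval_mul; [evaluate; bound| |].
    - eapply eval_get; [|apply Eb|].
      + eapply eval_add; [eapply eval_mul| |]; [| | |evaluate; bound|].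
        * eapply eval_mod; [eapply eval_add; [evaluate; bound|evaluate; bound|]|evaluate; bound].
          lia.
        * evaluate; bound.
        * fold u. nia.
        * fold u. exact Hud.
      + rewrite nth_bits. destruct (bit _ _); cbn; lia.
    - rewrite nth_bits. destruct (bit _ _), (_ =? 1); cbn; lia. }
  all: fold u; rewrite nth_bits; unfold text_bit; fold u; intros Hc.
  - eapply runs_le; [eapply runs_assign; [evaluate; bound|]|lia]. cbn [var arr set_var upd Nat.eqb].
    destruct (r mod 2 =? 1), (bit u (r / 2)); cbn in Hc |- *; try lia. repeat split. keep.
  - eapply runs_le; [eapply runs_assign; [evaluate; bound|]|lia]. cbn [var arr set_var upd Nat.eqb].
    destruct (r mod 2 =? 1), (bit u (r / 2)); cbn in Hc |- *; try lia; repeat split; keep.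
Qed.

Lemma runs_pattern_code s z :
  z < 2 ^ w ->
  var s vN = N -> var s vd = d -> var s vL = blk d -> var s vN1 = N1 -> var s vN2 = N2 ->
  var s vj = j0 -> z + j0 < 2 ^ w ->
  (forall i, arr s 0 i = nth i bits 0) -> var s vx = z ->
  runs w pattern_code s 12 (fun s' =>
    var s' vsym = pattern_sym d is_vector pattern_bit z /\ arr s' = arr s /\
    forall x, ~ In x [vq; vp; vs; vsym; vbit] -> var s' x = var s x).
Proof.
  intros Hz EN Ed EL E1 E2 Ej Hzj Eb Ex.
  pose proof (Nat.mod_upper_bound z (blk d) ltac:(unfold blk; lia)) as Hp.
  assert (HL : blk d + 1 < 2 ^ w) by (unfold blk; nia).
  assert (Hzd : z / blk d <= z) by (apply Nat.Div0.div_le_upper_bound; unfold blk; nia).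
  unfold pattern_sym. cbv zeta.
  set (q := z / blk d) in *. set (p := z mod blk d) in *.
  unfold pattern_code.
  apply runs_le with (T := 1 + (1 + (1 + 9))); [|lia].
  apply runs_seq. eapply runs_assign; [evaluate; bound|].
  apply runs_seq. eapply runs_assign; [evaluate; bound|]. fold p. fold q.
  apply runs_seq. eapply runs_assign; [evaluate; bound|].
  eapply runs_if_lt; [auto|evaluate; bound|evaluate; bound| |]; intros Hd.
  { eapply runs_le; [eapply runs_assign; [evaluate; bound|]|lia]. cbn [var arr set_var upd Nat.eqb].
    destruct (Nat.ltb_spec p d); [|lia]. repeat split. keep. }
  destruct (Nat.ltb_spec p d); [lia|].
  eapply runs_if_lt; [auto|evaluate; bound|evaluate; bound| |]; intros Hd2.
  2:{ eapply runs_le; [eapply runs_skip|lia]. cbn [var arr set_var upd Nat.eqb].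
    destruct (Nat.ltb_spec p (3 * d + 1)); [lia|]. repeat split. keep. }
  destruct (Nat.ltb_spec p (3 * d + 1)); [|lia].
  apply runs_le with (T := 1 + (1 + 5)); [|lia].
  apply runs_seq. eapply runs_assign; [evaluate; bound|].
  set (r := p - d) in *.
  apply runs_seq. eapply runs_assign with (v := Nat.b2n (is_vector q)).
  { erewrite eval_mul; [| | |]; [|eapply eval_sub; [evaluate; bound|evaluate; bound]|evaluate; bound|].
    - unfold is_vector. destruct (q <? N1), (q <? N1 + N2); reflexivity.
    - destruct (q <? N1), (q <? N1 + N2); cbn; lia. }
  assert (Hb2 : forall b, Nat.b2n b < 2 ^ w) by (intros []; cbn; lia).
  eapply runs_if_eq; [auto|evaluate; bound|evaluate; bound| |]; intros Hr.
  { destruct (Nat.eqb_spec r (2 * d)); [|lia].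
    apply runs_le with (T := S 1); [|lia].
    eapply runs_if_nonzero; [evaluate; auto| |]; intros Hc.
    - eapply runs_assign; [evaluate; bound|]. cbn [var arr set_var upd Nat.eqb].
      destruct (is_vector q); cbn in Hc; [|lia]. repeat split. keep.
    - apply runs_skip. cbn [var arr set_var upd Nat.eqb].
      destruct (is_vector q); cbn in Hc; [lia|]. repeat split. keep. }
  destruct (Nat.eqb_spec r (2 * d)); [lia|].
  assert (Hu : (j0 + (q - N1)) mod N < N) by (apply Nat.mod_upper_bound; lia).
  assert (Hrd : r / 2 <= d) by (apply Nat.Div0.div_le_upper_bound; unfold r, blk in *; lia).
  set (u := (j0 + (q - N1)) mod N) in *.
  assert (Hud : u * d + r / 2 < 2 ^ w) by nia.
  apply runs_le with (T := 1 + 2); [|lia].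
  apply runs_seq. eapply runs_assign with (v := Nat.b2n (pattern_bit q (r / 2))).
  { erewrite eval_mul; [|evaluate; auto| |].
    - unfold pattern_bit. fold u.
      instantiate (1 := Nat.b2n (bit u (r / 2))).
      destruct (is_vector q), (bit u (r / 2)); reflexivity.
    - eapply eval_get; [| |auto].
      + eapply eval_add; [eapply eval_mul| |]; [| | |evaluate; bound|].
        * eapply eval_mod; [eapply eval_add; [evaluate; bound|evaluate; bound|]|evaluate; bound].
          lia.
        * evaluate; bound.
        * fold u. nia.
        * fold u. exact Hud.
      + cbn [arr set_var]. rewrite Eb. apply nth_bits.
    - destruct (is_vector q), (bit u (r / 2)); cbn; lia. }
  assert (Hr2 : r mod 2 < 2) by (apply Nat.mod_upper_bound; lia).
  eapply runs_if_eq; [auto|evaluate; auto|evaluate; bound| |]; intros Hc.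
  - eapply runs_assign; [evaluate; bound|]. cbn [var arr set_var upd Nat.eqb].
    destruct (Nat.eqb_spec (r mod 2) 1), (pattern_bit q (r / 2)); cbn [Nat.b2n negb] in Hc |- *; try lia;
      repeat split; keep.
  - apply runs_skip. cbn [var arr set_var upd Nat.eqb].
    destruct (Nat.eqb_spec (r mod 2) 1), (pattern_bit q (r / 2)); cbn [Nat.b2n negb] in Hc |- *; try lia;
      repeat split; keep.
Qed.
End Symbols.

Definition guest_vars (p : cmd) : nat := Nat.max 3 (var_bound p).

Definition guest_call (p : cmd) : cmd := embed guest 1 vmod vbase p.

Definition body (Pe : cmd) : cmd :=
  Seq (Assign vbase (Bin Add (Var vbase) (Var vstride)))
  (Seq (Assign vi (Bin Mul (Bin Div (Var vz) (Var vcols)) (Var vN1)))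
  (Seq (Assign vj (Bin Mul (Bin Mod (Var vz) (Var vcols)) (Var vN2)))
  (Seq (fill 1 vLX text_code)
  (Seq (fill 2 vLY pattern_code)
  (Seq (reset guest (guest_vars Pe))
  (Seq (Assign guest (Var vn))
  (Seq (Assign (guest + 1) (Var vLX))
  (Seq (Assign (guest + 2) (Var vLY))
  (Seq (guest_call Pe)
  (Seq (If (Bin Eq (Var guest) (Const 0))
         (If (Bin Lt (Bin Mul (Var vtheta) (Var (guest + 2))) (Bin Mul (Var (guest + 1)) (Var va)))
           Skip (Assign vfound (Const 1)))
         Skip)
  (Assign vz (Bin Add (Var vz) (Const 1))))))))))))).

Lemma nth_seg f m i : nth i (seg f 0 m) 0 = if i <? m then f i else 0.
Proof.
  destruct (Nat.ltb_spec i m).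
  - unfold seg. rewrite (nth_indep _ 0 (f 0)) by (now rewrite length_map, length_seq).
    now rewrite map_nth, seq_nth.
  - apply nth_overflow. unfold seg. now rewrite length_map, length_seq.
Qed.

Lemma length_seg {A} (f : nat -> A) x m : length (seg f x m) = m.
Proof. unfold seg. now rewrite length_map, length_seq. Qed.

Section Loop.
Variables (w wb N d n a N1 N2 S LX LY theta TE : nat) (bits : list nat) (Pe : cmd).
Variable found : nat -> Prop.
Let cols := N / N2 + 1.
Let calls := (N / N1 + 1) * cols.
Let i0 z := z / cols * N1.
Let j0 z := z mod cols * N2.
Let tx z := text_sym d (text_bit N d N1 (i0 z) bits).
Let py z := pattern_sym d (is_vector N1 N2) (pattern_bit N d N1 N2 (j0 z) bits).
Hypothesis (Hw : 0 < w) (Hwb : wb < w) (Hbits : forall i, nth i bits 0 <= 1).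
Hypothesis (HN : 0 < N) (HN1 : 0 < N1) (HN2 : 0 < N2).
Hypothesis (HN1n : N1 + N2 <= n) (HLn : LX + LY <= n) (Hn : n < 2 ^ wb) (HS : 2 ^ wb <= S).
Hypothesis (HW1 : (calls + 3) * S <= 2 ^ w).
Hypothesis (HW2 : theta * S < 2 ^ w) (HW3 : a * S < 2 ^ w).
Hypothesis (HW4 : (N + 10) * (d + 2) + 2 * N + 3 * n < 2 ^ w).
Hypothesis Hcall : forall z, z < calls -> exists t s',
  exec wb Pe (ED_input n (seg (tx z) 0 LX) (seg (py z) 0 LY)) t s' /\ t <= TE /\
  (found z <-> var s' 0 = 0 /\ var s' 1 * a <= theta * var s' 2).

Definition params (s : state) : Prop :=
  (var s vN = N /\ var s vd = d /\ var s vmod = 2 ^ wb /\ var s vstride = S /\ var s vn = n) /\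
  (var s va = a /\ var s vL = blk d /\ var s vN1 = N1 /\ var s vN2 = N2 /\ var s vcols = cols) /\
  (var s vcalls = calls /\ var s vLX = LX /\ var s vLY = LY /\ var s vtheta = theta).

Lemma params_ext s s' :
  (forall x, In x [vN; vd; vmod; vstride; vn; va; vL; vN1; vN2; vcols; vcalls; vLX; vLY; vtheta] -> var s' x = var s x) ->
  params s -> params s'.
Proof. intros H. unfold params. rewrite !H by (simpl; lia). auto. Qed.

Definition loop_inv (z : nat) (s : state) : Prop :=
  params s /\ var s vz = z /\ var s vbase = (z + 1) * S /\
  (forall i, arr s 0 i = nth i bits 0) /\
  (forall C i, 1 <= C -> (z + 2) * S <= i -> arr s C i = 0) /\
  (var s vfound = 0 \/ var s vfound = 1) /\
  (var s vfound <> 0 <-> exists z', z' < z /\ found z').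

Lemma i0_le z : z < calls -> i0 z <= N.
Proof.
  intros Hz. unfold i0.
  assert (z / cols < N / N1 + 1).
  { apply Nat.Div0.div_lt_upper_bound. unfold calls in Hz. lia. }
  pose proof (Nat.Div0.mul_div_le N N1). nia.
Qed.

Lemma j0_le z : j0 z <= N.
Proof.
  unfold j0. pose proof (Nat.mod_upper_bound z cols ltac:(unfold cols; lia)).
  unfold cols in *. pose proof (Nat.Div0.mul_div_le N N2). nia.
Qed.

Lemma runs_body z s : z < calls -> loop_inv z s ->
  runs w (body Pe) s (15 * n + guest_vars Pe + TE + 20) (loop_inv (z + 1)).
Proof.
  intros Hz (HP & Ez & Eb & Hb & H0 & Hf01 & Hf).
  assert (Hw2 : 2 <= 2 ^ w) by (pose proof (Nat.pow_le_mono_r 2 1 w); change (2 ^ 1) with 2 in *; lia).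
  assert (HS0 : 0 < S) by lia.
  assert (HzS : (z + 1) * S + S + S <= 2 ^ w) by nia.
  assert (Hcalls : calls < 2 ^ w) by nia.
  assert (Hi0 := i0_le z Hz). assert (Hj0 := j0_le z).
  assert (HSw : S < 2 ^ w) by nia.
  assert (Hcols : cols < 2 ^ w) by (unfold calls in *; nia).
  apply runs_le with (T := 1 + (1 + (1 + (LX * (8 + 3) + 2 + (LY * (12 + 3) + 2 +
    (Datatypes.S (guest_vars Pe) + (1 + (1 + (1 + (TE + (3 + 1))))))))))); [|lia].
  unfold body.
  pose proof HP as ((EN & Ed & EM & ES & En) & (Ea & EL & E1 & E2 & Ec) & (Ecc & EX & EY & Et)).
  apply runs_seq. eapply runs_assign; [evaluate; try lia|].
  apply runs_seq. eapply runs_assign; [evaluate; fold (i0 z); lia|].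
  apply runs_seq. eapply runs_assign; [evaluate; fold (j0 z); lia|].
  fold (i0 z) (j0 z).
  match goal with |- runs _ _ ?st _ _ => set (s3 := st) end.
  assert (HP3 : params s3) by (apply (params_ext s); [|exact HP]; simpl; intros x Hx;
     repeat (destruct Hx as [<-|Hx]; [reflexivity|]); contradiction).
  assert (Eb3 : var s3 vbase = (z + 1) * S + S) by reflexivity.
  assert (Ez3 : var s3 vz = z) by exact Ez.
  assert (Ei3 : var s3 vi = i0 z) by reflexivity.
  assert (Ej3 : var s3 vj = j0 z) by reflexivity.
  assert (Ef3 : var s3 vfound = var s vfound) by reflexivity.
  assert (Ar3 : arr s3 = arr s) by reflexivity.
  clearbody s3.
  clear EN Ed EM ES En Ea EL E1 E2 Ec Ecc EX EY Et.
  pose proof HP3 as ((EN & Ed & EM & ES & En) & (Ea & EL & E1 & E2 & Ec) & (Ecc & EX & EY & Et)).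
  set (base := (z + 1) * S + S) in *.
  assert (HbS : base + S <= 2 ^ w) by (unfold base; lia).
  apply runs_seq. eapply runs_weaken; [eapply (runs_fill w 1 vLX text_code (tx z) LX base 8 s3)|apply le_n|]; auto; try lia.
  { simpl; lia. }
  { intros x Hx. pose proof (text_sym_lt d (text_bit N d N1 (i0 z) bits) x).
    unfold tx. unfold blk in *. nia. }
  { intros s' x Hx K A0 Ex.
    apply (runs_text_code w N d N1 N2 (i0 z) (j0 z) bits); auto; try lia;
    try (rewrite K by (simpl; lia); assumption).
    intros i. rewrite A0, Ar3. apply Hb. }
  intros s4 (K4 & X4 & Y4).
  apply runs_seq. eapply runs_weaken; [eapply (runs_fill w 2 vLY pattern_code (py z) LY base 12 s4)|apply le_n|]; auto; try lia.
  { simpl; lia. }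
  { rewrite K4 by (simpl; lia). auto. }
  { rewrite K4 by (simpl; lia). auto. }
  { intros x Hx. pose proof (pattern_sym_lt d (is_vector N1 N2) (pattern_bit N d N1 N2 (j0 z) bits) x).
    unfold py. unfold blk in *. nia. }
  { intros s' x Hx K A0 Ex.
    apply (runs_pattern_code w N d N1 N2 (i0 z) (j0 z) bits); auto; try lia;
    try (rewrite K, K4 by (simpl; lia); assumption).
    intros i. rewrite A0, Y4, Ar3 by lia. apply Hb. }
  intros s5 (K5 & X5 & Y5).
  apply runs_seq. eapply runs_weaken; [apply runs_reset|apply le_n|].
  intros s6 (K6 & R6 & A6).
  assert (K65 : forall x, x < guest -> ~ In x scratch -> var s6 x = var s3 x).
  { intros x Hx Hs. rewrite K6, K5, K4; auto. }
  pose proof (K65 vn ltac:(lia) ltac:(simpl; lia)) as En6. rewrite En in En6.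
  pose proof (K65 vLX ltac:(lia) ltac:(simpl; lia)) as EX6. rewrite EX in EX6.
  pose proof (K65 vLY ltac:(lia) ltac:(simpl; lia)) as EY6. rewrite EY in EY6.
  apply runs_seq. eapply runs_assign; [evaluate; try lia|].
  apply runs_seq. eapply runs_assign; [evaluate; try lia|].
  apply runs_seq. eapply runs_assign; [evaluate; try lia|].
  match goal with |- runs _ _ ?st _ _ => set (s9 := st) end.
  assert (K9 : forall x, x < guest -> ~ In x scratch -> var s9 x = var s3 x).
  { intros x Hx Hs. rewrite <- (K65 x Hx Hs). unfold s9, set_var, upd. cbn [var].
    destruct (Nat.eqb_spec x (guest + 2)), (Nat.eqb_spec x (guest + 1)), (Nat.eqb_spec x guest); try lia. }
  assert (A9 : arr s9 = arr s5) by (cbn; auto).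
  assert (G9 : forall x, x < guest_vars Pe -> var s9 (guest + x) = nth x [n; LX; LY] 0).
  { intros x Hx. unfold s9, set_var, upd. cbn [var].
    destruct x as [|[|[|x]]]; [reflexivity..|].
    destruct (Nat.eqb_spec (guest + Datatypes.S (Datatypes.S (Datatypes.S x))) (guest + 2)); [lia|].
    destruct (Nat.eqb_spec (guest + Datatypes.S (Datatypes.S (Datatypes.S x))) (guest + 1)); [lia|].
    destruct (Nat.eqb_spec (guest + Datatypes.S (Datatypes.S (Datatypes.S x))) guest); [lia|].
    rewrite R6 by auto. cbn. destruct x; auto. }
  clearbody s9.
  destruct (Hcall z Hz) as (t & se & He & Ht & Hdec).
  assert (Hzero : forall C i, 1 <= C -> base <= i -> arr s C i = 0).
  { intros C i HC Hi. apply H0; auto. unfold base in Hi. lia. }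
  destruct (exec_embed guest 1 vmod vbase wb w (guest_vars Pe) base ltac:(lia) ltac:(lia) ltac:(lia) ltac:(lia)
    _ _ _ _ He ltac:(unfold guest_vars; lia) s9) as (h & Hh & (Vh & _) & (Fv & Fa)).
  { rewrite K9 by (simpl; lia). auto. }
  { rewrite K9 by (simpl; lia). auto. }
  { split; [intros x Hx; unfold ED_input, init; cbn [var]; rewrite !length_seg; auto|]. intros C i Hi. rewrite A9. cbn [arr ED_input init].
    destruct C as [|[|C]]; cbn [nth].
    - rewrite nth_seg. rewrite Y5 by lia. destruct (Nat.ltb_spec i LX).
      + apply X4; auto.
      + rewrite Y4, Ar3 by lia. apply Hzero; lia.
    - rewrite nth_seg. destruct (Nat.ltb_spec i LY).
      + apply X5; auto.
      + rewrite Y5, Y4, Ar3 by lia. apply Hzero; lia.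
    - replace (match C with 0 | _ => [] end) with (@nil nat) by (destruct C; auto).
      replace (nth i [] 0) with 0 by (destruct i; auto).
      rewrite Y5, Y4, Ar3 by lia. apply Hzero; lia. }
  apply runs_seq. exists t, h. split; [exact Hh|split; [exact Ht|]].
  pose proof (exec_var_lt _ _ _ _ _ He) as Hlt.
  assert (Hlt' : forall x, var se x < 2 ^ wb).
  { apply Hlt. intros x. cbn [var ED_input init].
    destruct x as [|[|[|[|x]]]]; cbn [nth]; rewrite ?length_seg; lia. }
  clear Hlt.
  pose proof (Vh 0 ltac:(unfold guest_vars; lia)) as V0.
  pose proof (Vh 1 ltac:(unfold guest_vars; lia)) as V1.
  pose proof (Vh 2 ltac:(unfold guest_vars; lia)) as V2.
  rewrite Nat.add_0_r in V0.
  pose proof (Hlt' 0) as B0. pose proof (Hlt' 1) as B1. pose proof (Hlt' 2) as B2.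
  assert (theta < 2 ^ w /\ a < 2 ^ w) as [Hth Ha'].
  { clear -HW2 HW3 HS0. split; [apply (Nat.le_lt_trans _ (theta * S))|apply (Nat.le_lt_trans _ (a * S))];
    auto; destruct S; lia. }
  assert (theta * var se 2 < 2 ^ w).
  { eapply Nat.le_lt_trans; [|exact HW2]. apply Nat.mul_le_mono_l. lia. }
  assert (var se 1 * a < 2 ^ w).
  { eapply Nat.le_lt_trans; [|exact HW3]. rewrite Nat.mul_comm. apply Nat.mul_le_mono_l. lia. }
  assert (Kh : forall x, x < guest -> ~ In x scratch -> var h x = var s3 x).
  { intros x Hx Hs. rewrite Fv; auto. }
  pose proof (Kh vtheta ltac:(lia) ltac:(simpl; lia)) as Et9. rewrite Et in Et9.
  pose proof (Kh va ltac:(lia) ltac:(simpl; lia)) as Ea9. rewrite Ea in Ea9.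
  pose proof (Kh vz ltac:(lia) ltac:(simpl; lia)) as Ez9. rewrite Ez3 in Ez9.
  pose proof (Kh vfound ltac:(lia) ltac:(simpl; lia)) as Ef9. rewrite Ef3 in Ef9.
  pose proof (Kh vbase ltac:(lia) ltac:(simpl; lia)) as Eb9. rewrite Eb3 in Eb9.
  assert (HPh : params h).
  { apply (params_ext s3); [|exact HP3]. intros x Hx. apply Kh; simpl in *; lia. }
  assert (Ah0 : forall i, arr h 0 i = nth i bits 0).
  { intros i. rewrite Fa, A9, Y5, Y4, Ar3 by lia. apply Hb. }
  assert (Ah : forall C i, 1 <= C -> (z + 1 + 2) * S <= i -> arr h C i = 0).
  { intros C i HC Hi. rewrite Fa by (right; unfold base; lia).
    assert (base + S <= i) by (unfold base; lia).
    rewrite A9, Y5, Y4, Ar3 by lia. apply Hzero; lia. }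
  assert (Hstep : (exists z', z' < z + 1 /\ found z') <-> (exists z', z' < z /\ found z') \/ found z).
  { split.
    - intros (z' & Hz' & F). destruct (Nat.eq_dec z' z) as [->|]; [auto|left; exists z'; split; [lia|auto]].
    - intros [(z' & Hz' & F)|F]; [exists z'|exists z]; split; auto; lia. }
  assert (Hfin : forall s', arr s' = arr h -> (forall x, x <> vfound -> var s' x = var h x) ->
    (var s' 2 = 0 \/ var s' 2 = 1) -> (var s' 2 <> 0 <-> var s vfound <> 0 \/ found z) ->
    runs w (Assign vz (Bin Add (Var vz) (Const 1))) s' 1 (loop_inv (z + 1))).
  { intros s' Es' Ks' H01 Hf'. pose proof (Ks' 16 ltac:(lia)) as Ez'. rewrite Ez9 in Ez'.
    eapply runs_assign; [evaluate; try lia|].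
    unfold loop_inv. cbn [var arr set_var upd Nat.eqb]. rewrite Es'.
    split; [|split; [|split; [|split; [|split; [|split]]]]]; auto.
    - apply (params_ext h); [|exact HPh]. intros x Hx. cbn [var set_var]. unfold upd.
      destruct (Nat.eqb_spec x vz); [subst; simpl in Hx; lia|]. apply Ks'. intros ->; simpl in Hx; lia.
    - rewrite Ks', Eb9 by lia. unfold base. lia.
    - rewrite Hstep, Hf', Hf. reflexivity. }
  apply runs_seq.
  eapply runs_if_eq; [auto|evaluate; try lia|evaluate; try lia| |]; intros C0.
  - apply runs_le with (T := Datatypes.S 1); [|lia].
    eapply runs_if_lt; [auto|evaluate; try lia|evaluate; try lia| |]; intros C1.
    + apply runs_skip. apply Hfin; auto; try (rewrite Ef9; assumption).
      rewrite Ef9. split; [tauto|]. intros [?|F]; [auto|]. apply Hdec in F. lia.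
    + eapply runs_assign; [evaluate; try lia|]. apply Hfin; cbn [var arr set_var upd]; auto.
      * intros x Hx. cbn [var set_var]. unfold upd. destruct (Nat.eqb_spec x vfound); [lia|reflexivity].
      * split; [intros _; right; apply Hdec; lia|intros _; cbn; lia].
  - apply runs_le with (T := 1); [|lia].
    apply runs_skip. apply Hfin; auto; try (rewrite Ef9; assumption).
    rewrite Ef9. split; [tauto|]. intros [?|F]; [auto|]. apply Hdec in F. lia.
Qed.

Lemma runs_loop s : loop_inv 0 s ->
  runs w (While (Bin Lt (Var vz) (Var vcalls)) (body Pe)) s
    (calls * (15 * n + guest_vars Pe + TE + 21) + 1) (loop_inv calls).
Proof.
  intros H. eapply runs_le.
  - apply runs_while with (Inv := loop_inv); [| |exact H].
    + intros z s' Hz Hi. split; [|replace (Datatypes.S z) with (z + 1) by lia; now apply runs_body].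
      destruct Hi as (HP & Ez & _). destruct HP as (_ & _ & Ec & _).
      rewrite (eval_ltb w s' _ _ z calls Hw); [|apply eval_var; [auto|nia]..].
      destruct (Nat.ltb_spec z calls); cbn; lia.
    + intros s' Hi. destruct Hi as (HP & Ez & _). destruct HP as (_ & _ & Ec & _).
      rewrite (eval_ltb w s' _ _ calls calls Hw); [|apply eval_var; [auto|nia]..].
      now rewrite Nat.ltb_irrefl.
  - lia.
Qed.
End Loop.

Definition compute (c : nat) (P : cmd) (x : nat) : cmd :=
  Seq (Assign vmod (Bin Shl (Const 1) (Bin Mul (Const c) (Var vtmp))))
  (Seq (reset guest (guest_vars P))
  (Seq (Assign guest (Var vn))
  (Seq (guest_call P)
  (Assign x (Var guest))))).

Lemma runs_compute w c P x s0 base t v T n :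
  0 < w -> c * t < w -> base + 2 ^ (c * t) <= 2 ^ w -> n < 2 ^ w -> v < 2 ^ w -> x < guest ->
  var s0 vbase = base -> var s0 vtmp = t -> var s0 vn = n ->
  (forall C i, 1 <= C -> base <= i -> arr s0 C i = 0) ->
  (exists u s', exec (c * t) P (init [n] []) u s' /\ u <= T /\ var s' 0 = v) ->
  runs w (compute c P x) s0 (T + guest_vars P + 4) (fun s' =>
    var s' x = v /\ (forall y, y < guest -> y <> vmod -> y <> x -> var s' y = var s0 y) /\
    (forall i, arr s' 0 i = arr s0 0 i) /\
    (forall C i, 1 <= C -> base + 2 ^ (c * t) <= i -> arr s' C i = 0)).
Proof.
  intros Hw Hct Hb Hn Hv Hx Eb Et En Hz (u & se & He & Hu & Ev).
  assert (Hp : 2 ^ (c * t) < 2 ^ w) by (apply Nat.pow_lt_mono_r; lia).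
  assert (Hwp : w < 2 ^ w) by (apply Nat.pow_gt_lin_r; lia).
  assert (Hw2 : 2 <= 2 ^ w) by lia.
  apply runs_le with (T := 1 + (S (guest_vars P) + (1 + (T + 1)))); [|lia].
  unfold compute.
  apply runs_seq.
  assert (Ht : t < 2 ^ w \/ c = 0) by (destruct c; [auto|left; lia]).
  eapply runs_assign with (v := 2 ^ (c * t)).
  { destruct Ht as [Ht| ->].
    - assert (c <= c * t \/ t = 0) by (destruct t; [auto|left; lia]).
      destruct H as [H| ->].
      + evaluate; try lia.
      + rewrite Nat.mul_0_r in *. cbn [eval eval_binop]. rewrite Et.
        rewrite (Nat.Div0.mod_0_l (2 ^ w)), Nat.mul_0_r, Nat.Div0.mod_0_l.
        rewrite (Nat.mod_small 1), Nat.shiftl_1_l by lia. cbn. apply Nat.mod_small; lia.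
    - cbn [eval eval_binop]. rewrite Nat.Div0.mod_0_l. cbn [Nat.mul]. rewrite Nat.Div0.mod_0_l.
      rewrite (Nat.mod_small 1), Nat.shiftl_1_l by lia. cbn. apply Nat.mod_small; lia. }
  apply runs_seq. eapply runs_weaken; [apply runs_reset|apply le_n|].
  intros s1 (K1 & R1 & A1).
  pose proof (K1 vn ltac:(lia)) as En1. cbn [var set_var upd Nat.eqb] in En1. rewrite En in En1.
  apply runs_seq. eapply runs_assign; [evaluate; try lia|].
  match goal with |- runs _ _ ?st _ _ => set (s2 := st) end.
  assert (K2 : forall y, y < guest -> y <> vmod -> var s2 y = var s0 y).
  { intros y Hy H5. unfold s2, set_var, upd. cbn [var].
    destruct (Nat.eqb_spec y guest); [lia|]. rewrite K1 by auto.
    unfold set_var, upd. cbn [var]. destruct (Nat.eqb_spec y vmod); [lia|auto]. }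
  assert (M2 : var s2 vmod = 2 ^ (c * t)).
  { unfold s2. cbn [var set_var upd Nat.eqb]. rewrite K1 by lia. reflexivity. }
  assert (G2 : forall y, y < guest_vars P -> var s2 (guest + y) = nth y [n] 0).
  { intros y Hy. unfold s2, set_var, upd. cbn [var].
    destruct y as [|y]; [reflexivity|].
    destruct (Nat.eqb_spec (guest + S y) guest); [lia|]. rewrite R1 by auto. destruct y; auto. }
  assert (A2 : arr s2 = arr s0) by (unfold s2; cbn [arr set_var]; rewrite A1; reflexivity).
  clearbody s2.
  destruct (exec_embed guest 1 vmod vbase (c * t) w (guest_vars P) base ltac:(lia) ltac:(lia) ltac:(lia) ltac:(lia)
    _ _ _ _ He ltac:(unfold guest_vars; lia) s2) as (h & Hh & (Vh & _) & (Fv & Fa)).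
  { exact M2. }
  { rewrite K2 by lia. exact Eb. }
  { split; [exact G2|]. intros C i Hi. rewrite A2, Hz by lia.
    cbn [arr init]. destruct C, i; auto. }
  apply runs_seq. exists u, h. split; [exact Hh|split; [exact Hu|]].
  pose proof (Vh 0 ltac:(unfold guest_vars; lia)) as V0. rewrite Nat.add_0_r, Ev in V0.
  eapply runs_assign; [evaluate; try lia|].
  cbn [var arr set_var]. unfold upd. repeat split.
  - now rewrite Nat.eqb_refl.
  - intros y Hy H5 Hyx. destruct (Nat.eqb_spec y x); [lia|]. rewrite Fv, K2; auto.
  - intros i. rewrite Fa, A2 by lia. reflexivity.
  - intros C i HC Hi. rewrite Fa, A2 by lia. apply Hz; lia.
Qed.

Definition log_code : cmd :=
  While (Bin Lt (Const 1) (Var vtmp))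
    (Seq (Assign vtmp (Bin Div (Var vtmp) (Const 2)))
         (Assign vlog (Bin Add (Var vlog) (Const 1)))).

Lemma runs_log w s0 N : 0 < w -> 0 < N -> N < 2 ^ w -> 2 < 2 ^ w ->
  var s0 vtmp = N -> var s0 vlog = 0 ->
  runs w log_code s0 (3 * Nat.log2 N + 1) (fun s' =>
    var s' vlog = Nat.log2 N /\ arr s' = arr s0 /\
    forall x, x <> vtmp -> x <> vlog -> var s' x = var s0 x).
Proof.
  intros Hw HN HNw Hw2 Et El.
  assert (Hl : Nat.log2 N < N) by (apply Nat.log2_lt_lin; lia).
  pose proof (Nat.log2_spec N HN) as [Hl1 Hl2].
  apply runs_le with (T := Nat.log2 N * S (1 + 1) + 1); [|lia].
  eapply runs_weaken; [eapply runs_while with (N := Nat.log2 N) (Inv := fun z s' =>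
    var s' vtmp = N / 2 ^ z /\ var s' vlog = z /\ arr s' = arr s0 /\
    forall x, x <> vtmp -> x <> vlog -> var s' x = var s0 x)|apply le_n|].
  - intros z s Hz (Ht & Hlz & Ea & K).
    assert (Hd : N / 2 ^ z <= N) by (apply Nat.Div0.div_le_upper_bound; pose proof (Nat.pow_nonzero 2 z); nia).
    split.
    + rewrite (eval_ltb w s _ _ 1 (N / 2 ^ z) Hw); [|apply eval_const; lia|apply eval_var; [auto|lia]].
      destruct (Nat.ltb_spec 1 (N / 2 ^ z)); [cbn; lia|].
      exfalso. assert (2 <= N / 2 ^ z); [|lia].
      apply Nat.div_le_lower_bound; [apply Nat.pow_nonzero; lia|].
      transitivity (2 ^ (S z)); [cbn; lia|].
      transitivity (2 ^ Nat.log2 N); [apply Nat.pow_le_mono_r; lia|auto].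
    + apply runs_seq. eapply runs_assign; [evaluate; try lia|].
      eapply runs_assign; [evaluate; try lia|].
      cbn [var arr set_var]. unfold upd. cbn [Nat.eqb]. repeat split; auto.
      * rewrite Nat.Div0.div_div. f_equal. cbn. lia.
      * lia.
      * intros x H1 H2. destruct (Nat.eqb_spec x vlog), (Nat.eqb_spec x vtmp); try lia. apply K; auto.
  - intros s (Ht & Hlz & Ea & K).
    assert (E1 : N / 2 ^ Nat.log2 N = 1).
    { symmetry. apply (Nat.div_unique _ _ 1 (N - 2 ^ Nat.log2 N)); cbn in *; lia. }
    rewrite E1 in Ht.
    rewrite (eval_ltb w s _ _ 1 1 Hw); [reflexivity|apply eval_const; lia|apply eval_var; [auto|lia]].
  - rewrite Nat.pow_0_r, Nat.div_1_r. auto.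
  - intros s (Ht & Hlz & Ea & K). auto.
Qed.

Definition layout_code : cmd :=
  Seq (Assign vN1 (Bin Div (Var vk) (Bin Mul (Const 8) (Var vL))))
  (Seq (Assign vN2 (Bin Div (Var vmin) (Bin Mul (Const 8) (Var vL))))
  (Seq (Assign vcols (Bin Add (Bin Div (Var vN) (Var vN2)) (Const 1)))
  (Seq (Assign vcalls (Bin Mul (Bin Add (Bin Div (Var vN) (Var vN1)) (Const 1)) (Var vcols)))
  (Seq (Assign vLX (Bin Mul (Bin Add (Var vN2) (Bin Mul (Const 3) (Var vN1))) (Var vL)))
  (Seq (Assign vLY (Bin Mul (Bin Add (Var vN2) (Bin Mul (Const 2) (Var vN1))) (Var vL)))
  (Assign vtheta (Bin Sub
     (Bin Add (Bin Mul (Var va) (Bin Mul (Var vN1) (Var vL))) (Var vLY))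
     (Bin Add (Bin Add (Bin Mul (Bin Add (Var vN2) (Bin Mul (Const 2) (Var vN1))) (Var vd))
                       (Bin Mul (Var vd) (Var vN1))) (Const 1))))))))).

Definition setup_code : cmd :=
  Seq (Assign vL (Bin Add (Bin Mul (Const 4) (Var vd)) (Const 1)))
  (Seq (Assign vmin (Bin Mul (Var va) (Var vk)))
  (Seq (If (Bin Lt (Var vmin) (Var vn)) Skip (Assign vmin (Var vn)))
  layout_code)).

(** [vtmp] holds [log2 n + 1], so [c * vtmp] is the word size of a guest with constant [c]. *)
Definition ov_program (ca ck cb g q : nat) (Pa Pk Pe : cmd) : cmd :=
  Seq (Assign vtmp (Var vN))
  (Seq log_code
  (Seq (Assign vtmp (Bin Add (Bin Div (Var vlog) (Const g)) (Const q)))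
  (Seq (Assign vn (Bin Shl (Const 1) (Var vtmp)))
  (Seq (Assign vtmp (Bin Add (Var vtmp) (Const 1)))
  (Seq (Assign vstride (Bin Shl (Const 1) (Bin Mul (Const (ca + ck + cb)) (Var vtmp))))
  (Seq (compute ca Pa va)
  (Seq (Assign vbase (Var vstride))
  (Seq (compute ck Pk vk)
  (Seq (Assign vmod (Bin Shl (Const 1) (Bin Mul (Const cb) (Var vtmp))))
  (Seq setup_code
  (Seq (While (Bin Lt (Var vz) (Var vcalls)) (body Pe))
  (Assign 0 (Var vfound))))))))))))).

Lemma runs_setup w s0 N d n a k : 0 < w ->
  let L := blk d in
  let N1 := k / (8 * L) in
  let N2 := Nat.min n (a * k) / (8 * L) in
  let cols := N / N2 + 1 in
  let B := N + n + d + 10 in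
  a <= n -> k <= n -> B ^ 3 <= 2 ^ w ->
  var s0 vN = N -> var s0 vd = d -> var s0 vn = n -> var s0 va = a -> var s0 vk = k ->
  runs w setup_code s0 11 (fun s' =>
    (forall x, ~ In x [vL; vN1; vN2; vcols; vcalls; vLX; vLY; vtheta; vmin] -> var s' x = var s0 x) /\
    arr s' = arr s0 /\
    (var s' vL = L /\ var s' vN1 = N1 /\ var s' vN2 = N2 /\ var s' vcols = cols) /\
    (var s' vcalls = (N / N1 + 1) * cols /\ var s' vLX = (N2 + 3 * N1) * L /\
     var s' vLY = (N2 + 2 * N1) * L) /\
    var s' vtheta = a * (N1 * L) + (N2 + 2 * N1) * L - ((N2 + 2 * N1) * d + d * N1 + 1)).
Proof.
  intros Hw L N1 N2 cols B Han Hkn HB EN Ed En Ea Ek.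
  assert (HL : L = 4 * d + 1) by reflexivity.
  assert (B3 : B ^ 3 = B * (B * B)) by (cbn; ring).
  assert (B2 : 10 * (B * B) <= 2 ^ w).
  { rewrite B3 in HB. etransitivity; [|exact HB]. apply Nat.mul_le_mono_r. unfold B; lia. }
  assert (B1 : 10 * B <= B * B) by (apply Nat.mul_le_mono_r; unfold B; lia).
  assert (Hak : a * k <= B * B) by (apply Nat.mul_le_mono; unfold B; lia).
  assert (F1 : N1 * L * 8 <= k).
  { unfold N1. pose proof (Nat.Div0.mul_div_le k (8 * L)). lia. }
  assert (F2 : N2 * L * 8 <= n).
  { unfold N2. pose proof (Nat.Div0.mul_div_le (Nat.min n (a * k)) (8 * L)). lia. }
  assert (F3 : N1 <= N1 * L) by (rewrite HL; destruct N1; lia).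
  assert (F4 : N2 <= N2 * L) by (rewrite HL; destruct N2; lia).
  assert (Hd1 : forall x, N / x <= N).
  { intros [|x]; [cbn; lia|]. apply Nat.Div0.div_le_upper_bound. destruct x; lia. }
  pose proof (Hd1 N1) as Hc1. pose proof (Hd1 N2) as Hc2.
  assert (Hcc : (N / N1 + 1) * cols <= B * B) by (apply Nat.mul_le_mono; unfold cols, B; lia).
  assert (Han1 : a * (N1 * L) <= B * B) by (apply Nat.mul_le_mono; unfold B; lia).
  assert (Hd2 : (N2 + 2 * N1) * d <= (N2 + 2 * N1) * L) by (apply Nat.mul_le_mono_l; lia).
  assert (Hd3 : d * N1 <= N1 * L) by (rewrite Nat.mul_comm; apply Nat.mul_le_mono_l; lia).
  assert (HBv : N + n + d + 10 = B) by reflexivity.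
  apply runs_le with (T := 1 + (1 + (S 1 + (1 + (1 + (1 + (1 + (1 + (1 + 1))))))))); [|lia].
  unfold setup_code.
  apply runs_seq. eapply runs_assign with (v := L); [rewrite HL; evaluate; try lia|].
  apply runs_seq. eapply runs_assign; [evaluate; try lia|].
  apply runs_seq.
  assert (G : forall s, (forall x, x <> vL -> x <> vmin -> var s x = var s0 x) -> arr s = arr s0 ->
    var s vL = L -> var s vmin = Nat.min n (a * k) ->
    runs w layout_code s (1 + (1 + (1 + (1 + (1 + (1 + 1)))))) (fun s' =>
    (forall x, ~ In x [vL; vN1; vN2; vcols; vcalls; vLX; vLY; vtheta; vmin] -> var s' x = var s0 x) /\
    arr s' = arr s0 /\
    (var s' vL = L /\ var s' vN1 = N1 /\ var s' vN2 = N2 /\ var s' vcols = cols) /\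
    (var s' vcalls = (N / N1 + 1) * cols /\ var s' vLX = (N2 + 3 * N1) * L /\
     var s' vLY = (N2 + 2 * N1) * L) /\
    var s' vtheta = a * (N1 * L) + (N2 + 2 * N1) * L - ((N2 + 2 * N1) * d + d * N1 + 1))).
  { intros s K As EL Em.
    pose proof (K 0 ltac:(lia) ltac:(lia)) as KN. rewrite EN in KN.
    pose proof (K 1 ltac:(lia) ltac:(lia)) as Kd. rewrite Ed in Kd.
    pose proof (K 9 ltac:(lia) ltac:(lia)) as Ka. rewrite Ea in Ka.
    pose proof (K 10 ltac:(lia) ltac:(lia)) as Kk. rewrite Ek in Kk.
    unfold layout_code.
    apply runs_seq. eapply runs_assign; [evaluate; try lia|]. fold N1.
    apply runs_seq. eapply runs_assign; [evaluate; try lia|]. fold N2.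
    apply runs_seq. eapply runs_assign; [evaluate; try lia|]. fold cols.
    apply runs_seq. eapply runs_assign; [evaluate; unfold cols; try lia|].
    apply runs_seq. eapply runs_assign; [evaluate; try lia|].
    apply runs_seq. eapply runs_assign; [evaluate; try lia|].
    eapply runs_assign; [evaluate; try lia|].
    cbn [var arr set_var]. unfold upd. cbn [Nat.eqb]. repeat split; auto.
    intros x Hx. simpl in Hx.
    repeat match goal with
    | |- context [?x =? ?b] => destruct (Nat.eqb_spec x b); [lia|]
    end. apply K; lia. }
  eapply runs_if_lt; [auto|evaluate; try lia|evaluate; try lia| |]; intros Hm.
  - apply runs_skip. apply G; cbn [var arr set_var]; unfold upd; cbn [Nat.eqb]; auto; [|lia].
    intros x H1 H2. destruct (Nat.eqb_spec x vmin), (Nat.eqb_spec x vL); try lia.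
  - eapply runs_assign; [evaluate; try lia|].
    apply G; cbn [var arr set_var]; unfold upd; cbn [Nat.eqb]; auto; [|lia].
    intros x H1 H2. destruct (Nat.eqb_spec x vmin), (Nat.eqb_spec x vL); try lia.
Qed.

Lemma runs_ov_program w ca ck cb g q Pa Pk Pe N d V a k Ta Tk TE (found : nat -> Prop) :
  let lam := Nat.log2 N / g + q in
  let n := 2 ^ lam in
  let S := 2 ^ ((ca + ck + cb) * (lam + 1)) in
  let L := blk d in
  let N1 := k / (8 * L) in
  let N2 := Nat.min n (a * k) / (8 * L) in
  let cols := N / N2 + 1 in
  let calls := (N / N1 + 1) * cols in
  let LX := (N2 + 3 * N1) * L in
  let LY := (N2 + 2 * N1) * L in
  let theta := a * (N1 * L) + LY - ((N2 + 2 * N1) * d + d * N1 + 1) in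
  let bits := map Nat.b2n (concat V) in
  0 < N -> 1 <= ca -> 1 <= ck -> 1 <= cb -> g < 2 ^ w ->
  1 <= a <= n -> k <= n -> 8 * L <= k ->
  (N + n + d + 10) ^ 4 * S <= 2 ^ w ->
  (exists t s', exec (ca * (lam + 1)) Pa (init [n] []) t s' /\ t <= Ta /\ var s' 0 = a) ->
  (exists t s', exec (ck * (lam + 1)) Pk (init [n] []) t s' /\ t <= Tk /\ var s' 0 = k) ->
  (forall z, z < calls -> exists t s',
    exec (cb * (lam + 1)) Pe (ED_input n
      (seg (text_sym d (text_bit N d N1 (z / cols * N1) bits)) 0 LX)
      (seg (pattern_sym d (is_vector N1 N2) (pattern_bit N d N1 N2 (z mod cols * N2) bits)) 0 LY)) t s' /\
    t <= TE /\
    (found z <-> var s' 0 = 0 /\ var s' 1 * a <= theta * var s' 2)) ->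
  runs w (ov_program ca ck cb g q Pa Pk Pe) (OV_input N d V)
    (3 * Nat.log2 N + Ta + Tk + guest_vars Pa + guest_vars Pk +
     calls * (15 * n + guest_vars Pe + TE + 21) + 40)
    (fun s' => var s' 0 <> 0 <-> exists z, z < calls /\ found z).
Proof.
  intros lam n S L N1 N2 cols calls LX LY theta bits HN Hca Hck Hcb Hg Ha Hkn HLk HB HPa HPk Hcall.
  set (B := N + n + d + 10) in *.
  assert (HL : L = 4 * d + 1) by reflexivity.
  assert (Hn0 : 0 < n) by (apply Nat.neq_0_lt_0, Nat.pow_nonzero; lia).
  assert (HlamS : lam < n) by (apply Nat.pow_gt_lin_r; lia).
  assert (HS0 : 0 < S) by (apply Nat.neq_0_lt_0, Nat.pow_nonzero; lia).
  assert (HB1 : 10 <= B) by (unfold B; lia).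
  assert (B4 : B ^ 4 = B * (B * (B * B))) by (cbn; ring).
  assert (B3 : B ^ 3 = B * (B * B)) by (cbn; ring).
  assert (HB3 : B ^ 3 * S * 10 <= 2 ^ w) by (rewrite B4 in HB; rewrite B3; nia).
  assert (HB2 : B * B * S * 100 <= 2 ^ w) by (rewrite B3 in HB3; nia).
  assert (HBS : B * S * 1000 <= 2 ^ w) by nia.
  assert (HB3' : B ^ 3 <= 2 ^ w) by nia.
  assert (HBB : B * B * 100 <= 2 ^ w) by nia.
  assert (HBw : B * 1000 <= 2 ^ w) by nia.
  assert (HSw : S * 100 <= 2 ^ w) by nia.
  assert (HW : (ca + ck + cb) * (lam + 1) < w).
  { apply (Nat.pow_lt_mono_r_iff 2); [lia|]. fold S. lia. }
  assert (Hw : 0 < w) by lia.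
  assert (Hwp : w < 2 ^ w) by (apply Nat.pow_gt_lin_r; lia).
  assert (Hpa : 2 ^ (ca * (lam + 1)) <= S) by (apply Nat.pow_le_mono_r; nia).
  assert (Hpk : 2 ^ (ck * (lam + 1)) <= S) by (apply Nat.pow_le_mono_r; nia).
  assert (Hpb : 2 ^ (cb * (lam + 1)) <= S) by (apply Nat.pow_le_mono_r; nia).
  assert (Hwa : ca * (lam + 1) < w) by nia.
  assert (Hwk : ck * (lam + 1) < w) by nia.
  assert (Hwb : cb * (lam + 1) < w) by nia.
  assert (Hcb1 : 1 * (lam + 1) <= cb * (lam + 1)) by (apply Nat.mul_le_mono_r; lia).
  assert (Hnb : n < 2 ^ (cb * (lam + 1))) by (apply Nat.pow_lt_mono_r; lia).
  assert (Hlog : Nat.log2 N < N) by (apply Nat.log2_lt_lin; lia).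
  assert (Hdg : Nat.log2 N / g <= Nat.log2 N).
  { destruct g as [|g']; [cbn; lia|]. apply Nat.Div0.div_le_upper_bound. clear; nia. }
  assert (Hc3 : (ca + ck + cb) * 1 <= (ca + ck + cb) * (lam + 1)) by (apply Nat.mul_le_mono_l; lia).
  assert (Hak : 1 * k <= a * k) by (apply Nat.mul_le_mono_r; lia).
  assert (Hmin : k <= Nat.min n (a * k)) by (apply Nat.min_glb; lia).
  assert (HN1 : 0 < N1) by (apply Nat.div_str_pos; lia).
  assert (HN2 : 0 < N2) by (apply Nat.div_str_pos; lia).
  assert (F1 : N1 * L * 8 <= k).
  { unfold N1. pose proof (Nat.Div0.mul_div_le k (8 * L)). lia. }
  assert (F2 : N2 * L * 8 <= n).
  { unfold N2. pose proof (Nat.Div0.mul_div_le (Nat.min n (a * k)) (8 * L)). lia. }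
  assert (F3 : N1 <= N1 * L) by (rewrite HL; destruct N1; lia).
  assert (F4 : N2 <= N2 * L) by (rewrite HL; destruct N2; lia).
  assert (Hd1 : forall x, N / x <= N).
  { intros [|x]; [cbn; lia|]. apply Nat.Div0.div_le_upper_bound. destruct x; lia. }
  pose proof (Hd1 N1) as Hc1. pose proof (Hd1 N2) as Hc2.
  assert (Hcc : calls + 3 <= B * B).
  { unfold calls. assert ((N / N1 + 1) * cols <= (N + 1) * (N + 1)) by (apply Nat.mul_le_mono; unfold cols; lia).
    assert ((N + 2) * (N + 2) <= B * B) by (apply Nat.mul_le_mono; unfold B; lia). lia. }
  assert (HaN : a * (N1 * L) <= B * n) by (apply Nat.mul_le_mono; unfold B; lia).
  assert (Hth : theta <= B * B).
  { unfold theta, LY. assert (1 * n <= B * n) by (apply Nat.mul_le_mono_r; lia). assert (B * (n + n) <= B * (2 * B)) by (apply Nat.mul_le_mono_l; unfold B; lia).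
    assert (B * (n + 1) <= B * B) by (apply Nat.mul_le_mono_l; unfold B; lia). lia. }
  assert (Hbits : forall i, nth i bits 0 <= 1).
  { intros i. destruct (Nat.lt_ge_cases i (length bits)) as [Hi|Hi].
    - assert (In (nth i bits 0) bits) as HI by (apply nth_In; auto).
      unfold bits in HI at 2. apply in_map_iff in HI as (b & <- & _). destruct b; cbn; lia.
    - rewrite nth_overflow by auto. lia. }
  apply runs_le with (T := 1 + (3 * Nat.log2 N + 1 + (1 + (1 + (1 + (1 +
    (Ta + guest_vars Pa + 4 + (1 + (Tk + guest_vars Pk + 4 + (1 + (11 +
    (calls * (15 * n + guest_vars Pe + TE + 21) + 1 + 1)))))))))))); [|lia].
  unfold ov_program.
  assert (E0 : forall x, var (OV_input N d V) (2 + x) = 0).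
  { intros x. cbn. destruct x; auto. }
  assert (EN0 : var (OV_input N d V) 0 = N) by reflexivity.
  assert (Ed0 : var (OV_input N d V) 1 = d) by reflexivity.
  assert (Eb0 : forall i, arr (OV_input N d V) 0 i = nth i bits 0) by reflexivity.
  assert (Ez0 : forall C i, 1 <= C -> arr (OV_input N d V) C i = 0).
  { intros [|[|C]] i HC; [lia| |]; cbn; destruct i; auto. }
  set (s0 := OV_input N d V) in *. clearbody s0.
  apply runs_seq. eapply runs_assign; [evaluate; try lia|].
  apply runs_seq. eapply runs_weaken; [apply (runs_log w _ N); auto; try lia|apply le_n|].
  { exact (E0 1). }
  intros s1 (El & A1 & K1).
  assert (Kz1 : forall x, 5 <= x -> var s1 x = 0).
  { intros x Hx. rewrite K1 by lia. unfold set_var, upd. cbn [var].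
    destruct (Nat.eqb_spec x vtmp); [lia|]. replace x with (2 + (x - 2)) by lia. apply E0. }
  assert (Kf1 : var s1 vfound = 0) by (rewrite K1 by lia; apply (E0 0)).
  assert (KN1 : var s1 vN = N) by (rewrite K1 by lia; exact EN0).
  assert (Kd1 : var s1 vd = d) by (rewrite K1 by lia; exact Ed0).
  cbn [arr set_var] in A1. clear K1.
  apply runs_seq. eapply runs_assign; [evaluate; try lia|]. fold lam.
  apply runs_seq. eapply runs_assign with (v := n); [eapply eval_pow2; [evaluate; try lia|evaluate; try lia|fold n; lia]|].
  apply runs_seq. eapply runs_assign; [evaluate; try lia|].
  apply runs_seq. eapply runs_assign with (v := S); [eapply eval_pow2; [evaluate; try lia|evaluate; try lia|fold S; lia]|].
  match goal with |- runs _ _ ?st _ _ => set (s2 := st) end.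
  apply runs_seq. eapply runs_weaken; [apply (runs_compute w ca Pa va s2 0 (lam + 1) a Ta n); auto; try lia|apply le_n|].
  { unfold s2. cbn [var set_var upd Nat.eqb]. apply Kz1. lia. }
  { intros C i HC _. unfold s2. cbn [arr set_var]. rewrite A1. auto. }
  intros s3 (Ea3 & K3 & A3 & Z3).
  assert (KS3 : var s3 vstride = S) by (rewrite K3 by lia; reflexivity).
  apply runs_seq. eapply runs_assign; [evaluate; try lia|].
  match goal with |- runs _ _ ?st _ _ => set (s4 := st) end.
  assert (K4 : forall x, x < guest -> x <> vmod -> x <> vbase -> x <> va -> var s4 x = var s2 x).
  { intros x H1 H2 H3 H4. rewrite <- K3 by auto. unfold s4, set_var, upd. cbn [var].
    destruct (Nat.eqb_spec x vbase); [lia|auto]. }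
  apply runs_seq. eapply runs_weaken; [apply (runs_compute w ck Pk vk s4 S (lam + 1) k Tk n); auto; try lia|apply le_n|].
  { rewrite K4 by lia. reflexivity. }
  { rewrite K4 by lia. reflexivity. }
  { intros C i HC Hi. unfold s4. cbn [arr set_var]. apply Z3; lia. }
  intros s5 (Ek5 & K5 & A5 & Z5).
  assert (K52 : forall x, x < guest -> x <> vmod -> x <> vbase -> x <> va -> x <> vk -> var s5 x = var s2 x).
  { intros x H1 H2 H3 H4 H5. rewrite K5, K4; auto. }
  assert (Et5 : var s5 vtmp = lam + 1) by (rewrite K52 by lia; reflexivity).
  apply runs_seq. eapply runs_assign with (v := 2 ^ (cb * (lam + 1))); [eapply eval_pow2; [evaluate; try lia|evaluate; try lia|lia]|].
  match goal with |- runs _ _ ?st _ _ => set (s6 := st) end.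
  assert (K6 : forall x, x <> vmod -> var s6 x = var s5 x).
  { intros x H1. unfold s6, set_var, upd. cbn [var]. destruct (Nat.eqb_spec x vmod); [lia|auto]. }
  assert (Ea5 : var s5 va = a) by (rewrite K5 by lia; exact Ea3).
  assert (Eb5 : var s5 vbase = S) by (rewrite K5 by lia; reflexivity).
  assert (M6 : var s6 vmod = 2 ^ (cb * (lam + 1))) by reflexivity.
  assert (A6 : arr s6 = arr s5) by reflexivity.
  assert (A50 : forall i, arr s5 0 i = nth i bits 0).
  { intros i. rewrite A5. unfold s4. cbn [arr set_var]. rewrite A3. unfold s2. cbn [arr set_var].
    rewrite A1. apply Eb0. }
  assert (EN5 : var s5 vN = N) by (rewrite K52 by lia; exact KN1).
  assert (Ed5 : var s5 vd = d) by (rewrite K52 by lia; exact Kd1).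
  assert (Ef5 : var s5 vfound = 0) by (rewrite K52 by lia; exact Kf1).
  assert (En5 : var s5 vn = n) by (rewrite K52 by lia; reflexivity).
  assert (ES5 : var s5 vstride = S) by (rewrite K52 by lia; reflexivity).
  assert (Ez5 : var s5 vz = 0) by (rewrite K52 by lia; apply Kz1; lia).
  clearbody s6. clear K52 K5 K4 K3.
  apply runs_seq. eapply runs_weaken; [apply (runs_setup w s6 N d n a k Hw); auto; try lia|apply le_n|].
  1-5: rewrite K6 by lia; assumption.
  intros s7 (K7 & A7 & (EL7 & EN17 & EN27 & Ec7) & (Ecc7 & EX7 & EY7) & Et7).
  assert (K75 : forall x, x <> vmod -> ~ In x [vL; vN1; vN2; vcols; vcalls; vLX; vLY; vtheta; vmin] -> var s7 x = var s5 x).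
  { intros x H1 H2. rewrite K7, K6; auto. }
  apply runs_seq. eapply runs_weaken; [eapply (runs_loop w (cb * (lam + 1)) N d n a N1 N2 S LX LY theta TE bits Pe found); auto; try lia|apply le_n|].
  - change ((calls + 3) * S <= 2 ^ w). transitivity (B * B * S); [apply Nat.mul_le_mono_r; auto|lia].
  - apply Nat.le_lt_trans with (B * B * S); [apply Nat.mul_le_mono_r; auto|lia].
  - apply Nat.le_lt_trans with (B * S); [apply Nat.mul_le_mono_r; unfold B; lia|].
    assert (0 < B * S) by (apply Nat.mul_pos_pos; lia). lia.
  - split; [|split; [|split; [|split; [|split; [|split]]]]].
    + repeat split; auto;
      try (rewrite K75 by (simpl; lia); assumption).
      rewrite K7 by (simpl; lia). assumption.
    + rewrite K75 by (simpl; lia). assumption.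
    + rewrite K75 by (simpl; lia). lia.
    + intros i. rewrite A7, A6. apply A50.
    + intros C i HC Hi. rewrite A7, A6. apply Z5; lia.
    + left. rewrite K75 by (simpl; lia). assumption.
    + rewrite K75 by (simpl; lia). rewrite Ef5. split; [lia|]. intros (z' & Hz' & _). lia.
  - intros s8 (_ & _ & _ & _ & _ & H01 & Hf).
    eapply runs_assign; [evaluate; destruct H01 as [-> | ->]; lia|].
    cbn [var set_var upd Nat.eqb]. exact Hf.
Qed.

(** * Correctness of the reduction *)

Definition cell_orthogonal (N d N1 N2 i0 j0 : nat) (bits : list nat) : Prop :=
  exists t j, t < N1 /\ j < N2 /\
  dot d (text_bit N d N1 i0 bits (N1 + j + t)) (pattern_bit N d N1 N2 j0 bits (N1 + j)) = 0.

Lemma shift_residue N1 i j : 0 < N1 ->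
  exists t, t < N1 /\ (N1 + j + t) mod N1 = i mod N1.
Proof.
  intros H. exists ((i + (N1 - j mod N1)) mod N1).
  split; [apply Nat.mod_upper_bound; lia|].
  rewrite Nat.Div0.add_mod_idemp_r.
  pose proof (Nat.div_mod j N1 ltac:(lia)). pose proof (Nat.mod_upper_bound j N1 ltac:(lia)).
  replace (N1 + j + (i + (N1 - j mod N1))) with (i + (j / N1 + 2) * N1) by nia.
  apply Nat.Div0.mod_add.
Qed.

Lemma ED_decision a k N d N1 N2 i0 j0 bits s :
  let NY := N2 + 2 * N1 in
  let theta := a * (N1 * blk d) + NY * blk d - (NY * d + d * N1 + 1) in
  1 <= a -> 0 < N1 ->
  NY * d + d * N1 + 1 <= a * (N1 * blk d) + NY * blk d ->
  a * (N1 * blk d) + NY * blk d <= a * k ->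
  ED_output a k (seg (text_sym d (text_bit N d N1 i0 bits)) 0 ((N2 + 3 * N1) * blk d))
    (seg (pattern_sym d (is_vector N1 N2) (pattern_bit N d N1 N2 j0 bits)) 0 (NY * blk d)) s ->
  (cell_orthogonal N d N1 N2 i0 j0 bits <-> var s 0 = 0 /\ var s 1 * a <= theta * var s 2).
Proof.
  intros NY theta Ha HN1 Hth1 Hth2 (r & (Hr & Hmin) & Hout).
  assert (HaR : (1 <= INR a)%R) by (apply le_INR in Ha; exact Ha).
  assert (Ha' : (0 < 1 / INR a)%R) by (apply Rdiv_lt_0_compat; lra).
  replace ((N2 + 3 * N1) * blk d) with ((NY + N1) * blk d) in * by (unfold NY; lia).
  assert (Eth : INR theta = (INR a * INR (N1 * blk d) + INR (NY * blk d) - INR (NY * d + d * N1) - 1)%R).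
  { unfold theta. rewrite minus_INR by auto. rewrite (plus_INR (a * _)), (mult_INR a).
    rewrite (plus_INR (NY * d + d * N1) 1). simpl (INR 1). ring. }
  assert (Hk : (INR theta <= INR a * INR k)%R).
  { rewrite <- mult_INR. apply le_INR. unfold theta. lia. }
  split.
  - intros (t & j & Ht & Hj & Hdot).
    destruct (pattern_upper_bound (INR a) d (text_bit N d N1 i0 bits) (is_vector N1 N2)
      (pattern_bit N d N1 N2 j0 bits) HaR N1 N2 t j Ht Hj) as (r' & Hal & Hr'); auto.
    { intros q Hq. assert (E : is_vector N1 N2 q = false).
      { unfold is_vector. destruct (Nat.ltb_spec q N1), (Nat.ltb_spec q (N1 + N2)); auto; lia. }
      split; [exact E|]. intros p. unfold pattern_bit. now rewrite E. }
    { unfold is_vector. destruct (Nat.ltb_spec (N1 + j) N1), (Nat.ltb_spec (N1 + j) (N1 + N2)); auto; lia. }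
    fold NY in Hal, Hr'. apply align_edit_seq in Hal. apply Hmin in Hal.
    assert (Hle : (INR a * r <= INR theta)%R).
    { rewrite Eth. eapply Rle_trans; [apply Rmult_le_compat_l; [lra|exact Hal]|lra]. }
    destruct Hout as [[_ Hgt]|(H0 & H2 & Er)].
    + exfalso. apply (Rmult_gt_compat_l (INR a)) in Hgt; lra.
    + split; [exact H0|]. apply INR_le. rewrite !mult_INR.
      assert (0 < INR (var s 2))%R by (apply lt_0_INR; lia).
      rewrite Er in Hle. apply (Rmult_le_compat_r (INR (var s 2))) in Hle; [|lra].
      replace (INR a * (INR (var s 1) / INR (var s 2)) * INR (var s 2))%R
        with (INR (var s 1) * INR a)%R in Hle by (field; lra). exact Hle.
  - intros [H0 Hle].
    destruct Hout as [[Hn _]|(_ & H2 & Er)]; [contradiction|].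
    destruct (classic (cell_orthogonal N d N1 N2 i0 j0 bits)) as [Hc|Hc]; [exact Hc|exfalso].
    apply (edit_seq_align (INR a)) in Hr as (r' & Hr' & Hal); [|exact Ha'].
    apply (pattern_lower_bound d (text_bit N d N1 i0 bits) (is_vector N1 N2)
      (pattern_bit N d N1 N2 j0 bits)) in Hal; [| |exact HaR].
    + assert (H3 : (INR theta + 1 <= INR a * r)%R).
      { rewrite Eth. eapply Rle_trans; [|apply Rmult_le_compat_l; [lra|exact Hr']]. lra. }
      assert (0 < INR (var s 2))%R by (apply lt_0_INR; lia).
      apply le_INR in Hle. rewrite !mult_INR in Hle.
      rewrite Er in H3. apply (Rmult_le_compat_r (INR (var s 2))) in H3; [|lra].
      replace (INR a * (INR (var s 1) / INR (var s 2)) * INR (var s 2))%R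
        with (INR (var s 1) * INR a)%R in H3 by (field; lra). lra.
    + intros i q Hq. unfold is_vector in Hq.
      destruct (Nat.ltb_spec q N1), (Nat.ltb_spec q (N1 + N2)); try discriminate.
      destruct (shift_residue N1 i (q - N1) HN1) as (t & Ht & Em).
      destruct (Nat.eq_dec (dot d (text_bit N d N1 i0 bits i) (pattern_bit N d N1 N2 j0 bits q)) 0) as [E|]; [|lia].
      exfalso; apply Hc. exists t, (q - N1). split; [exact Ht|split; [lia|]].
      unfold text_bit in *. rewrite Em. replace (N1 + (q - N1)) with q by lia. exact E.
Qed.

Lemma nth_concat (V : list (list bool)) d i p :
  Forall (fun v => length v = d) V -> i < length V -> p < d ->
  nth (i * d + p) (map Nat.b2n (concat V)) 0 = Nat.b2n (nth p (nth i V []) false).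
Proof.
  intros HV; revert i; induction HV as [|v V Hv HV IH]; intros i Hi Hp; [simpl in Hi; lia|].
  cbn [concat]. rewrite map_app. destruct i as [|i].
  - rewrite app_nth1 by (rewrite length_map; lia). cbn [nth Nat.mul Nat.add].
    change 0 with (Nat.b2n false) at 1. apply map_nth.
  - rewrite app_nth2 by (rewrite length_map; lia). rewrite length_map.
    replace (S i * d + p - length v) with (i * d + p) by lia.
    apply IH; [simpl in Hi; lia|auto].
Qed.

Lemma inner_dot d u v : length u = d -> length v = d ->
  inner u v = dot d (fun p => nth p u false) (fun p => nth p v false).
Proof.
  unfold inner, dot. revert u v; induction d as [|d IH]; intros [|x u] [|y v] Hu Hv; try discriminate; auto.
  injection Hu as Hu. injection Hv as Hv. cbn [combine map seq]. rewrite <- seq_shift, map_map.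
  cbn [list_sum fold_right nth fst snd]. unfold list_sum in IH. rewrite (IH u v Hu Hv).
  f_equal. destruct x, y; reflexivity.
Qed.

Lemma dot_ext d f f' g g' : (forall p, p < d -> f p = f' p) -> (forall p, p < d -> g p = g' p) ->
  dot d f g = dot d f' g'.
Proof.
  intros Hf Hg. unfold dot. f_equal. apply map_ext_in. intros p Hp. apply in_seq in Hp.
  rewrite Hf, Hg by lia. reflexivity.
Qed.

Lemma cells_orthogonal N d N1 N2 V :
  0 < N1 -> 0 < N2 -> 0 < N -> is_OV_instance N d V ->
  let cols := N / N2 + 1 in
  ((exists z, z < (N / N1 + 1) * cols /\
      cell_orthogonal N d N1 N2 (z / cols * N1) (z mod cols * N2) (map Nat.b2n (concat V)))
   <-> has_orthogonal_pair V).
Proof.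
  intros HN1 HN2 HN (_ & Hlen & HV) cols.
  assert (Hbit : forall i p, i < N -> p < d ->
    bit d (map Nat.b2n (concat V)) i p = nth p (nth i V []) false).
  { intros i p Hi Hp. unfold bit. rewrite nth_concat by (auto; lia). destruct (nth p _ _); reflexivity. }
  assert (HVl : forall i, i < N -> length (nth i V []) = d).
  { intros i Hi. rewrite Forall_forall in HV. apply HV, nth_In. lia. }
  assert (Hcell : forall i0 j0 i j, j < N2 ->
    dot d (text_bit N d N1 i0 (map Nat.b2n (concat V)) i)
      (pattern_bit N d N1 N2 j0 (map Nat.b2n (concat V)) (N1 + j)) =
    inner (nth ((i0 + i mod N1) mod N) V []) (nth ((j0 + j) mod N) V [])).
  { intros i0 j0 i j Hj.
    assert (H1 : (i0 + i mod N1) mod N < N) by (apply Nat.mod_upper_bound; lia).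
    assert (H2 : (j0 + j) mod N < N) by (apply Nat.mod_upper_bound; lia).
    rewrite (inner_dot d) by auto. apply dot_ext.
    - intros p Hp. unfold text_bit. now apply Hbit.
    - intros p Hp. unfold pattern_bit, is_vector.
      destruct (Nat.ltb_spec (N1 + j) N1), (Nat.ltb_spec (N1 + j) (N1 + N2)); try lia.
      replace (N1 + j - N1) with j by lia. now apply Hbit. }
  split.
  - intros (z & _ & t & j & Ht & Hj & Hdot). rewrite Hcell in Hdot by auto.
    do 2 eexists. split; [|split; [|exact Hdot]]; apply nth_In; rewrite Hlen; apply Nat.mod_upper_bound; lia.
  - intros (u & v & Hu & Hv & Huv).
    apply (In_nth _ _ []) in Hu as (x & Hx & <-). apply (In_nth _ _ []) in Hv as (y & Hy & <-).
    rewrite Hlen in Hx, Hy.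
    assert (Hy2 : y / N2 < cols).
    { unfold cols. pose proof (Nat.Div0.div_le_mono y N N2). lia. }
    assert (Hx1 : x / N1 < N / N1 + 1).
    { pose proof (Nat.Div0.div_le_mono x N N1). lia. }
    exists (x / N1 * cols + y / N2). split; [nia|].
    destruct (block_divmod cols (x / N1) (y / N2) Hy2) as [-> ->].
    destruct (shift_residue N1 (x mod N1) (y mod N2) HN1) as (t & Ht & Et).
    exists t, (y mod N2). split; [exact Ht|].
    split; [apply Nat.mod_upper_bound; lia|].
    rewrite Hcell by (apply Nat.mod_upper_bound; lia).
    rewrite Et, Nat.Div0.mod_mod.
    replace (x / N1 * N1 + x mod N1) with x by (pose proof (Nat.div_mod x N1); lia).
    replace (y / N2 * N2 + y mod N2) with y by (pose proof (Nat.div_mod y N2); lia).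
    rewrite !Nat.mod_small by auto. exact Huv.
Qed.

(** * The trivial linear lower bound *)

Lemma edit_seq_nonneg {A} (a : R) (X Y : list A) r : (0 < 1 / a)%R -> edit_seq a X Y r ->
  (0 <= r)%R /\ (r = 0%R -> X = Y).
Proof.
  intros Ha; induction 1 as [|X Y Z r1 r2 Hop _ [IH1 IH2]]; [split; auto; lra|].
  assert (0 < r1)%R by (destruct Hop; lra). split; [lra|intros; lra].
Qed.

Lemma ED_solver_reads_half (p : cmd) (b a k n : nat) (T : R) :
  2 <= n -> 1 <= a -> 1 <= k ->
  (forall X Y, is_ED_instance n X Y ->
    halts_within (word_size b n) p (ED_input n X Y) T (ED_output a k X Y)) ->
  exists t, (INR t <= T)%R /\ n / 2 <= csize p * t.
Proof.
  intros Hn Ha Hk H.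
  assert (HaR : (1 <= INR a)%R) by (apply le_INR in Ha; exact Ha).
  assert (Ha' : (0 < 1 / INR a)%R) by (apply Rdiv_lt_0_compat; lra).
  set (m := n / 2).
  assert (Hm : 2 * m <= n) by (apply Nat.Div0.mul_div_le).
  set (X := repeat 0 m).
  assert (HX : is_ED_instance n X X).
  { split; [unfold X; rewrite repeat_length; lia|].
    apply Forall_app; split; apply Forall_forall; intros x Hx; apply repeat_spec in Hx; lia. }
  destruct (H X X HX) as (t & s & He & Ht & (r & (Hr & Hmin) & Hout)).
  exists t. split; [exact Ht|].
  destruct (Nat.le_gt_cases m (csize p * t)) as [Hle|Hlt]; [exact Hle|exfalso].
  destruct (exec_agree 1 _ _ _ _ _ He) as (l & Hl & Hagree).
  assert (Hj : exists j, j < m /\ ~ In j l).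
  { apply NNPP. intros Hno.
    assert (m <= length l); [|lia].
    rewrite <- (length_seq m 0). apply NoDup_incl_length; [apply seq_NoDup|].
    intros j Hj. apply in_seq in Hj. apply NNPP. intros Hjl. apply Hno. exists j. split; [lia|auto]. }
  destruct Hj as (j & Hj & Hjl).
  set (Y := repeat 0 j ++ 1 :: repeat 0 (m - 1 - j)).
  assert (HYl : length Y = m) by (unfold Y; rewrite length_app; cbn [length]; rewrite !repeat_length; lia).
  assert (HY : is_ED_instance n X Y).
  { split; [rewrite HYl; unfold X; rewrite repeat_length; lia|].
    apply Forall_app; split; [apply Forall_forall; intros x Hx; apply repeat_spec in Hx; lia|].
    apply Forall_app; split; [|constructor; [lia|]];
    apply Forall_forall; intros x Hx; apply repeat_spec in Hx; lia. }
  assert (nth_repeat0 : forall i c, nth i (repeat 0 c) 0 = 0).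
  { intros i c; revert i; induction c as [|c IH]; intros [|i]; cbn; auto. }
  destruct (Hagree j (ED_input n X Y) Hjl) as (s' & He' & [Hv _]).
  { split.
    - intros x. cbn [var ED_input init]. rewrite HYl. unfold X at 1 2. rewrite !repeat_length.
      unfold X. rewrite repeat_length. reflexivity.
    - intros [|[|A]] i Hi; cbn [arr ED_input init nth]; auto.
      unfold X, Y. rewrite nth_repeat0.
      destruct (Nat.lt_ge_cases i j) as [Hij|Hij].
      + rewrite app_nth1 by (rewrite repeat_length; lia). symmetry; apply nth_repeat0.
      + rewrite app_nth2 by (rewrite repeat_length; lia). rewrite repeat_length.
        destruct (i - j) as [|i'] eqn:E; [lia|]. cbn [nth]. symmetry; apply nth_repeat0. }
  destruct (H X Y HY) as (t2 & s2 & He2 & _ & (r2 & (Hr2 & _) & Hout2)).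
  assert (s2 = s') as -> by (eapply exec_det; eauto).
  assert (r = 0)%R.
  { apply Rle_antisym; [apply Hmin; constructor|]. eapply edit_seq_nonneg; eauto. }
  assert (r2 = 0)%R.
  { assert (1 <= INR k)%R by (apply le_INR in Hk; exact Hk).
    destruct Hout as [[_ Hgt]|(E0 & E2 & Er)]; [lra|].
    destruct Hout2 as [[Hn0 _]|(_ & _ & ->)]; [rewrite <- Hv in Hn0; contradiction|].
    rewrite <- !Hv. lra. }
  assert (HXY : X = Y) by (eapply edit_seq_nonneg; eauto).
  apply (f_equal (fun l => nth j l 0)) in HXY. unfold X, Y in HXY.
  rewrite nth_repeat0, app_nth2, repeat_length, Nat.sub_diag in HXY by (rewrite repeat_length; lia).
  discriminate.
Qed.

Lemma ov_program_correct w ca ck cb g q Pa Pk Pe N d V a k Ta Tk TE T :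
  let lam := Nat.log2 N / g + q in
  let n := 2 ^ lam in
  let S := 2 ^ ((ca + ck + cb) * (lam + 1)) in
  let L := blk d in
  let N1 := k / (8 * L) in
  let N2 := Nat.min n (a * k) / (8 * L) in
  let calls := (N / N1 + 1) * (N / N2 + 1) in
  0 < N -> is_OV_instance N d V -> 1 <= ca -> 1 <= ck -> 1 <= cb -> g < 2 ^ w ->
  1 <= a <= n -> k <= n -> 8 * L <= k ->
  (N + n + d + 10) ^ 4 * S <= 2 ^ w ->
  halts_within (word_size ca n) Pa (init [n] []) (INR Ta) (fun s => var s 0 = a) ->
  halts_within (word_size ck n) Pk (init [n] []) (INR Tk) (fun s => var s 0 = k) ->
  (forall X Y, is_ED_instance n X Y ->
    halts_within (word_size cb n) Pe (ED_input n X Y) T (ED_output a k X Y)) ->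
  (forall t, (INR t <= T)%R -> t <= TE) ->
  runs w (ov_program ca ck cb g q Pa Pk Pe) (OV_input N d V)
    (3 * Nat.log2 N + Ta + Tk + guest_vars Pa + guest_vars Pk +
     calls * (15 * n + guest_vars Pe + TE + 21) + 40)
    (fun s' => var s' 0 <> 0 <-> has_orthogonal_pair V).
Proof.
  intros lam n S L N1 N2 calls HN HV Hca Hck Hcb Hg Ha Hkn HLk HB HPa HPk HPe HTE.
  assert (Hlog : Nat.log2 n = lam) by (apply Nat.log2_pow2; lia).
  unfold word_size in HPa, HPk, HPe. rewrite Hlog in HPa, HPk, HPe.
  assert (HL : L = 4 * d + 1) by reflexivity.
  assert (Hak : 1 * k <= a * k) by (apply Nat.mul_le_mono_r; lia).
  assert (HN1 : 0 < N1) by (apply Nat.div_str_pos; lia).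
  assert (HN2 : 0 < N2) by (apply Nat.div_str_pos; lia).
  assert (F1 : N1 * L * 8 <= k).
  { unfold N1. pose proof (Nat.Div0.mul_div_le k (8 * L)). lia. }
  assert (F2 : N2 * L * 8 <= Nat.min n (a * k)).
  { unfold N2. pose proof (Nat.Div0.mul_div_le (Nat.min n (a * k)) (8 * L)). lia. }
  set (bits := map Nat.b2n (concat V)).
  set (cols := N / N2 + 1).
  eapply runs_weaken; [apply (runs_ov_program w ca ck cb g q Pa Pk Pe N d V a k Ta Tk TE
    (fun z => cell_orthogonal N d N1 N2 (z / cols * N1) (z mod cols * N2) bits)); auto|apply le_n|].
  - destruct HPa as (t & s & He & Ht & Hs). apply INR_le in Ht. eauto.
  - destruct HPk as (t & s & He & Ht & Hs). apply INR_le in Ht. eauto.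
  - intros z Hz. fold lam. fold n. fold L. fold N1. fold N2. fold bits. fold cols.
    set (X := seg (text_sym d (text_bit N d N1 (z / cols * N1) bits)) 0 ((N2 + 3 * N1) * L)).
    set (Y := seg (pattern_sym d (is_vector N1 N2) (pattern_bit N d N1 N2 (z mod cols * N2) bits)) 0 ((N2 + 2 * N1) * L)).
    destruct (HPe X Y) as (t & s & He & Ht & Hs).
    { split.
      - unfold X, Y. rewrite !length_seg. lia.
      - assert (L + 2 <= n) by lia. unfold L in H.
        apply Forall_app; split; apply Forall_forall; intros x Hx;
          apply in_map_iff in Hx as (y & <- & _).
        + pose proof (text_sym_lt d (text_bit N d N1 (z / cols * N1) bits) y). lia.
        + pose proof (pattern_sym_lt d (is_vector N1 N2) (pattern_bit N d N1 N2 (z mod cols * N2) bits) y). lia. }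
    exists t, s. split; [exact He|split; [apply HTE; exact Ht|]].
    assert (G1 : 1 * (N1 * L) <= a * (N1 * L)) by (apply Nat.mul_le_mono_r; lia).
    assert (G2 : a * (N1 * L * 8) <= a * k) by (apply Nat.mul_le_mono_l; lia).
    apply (ED_decision a k N d N1 N2 (z / cols * N1) (z mod cols * N2) bits s); auto; try lia.
  - intros s'. fold lam. fold n. fold L. fold N1. fold N2. fold cols. fold calls. cbv beta.
    intros ->. apply (cells_orthogonal N d N1 N2 V HN1 HN2 HN HV).
Qed.

(** * Running time of the reduction *)

Lemma calls_bound N n k m d N1 N2 Q :
  let L := blk d in
  N1 = k / (8 * L) -> N2 = m / (8 * L) -> 8 * L <= k -> 8 * L <= m -> k <= n -> m <= n ->
  n <= Q * N ->
  (N / N1 + 1) * (N / N2 + 1) * (k * m) <= 256 * ((Q + 1) * N * ((Q + 1) * N)) * (L * L).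
Proof.
  intros L E1 E2 Hk Hm Hkn Hmn HQ.
  assert (HL : 0 < L) by (unfold L, blk; lia).
  assert (G : forall x y, 8 * L <= x -> x <= n -> y = x / (8 * L) ->
    (N / y + 1) * x <= 16 * ((Q + 1) * N) * L).
  { intros x y Hx Hxn Ey.
    assert (Hy : 0 < y) by (rewrite Ey; apply Nat.div_str_pos; lia).
    pose proof (Nat.div_mod x (8 * L) ltac:(lia)) as Ex. rewrite <- Ey in Ex.
    pose proof (Nat.mod_upper_bound x (8 * L) ltac:(lia)).
    assert (Hx16 : x <= y * (16 * L)) by nia.
    assert (Hyn : y <= n) by (clear -Ex Hxn HL; nia).
    pose proof (Nat.Div0.mul_div_le N y) as HNy.
    transitivity ((N / y + 1) * y * (16 * L)).
    - rewrite <- Nat.mul_assoc. apply Nat.mul_le_mono_l; auto.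
    - assert ((N / y + 1) * y <= (Q + 1) * N) by lia.
      transitivity ((Q + 1) * N * (16 * L)); [apply Nat.mul_le_mono_r; auto|lia]. }
  pose proof (G k N1 Hk Hkn E1) as G1. pose proof (G m N2 Hm Hmn E2) as G2.
  pose proof (Nat.mul_le_mono _ _ _ _ G1 G2). lia.
Qed.

Local Open Scope R_scope.

Lemma Rpower_eventually_gt (s K : R) : 0 < s ->
  exists n0 : nat, forall n : nat, (n0 <= n)%nat -> K < Rpower (INR n) s.
Proof.
  intros Hs.
  set (K1 := Rmax K 1).
  assert (HK1 : 1 <= K1) by apply Rmax_r.
  destruct (INR_unbounded (Rpower K1 (/ s))) as [n0 Hn0].
  exists n0. intros n Hn. apply le_INR in Hn.
  apply Rle_lt_trans with K1; [apply Rmax_l|].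
  assert (Hp : 0 < Rpower K1 (/ s)) by apply exp_pos.
  replace K1 with (Rpower (Rpower K1 (/ s)) s).
  - apply Rlt_Rpower_l; lra.
  - rewrite Rpower_mult. replace (/ s * s) with 1 by (field; lra). apply Rpower_1; lra.
Qed.

Lemma ln_le_Rpower (s x : R) : 0 < s -> 1 <= x -> ln x <= Rpower x s / s.
Proof.
  intros Hs Hx. apply (Rmult_le_reg_r s); [auto|].
  replace (Rpower x s / s * s) with (Rpower x s) by (field; lra).
  assert (H := exp_ineq1_le (s * ln x)). unfold Rpower. lra.
Qed.

Lemma Rpower_ge_1 (x s : R) : 1 <= x -> 0 <= s -> 1 <= Rpower x s.
Proof. intros Hx Hs. rewrite <- (Rpower_O x) by lra. now apply Rle_Rpower. Qed.

Lemma nat_ceiling (r : R) : 0 <= r ->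
  exists m : nat, INR m <= r + 1 /\ forall t : nat, INR t <= r -> (t <= m)%nat.
Proof.
  intros Hr. destruct (archimed r) as [H1 H2].
  exists (Z.to_nat (up r)).
  assert (E : INR (Z.to_nat (up r)) = IZR (up r)).
  { rewrite INR_IZR_INZ, Z2Nat.id; [auto|]. apply le_IZR. lra. }
  rewrite E. split; [lra|]. intros t Ht. apply INR_le. lra.
Qed.

Lemma sublinear_time (n km e0 : R) : 0 < e0 <= 1 / 2 -> 1 <= n -> 0 <= km ->
  km <= Rpower n (1 + e0 / 2) -> Rpower (n + km) (1 - e0) <= 2 * Rpower n (1 - e0 / 2).
Proof.
  intros He Hn Hkm H.
  assert (H1 : n <= Rpower n (1 + e0 / 2)).
  { rewrite <- (Rpower_1 n) at 1 by lra. apply Rle_Rpower; lra. }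
  apply Rle_trans with (Rpower (2 * Rpower n (1 + e0 / 2)) (1 - e0)).
  { apply Rle_Rpower_l; lra. }
  rewrite <- Rpower_mult_distr by (lra || apply exp_pos).
  apply Rmult_le_compat; try (left; apply exp_pos).
  - rewrite <- (Rpower_1 2) at 2 by lra. apply Rle_Rpower; lra.
  - rewrite Rpower_mult. apply Rle_Rpower; [lra|nra].
Qed.

Lemma superlinear_time (n km e0 : R) : 0 < e0 <= 1 / 2 -> 1 <= n ->
  Rpower n (1 + e0 / 2) <= km ->
  Rpower (n + km) (1 - e0) <= 2 * (km * Rpower n (- (e0 / 2))) /\
  n <= km * Rpower n (- (e0 / 2)).
Proof.
  intros He Hn H.
  assert (H1 : n <= Rpower n (1 + e0 / 2)).
  { rewrite <- (Rpower_1 n) at 1 by lra. apply Rle_Rpower; lra. }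
  split.
  - apply Rle_trans with (Rpower (2 * km) (1 - e0)).
    { apply Rle_Rpower_l; lra. }
    rewrite <- Rpower_mult_distr by lra.
    apply Rmult_le_compat; try (left; apply exp_pos).
    + rewrite <- (Rpower_1 2) at 2 by lra. apply Rle_Rpower; lra.
    + replace (1 - e0) with (1 + - e0) by ring.
      rewrite Rpower_plus, Rpower_1 by lra. apply Rmult_le_compat_l; [lra|].
      rewrite !Rpower_Ropp. apply Rinv_le_contravar; [apply exp_pos|].
      apply Rle_trans with (Rpower n e0); [apply Rle_Rpower; lra|apply Rle_Rpower_l; lra].
  - apply Rle_trans with (Rpower n (1 + e0 / 2) * Rpower n (- (e0 / 2))).
    + rewrite <- Rpower_plus. replace (1 + e0 / 2 + - (e0 / 2)) with 1 by ring. rewrite Rpower_1; lra.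
    + apply Rmult_le_compat_r; [left; apply exp_pos|exact H].
Qed.

Lemma log_scale (N g q : nat) : (0 < N)%nat -> (0 < g)%nat -> (0 < q)%nat ->
  let n := (2 ^ (Nat.log2 N / g + q))%nat in
  (N <= n ^ g /\ n <= 2 ^ q * N /\ forall e, e <= g -> n ^ e <= 2 ^ (q * g) * N)%nat.
Proof.
  intros HN Hg Hq n.
  pose proof (Nat.log2_spec N HN) as [H1 H2].
  pose proof (Nat.div_mod (Nat.log2 N) g ltac:(lia)) as Hd.
  pose proof (Nat.mod_upper_bound (Nat.log2 N) g ltac:(lia)).
  set (l := Nat.log2 N) in *. set (r := (l / g)%nat) in *.
  assert (Hng : (n ^ g = 2 ^ ((r + q) * g))%nat) by (unfold n; now rewrite <- Nat.pow_mul_r).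
  assert (Hup : (n ^ g <= 2 ^ (q * g) * N)%nat).
  { rewrite Hng. transitivity (2 ^ (q * g + l))%nat.
    - apply Nat.pow_le_mono_r; nia.
    - rewrite Nat.pow_add_r. apply Nat.mul_le_mono_l; auto. }
  repeat split.
  - rewrite Hng. transitivity (2 ^ S l)%nat; [lia|]. apply Nat.pow_le_mono_r; nia.
  - unfold n. rewrite Nat.pow_add_r, Nat.mul_comm. apply Nat.mul_le_mono_l.
    transitivity (2 ^ l)%nat; [|auto]. apply Nat.pow_le_mono_r; nia.
  - intros e He. etransitivity; [|exact Hup]. apply Nat.pow_le_mono_r; [|auto].
    unfold n. apply Nat.pow_nonzero. lia.
Qed.

Lemma word_bound (N d g q cn cs b : nat) : (0 < N)%nat ->
  (d <= (2 * cn + 1) * N)%nat ->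
  b = (4 * (q + 2 * cn + 13) + cs * (q + 1) + g)%nat ->
  let n := (2 ^ (Nat.log2 N / g + q))%nat in
  ((N + n + d + 10) ^ 4 * 2 ^ (cs * (Nat.log2 N / g + q + 1)) <= 2 ^ word_size b N /\
   g < 2 ^ word_size b N)%nat.
Proof.
  intros HN Hd Eb n. unfold word_size.
  pose proof (Nat.log2_spec N HN) as [H1 H2].
  assert (Hr : (Nat.log2 N / g <= Nat.log2 N)%nat).
  { destruct g as [|g]; [cbn; lia|]. apply Nat.Div0.div_le_upper_bound. nia. }
  set (l := Nat.log2 N) in *. set (r := (l / g)%nat) in *.
  set (Z := (2 ^ (l + 1))%nat).
  assert (HNZ : (N < Z)%nat) by (unfold Z; now rewrite Nat.add_1_r).
  assert (Hn : (n <= 2 ^ q * Z)%nat).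
  { unfold n, Z. rewrite <- Nat.pow_add_r. apply Nat.pow_le_mono_r; lia. }
  set (m0 := (q + 2 * cn + 12)%nat).
  assert (Hm0 : (2 ^ q + 2 * cn + 12 <= 2 ^ m0)%nat).
  { unfold m0. replace (q + 2 * cn + 12)%nat with (q + (2 * cn + 12))%nat by lia. rewrite Nat.pow_add_r.
    pose proof (Nat.pow_nonzero 2 q ltac:(lia)).
    pose proof (Nat.pow_gt_lin_r 2 (2 * cn + 12) ltac:(lia)).
    set (A := (2 ^ q)%nat) in *. set (A' := (2 ^ (2 * cn + 12))%nat) in *.
    clearbody A A'. nia. }
  assert (HB : (N + n + d + 10 <= 2 ^ ((m0 + 1) * (l + 1)))%nat).
  { transitivity (2 ^ m0 * Z)%nat.
    - transitivity ((2 ^ q + 2 * cn + 12) * Z)%nat; [nia|apply Nat.mul_le_mono_r; auto].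
    - unfold Z. rewrite <- Nat.pow_add_r. apply Nat.pow_le_mono_r; nia. }
  split.
  - transitivity (2 ^ (4 * ((m0 + 1) * (l + 1))) * 2 ^ (cs * (q + 1) * (l + 1)))%nat.
    + apply Nat.mul_le_mono.
      * rewrite (Nat.mul_comm 4), Nat.pow_mul_r. apply Nat.pow_le_mono_l; auto.
      * apply Nat.pow_le_mono_r; [lia|]. rewrite <- Nat.mul_assoc. apply Nat.mul_le_mono_l. nia.
    + rewrite <- Nat.pow_add_r. apply Nat.pow_le_mono_r; [lia|]. subst b. unfold m0. nia.
  - apply Nat.lt_le_trans with (2 ^ g)%nat; [apply Nat.pow_gt_lin_r; lia|].
    apply Nat.pow_le_mono_r; [lia|]. subst b. nia.
Qed.

Lemma reduction_time (N n km L calls TE G Q g : nat) (T Cp CL delta : R) :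
  (1 <= N)%nat -> (1 <= n)%nat -> (1 <= g)%nat -> (N <= n ^ g)%nat ->
  (calls * km <= 256 * ((Q + 1) * N * ((Q + 1) * N)) * (L * L))%nat ->
  0 < delta -> 0 <= Cp -> INR TE <= Cp * T + 1 ->
  T <= 2 * (INR km * Rpower (INR n) (- delta)) ->
  INR n <= INR km * Rpower (INR n) (- delta) ->
  INR L <= CL * Rpower (INR n) (delta / 4) ->
  INR (calls * (15 * n + G + TE + 21)) <=
  (INR G + 37 + 2 * Cp) * (256 * ((INR Q + 1) * (INR Q + 1)) * (CL * CL)) *
    Rpower (INR N) (2 - delta / (2 * INR g)).
Proof.
  intros HN Hn Hg HNn Hcalls Hdel HCp HTE HT Hnkm HL.
  apply le_INR in HN, Hn, Hg, HNn, Hcalls. rewrite !mult_INR, !plus_INR in Hcalls.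
  rewrite pow_INR in HNn. simpl (INR 1) in *.
  replace (INR 256) with 256 in Hcalls by (simpl; ring).
  set (x := INR n) in *. set (M := INR N) in *.
  rewrite mult_INR, !plus_INR, mult_INR. fold x.
  replace (INR 15) with 15 by (simpl; ring). replace (INR 21) with 21 by (simpl; ring).
  set (y := Rpower x (- delta)) in *.
  assert (Hy : 0 < y) by apply exp_pos.
  pose proof (pos_INR calls) as Pc. pose proof (pos_INR km) as Pk.
  pose proof (pos_INR G) as PG. pose proof (pos_INR L) as PL. pose proof (pos_INR Q) as PQ.
  set (c := INR calls) in *. set (K := INR km) in *.
  set (D2 := INR G + 37 + 2 * Cp).
  assert (HD2 : 0 <= D2) by (unfold D2; lra).
  assert (HW : 15 * x + INR G + INR TE + 21 <= D2 * (K * y)).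
  { assert (Cp * T <= Cp * (2 * (K * y))) by (apply Rmult_le_compat_l; auto).
    assert (INR G * x <= INR G * (K * y)) by (apply Rmult_le_compat_l; auto).
    assert (INR G * 1 <= INR G * x) by (apply Rmult_le_compat_l; auto).
    unfold D2. lra. }
  set (z := Rpower x (delta / 4)) in *.
  assert (Hz : 0 < z) by apply exp_pos.
  assert (HLL : INR L * INR L <= (CL * z) * (CL * z)) by (apply Rmult_le_compat; auto).
  set (A := 256 * ((INR Q + 1) * (INR Q + 1))).
  assert (HA : 0 <= A) by (unfold A; nra).
  apply Rle_trans with (D2 * y * (c * K)).
  { replace (D2 * y * (c * K)) with (c * (D2 * (K * y))) by ring. now apply Rmult_le_compat_l. }
  apply Rle_trans with (D2 * y * (A * (M * M) * ((CL * z) * (CL * z)))).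
  { apply Rmult_le_compat_l; [apply Rmult_le_pos; lra|].
    eapply Rle_trans; [exact Hcalls|].
    replace (256 * ((INR Q + 1) * M * ((INR Q + 1) * M))) with (A * (M * M)) by (unfold A; ring).
    apply Rmult_le_compat_l; [|exact HLL]. apply Rmult_le_pos; [auto|nra]. }
  assert (Hyz : y * z * z = Rpower x (- (delta / 2))).
  { unfold y, z. rewrite <- !Rpower_plus. f_equal. field. }
  replace (D2 * y * (A * (M * M) * ((CL * z) * (CL * z))))
    with (D2 * (A * (CL * CL)) * (M * M * (y * z * z))) by ring.
  rewrite Hyz.
  apply Rmult_le_compat_l.
  { apply Rmult_le_pos; [auto|]. apply Rmult_le_pos; [auto|]. nra. }
  replace (2 - delta / (2 * INR g)) with (1 + 1 + - (delta / (2 * INR g))) by ring.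
  rewrite !Rpower_plus, Rpower_1 by lra.
  apply Rmult_le_compat_l; [nra|].
  rewrite !Rpower_Ropp. apply Rinv_le_contravar; [apply exp_pos|].
  apply Rle_trans with (Rpower (x ^ g) (delta / (2 * INR g))).
  { apply Rle_Rpower_l; [|lra]. left. apply Rdiv_lt_0_compat; lra. }
  rewrite <- Rpower_pow by lra. rewrite Rpower_mult.
  right. f_equal. field. lra.
Qed.

Lemma ln_nondecreasing (x y : R) : 0 < x -> x <= y -> ln x <= ln y.
Proof. intros Hx [H| ->]; [left; now apply ln_increasing|lra]. Qed.

Lemma log_dim_bounds (c : R) (cn g N n d : nat) (s : R) :
  1 <= c -> c <= INR cn -> (1 <= N)%nat -> (1 <= n)%nat -> (N <= n ^ g)%nat -> 0 < s ->
  log_dim c N d ->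
  (d <= (2 * cn + 1) * N)%nat /\
  INR (blk d) <= (4 * c * INR g / ln 2 / s + 5) * Rpower (INR n) s.
Proof.
  intros Hc Hcn HN Hn HNn Hs [_ Hd].
  assert (Hln2 := ln_lt_2).
  apply le_INR in HN, Hn, HNn. rewrite pow_INR in HNn. simpl (INR 1) in *.
  assert (HlN0 : 0 <= ln (INR N)) by (rewrite <- ln_1; apply ln_nondecreasing; lra).
  assert (Hi : 0 < / ln 2) by (apply Rinv_0_lt_compat; lra).
  split.
  - apply INR_le. rewrite mult_INR, plus_INR, mult_INR. simpl (INR 1). simpl (INR 2).
    assert (HlN : ln (INR N) <= INR N).
    { pose proof (ln_le_Rpower 1 (INR N)) as H. rewrite Rpower_1 in H by lra. lra. }
    assert (Hi2 : / ln 2 <= 2).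
    { replace 2 with (/ / 2) at 2 by field. apply Rinv_le_contravar; lra. }
    assert (H1 : ln (INR N) / ln 2 <= INR N * 2).
    { unfold Rdiv. apply Rmult_le_compat; lra. }
    assert (H0 : 0 <= ln (INR N) / ln 2) by (unfold Rdiv; apply Rmult_le_pos; lra).
    assert (H2 : c * (ln (INR N) / ln 2) <= INR cn * (INR N * 2)) by (apply Rmult_le_compat; lra).
    lra.
  - assert (HlN : ln (INR N) <= INR g * ln (INR n)).
    { rewrite <- Rpower_pow in HNn by lra.
      apply ln_nondecreasing in HNn; [|lra]. unfold Rpower in HNn. now rewrite ln_exp in HNn. }
    pose proof (ln_le_Rpower s (INR n) Hs Hn) as Hln.
    pose proof (Rpower_ge_1 (INR n) s Hn ltac:(lra)) as Hp.
    set (p := Rpower (INR n) s) in *.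
    pose proof (pos_INR g) as Hg.
    assert (H1 : ln (INR N) <= INR g * (p / s)).
    { eapply Rle_trans; [exact HlN|]. apply Rmult_le_compat_l; auto. }
    assert (H2 : c * (ln (INR N) / ln 2) <= c * (INR g * (p / s) / ln 2)).
    { apply Rmult_le_compat_l; [lra|]. unfold Rdiv at 1 2. apply Rmult_le_compat_r; lra. }
    unfold blk. rewrite plus_INR, mult_INR. simpl (INR 1). replace (INR 4) with 4 by (simpl; ring).
    replace ((4 * c * INR g / ln 2 / s + 5) * p) with (4 * (c * (INR g * (p / s) / ln 2)) + 5 * p)
      by (field; lra).
    lra.
Qed.

Lemma OV_solvable_of_ED (a k : nat -> nat) (Pa Pk Pe : cmd)
    (ca Ca ea ck Ck ek cb n0 : nat) (C e0 c : R) :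
  (forall n, (1 <= n)%nat -> (1 <= a n <= n)%nat) ->
  (forall n, (1 <= n)%nat -> (1 <= k n <= n)%nat) ->
  (1 <= ca)%nat -> (1 <= ck)%nat -> (1 <= cb)%nat -> 0 < e0 <= 1 / 2 -> 0 <= C -> 1 <= c ->
  (forall n, (1 <= n)%nat -> halts_within (word_size ca n) Pa (init [n] [])
     (INR (Ca * n ^ ea)) (fun s => var s 0 = a n)) ->
  (forall n, (1 <= n)%nat -> halts_within (word_size ck n) Pk (init [n] [])
     (INR (Ck * n ^ ek)) (fun s => var s 0 = k n)) ->
  (forall n X Y, (1 <= n)%nat -> is_ED_instance n X Y ->
     halts_within (word_size cb n) Pe (ED_input n X Y)
       (C * Rpower (INR (n + k n * Nat.min n (a n * k n))) (1 - e0)) (ED_output (a n) (k n) X Y)) ->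
  (forall n, (n0 <= n)%nat ->
     Rpower (INR n) (1 + e0 / 2) <= INR (k n * Nat.min n (a n * k n))) ->
  OV_solvable c (fun N => Rpower (INR N) (2 - e0 / 2 / (2 * INR (ea + ek + 1)))).
Proof.
  intros ha hk Hca Hck Hcb He0 HC Hc HPa HPk HPe Hsup.
  set (delta := e0 / 2) in *. set (g := (ea + ek + 1)%nat).
  set (CL := 4 * c * INR g / ln 2 / (delta / 4) + 5).
  destruct (Rpower_eventually_gt (3 * delta / 4) (8 * CL) ltac:(unfold delta; lra)) as [n1 Hn1].
  destruct (INR_unbounded c) as [cn Hcn].
  set (q := (n0 + n1 + 1)%nat).
  set (b := (4 * (q + 2 * cn + 13) + (ca + ck + cb) * (q + 1) + g)%nat).
  set (D5 := (3 + Ca * 2 ^ (q * g) + Ck * 2 ^ (q * g) + guest_vars Pa + guest_vars Pk + 40)%nat).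
  set (D4 := (INR (guest_vars Pe) + 37 + 2 * C) *
     (256 * ((INR (2 ^ q) + 1) * (INR (2 ^ q) + 1)) * (CL * CL))).
  exists (ov_program ca ck cb g q Pa Pk Pe), b, (D4 + INR D5).
  split; [unfold b; lia|].
  intros N d V HN Hd HV.
  destruct (log_scale N g q HN ltac:(unfold g; lia) ltac:(unfold q; lia)) as (HNn & HnN & Hne).
  set (n := (2 ^ (Nat.log2 N / g + q))%nat) in *.
  assert (Hqn : (q <= n)%nat).
  { apply Nat.lt_le_incl. apply Nat.lt_le_trans with (2 ^ q)%nat; [apply Nat.pow_gt_lin_r; lia|].
    apply Nat.pow_le_mono_r; lia. }
  assert (Hn : (1 <= n)%nat) by (unfold q in Hqn; lia).
  assert (HnR : 1 <= INR n) by (apply le_INR in Hn; exact Hn).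
  destruct (ha n Hn) as [Ha1 Ha2]. destruct (hk n Hn) as [Hk1 Hk2].
  specialize (Hsup n ltac:(unfold q in Hqn; lia)). specialize (Hn1 n ltac:(unfold q in Hqn; lia)).
  destruct (log_dim_bounds c cn g N n d (delta / 4) Hc ltac:(lra) HN Hn HNn ltac:(unfold delta; lra) Hd)
    as [HdN HdL]. fold CL in HdL.
  destruct (word_bound N d g q cn (ca + ck + cb) b HN HdN eq_refl) as [HB Hg]. fold n in HB.
  assert (HLk : (8 * blk d <= k n)%nat).
  { apply INR_le. rewrite mult_INR. replace (INR 8) with 8 by (simpl; ring).
    assert (H1 : 8 * INR (blk d) <= Rpower (INR n) delta).
    { replace delta with (3 * delta / 4 + delta / 4) by field. rewrite Rpower_plus.
      assert (0 < Rpower (INR n) (delta / 4)) by apply exp_pos. nra. }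
    eapply Rle_trans; [exact H1|].
    apply (Rmult_le_reg_l (INR n)); [lra|].
    rewrite Rpower_plus, Rpower_1 in Hsup by lra.
    eapply Rle_trans; [exact Hsup|]. rewrite Rmult_comm, mult_INR.
    apply Rmult_le_compat_l; [apply pos_INR|]. apply le_INR. lia. }
  set (m := Nat.min n (a n * k n)) in *.
  set (km := (k n * m)%nat) in *.
  set (T := Rpower (INR (n + km)) (1 - e0)) in *.
  assert (HT0 : 0 < T) by apply exp_pos.
  assert (Hak : (1 * k n <= a n * k n)%nat) by (apply Nat.mul_le_mono_r; lia).
  assert (Hm : (k n <= m)%nat) by (apply Nat.min_glb; lia).
  assert (Hmn : (m <= n)%nat) by apply Nat.le_min_l.
  destruct (nat_ceiling (C * T)) as (TE & HTE1 & HTE2).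
  { apply Rmult_le_pos; lra. }
  destruct (superlinear_time (INR n) (INR km) e0 He0 HnR Hsup) as [HT1 HT2].
  fold delta in HT1, HT2. rewrite <- plus_INR in HT1. fold T in HT1.
  destruct (ov_program_correct (word_size b N) ca ck cb g q Pa Pk Pe N d V (a n) (k n)
    (Ca * n ^ ea) (Ck * n ^ ek) TE (C * T)) as (t & s & Hex & Ht & Hpost); auto.
  exists t, s. split; [exact Hex|split; [|exact Hpost]].
  fold n in Ht. fold m in Ht.
  set (N1 := (k n / (8 * blk d))%nat) in *. set (N2 := (m / (8 * blk d))%nat) in *.
  set (calls := ((N / N1 + 1) * (N / N2 + 1))%nat) in *.
  assert (Hcalls : (calls * km <= 256 * ((2 ^ q + 1) * N * ((2 ^ q + 1) * N)) * (blk d * blk d))%nat).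
  { apply (calls_bound N n (k n) m d N1 N2 (2 ^ q)); auto; lia. }
  pose proof (reduction_time N n km (blk d) calls TE (guest_vars Pe) (2 ^ q) g T C CL delta
    HN Hn ltac:(unfold g; lia) HNn Hcalls ltac:(unfold delta; lra) HC HTE1 HT1 HT2 HdL) as Hmain.
  fold D4 in Hmain.
  assert (Hrest : (3 * Nat.log2 N + Ca * n ^ ea + Ck * n ^ ek + guest_vars Pa + guest_vars Pk + 40 <= D5 * N)%nat).
  { pose proof (Nat.log2_le_lin N ltac:(lia)).
    pose proof (Nat.mul_le_mono_l _ _ Ca (Hne ea ltac:(unfold g; lia))).
    pose proof (Nat.mul_le_mono_l _ _ Ck (Hne ek ltac:(unfold g; lia))).
    pose proof (Nat.mul_le_mono_l 1 N (guest_vars Pa + guest_vars Pk + 40) HN).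
    unfold D5. lia. }
  assert (Ht' : (t <= D5 * N + calls * (15 * n + guest_vars Pe + TE + 21))%nat) by lia.
  apply le_INR in Ht'. rewrite plus_INR, mult_INR in Ht'.
  assert (HNR : 1 <= INR N) by (apply le_INR in HN; exact HN).
  assert (HgR : 1 <= INR g) by (replace 1 with (INR 1) by reflexivity; apply le_INR; unfold g; lia).
  assert (HNe : INR N <= Rpower (INR N) (2 - delta / (2 * INR g))).
  { rewrite <- (Rpower_1 (INR N)) at 1 by lra. apply Rle_Rpower; [lra|].
    assert (delta / (2 * INR g) <= delta / 2).
    { unfold Rdiv. apply Rmult_le_compat_l; [unfold delta; lra|]. apply Rinv_le_contravar; lra. }
    unfold delta in *. lra. }
  pose proof (pos_INR D5) as HD5.
  apply (Rmult_le_compat_l (INR D5)) in HNe; [|exact HD5].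
  rewrite Rmult_plus_distr_r. lra.
Qed.

Lemma ED_unsolvable (a k : nat -> nat) (eps : R) :
  (forall n, (1 <= n)%nat -> (1 <= a n <= n)%nat) ->
  (forall n, (1 <= n)%nat -> (1 <= k n <= n)%nat) ->
  poly_time_computable a -> poly_time_computable k -> OV_conjecture -> 0 < eps ->
  ~ ED_solvable a k
      (fun n => Rpower (INR (n + k n * Nat.min n (a n * k n))) (1 - eps)).
Proof.
  intros ha hk ca ck OVC Heps (Pe & cb & C & Hcb & HPe).
  set (e0 := Rmin eps (1 / 2)).
  assert (He0 : 0 < e0 <= 1 / 2).
  { unfold e0, Rmin. destruct (Rle_dec eps (1 / 2)); lra. }
  assert (He1 : e0 <= eps) by apply Rmin_l.
  set (km := fun n => (k n * Nat.min n (a n * k n))%nat).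
  assert (HPe' : forall n X Y, (1 <= n)%nat -> is_ED_instance n X Y ->
     halts_within (word_size cb n) Pe (ED_input n X Y)
       (Rabs C * Rpower (INR (n + km n)) (1 - e0)) (ED_output (a n) (k n) X Y)).
  { intros n X Y Hn HXY. destruct (HPe n X Y Hn HXY) as (t & s & Hex & Ht & Hs).
    exists t, s. split; [exact Hex|split; [|exact Hs]]. eapply Rle_trans; [exact Ht|].
    fold (km n).
    assert (1 <= INR (n + km n)).
    { replace 1 with (INR 1) by reflexivity. apply le_INR. lia. }
    assert (0 < Rpower (INR (n + km n)) (1 - eps)) by apply exp_pos.
    assert (Rpower (INR (n + km n)) (1 - eps) <= Rpower (INR (n + km n)) (1 - e0))
      by (apply Rle_Rpower; lra).
    pose proof (Rle_abs C). pose proof (Rabs_pos C). nra. }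
  destruct (classic (exists n0, forall n, (n0 <= n)%nat ->
    Rpower (INR n) (1 + e0 / 2) <= INR (km n))) as [[n0 Hsup]|Hsub].
  - destruct ca as (Pa & ca & Ca & ea & Hca & HPa). destruct ck as (Pk & ck & Ck & ek & Hck & HPk).
    assert (Hg : 1 <= INR (ea + ek + 1)).
    { replace 1 with (INR 1) by reflexivity. apply le_INR. lia. }
    destruct (OVC (e0 / 2 / (2 * INR (ea + ek + 1)))) as (c & Hc & Hno).
    { apply Rdiv_lt_0_compat; lra. }
    apply Hno.
    apply (OV_solvable_of_ED a k Pa Pk Pe ca Ca ea ck Ck ek cb n0 (Rabs C) e0 c); auto.
    apply Rabs_pos.
  - apply Hsub.
    destruct (Rpower_eventually_gt (e0 / 2) (8 * INR (csize Pe) * Rabs C) ltac:(lra)) as [n0 Hn0].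
    exists (n0 + 2)%nat. intros n Hn. apply Rnot_lt_le. intros Hlt.
    specialize (Hn0 n ltac:(lia)).
    assert (HnR : 1 <= INR n).
    { replace 1 with (INR 1) by reflexivity. apply le_INR. lia. }
    destruct (ED_solver_reads_half Pe cb (a n) (k n) n _ ltac:(lia)
      (proj1 (ha n ltac:(lia))) (proj1 (hk n ltac:(lia)))
      (fun X Y => HPe' n X Y ltac:(lia))) as (t & Ht & Hhalf).
    rewrite plus_INR in Ht.
    pose proof (sublinear_time (INR n) (INR (km n)) e0 He0 HnR (pos_INR _) ltac:(lra)) as HT.
    assert (H4 : (n <= 4 * (n / 2))%nat).
    { pose proof (Nat.div_mod n 2 ltac:(lia)). pose proof (Nat.mod_upper_bound n 2 ltac:(lia)). lia. }
    assert (H5 : (n <= 4 * (csize Pe * t))%nat) by lia.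
    apply le_INR in H5. rewrite !mult_INR in H5. replace (INR 4) with 4 in H5 by (simpl; ring).
    pose proof (Rabs_pos C) as HC. pose proof (pos_INR (csize Pe)) as Hcs.
    set (y := Rpower (INR n) (1 - e0 / 2)) in *.
    assert (Hy : 0 < y) by apply exp_pos.
    assert (Ht2 : INR t <= Rabs C * (2 * y)).
    { eapply Rle_trans; [exact Ht|]. apply Rmult_le_compat_l; auto. }
    apply (Rmult_le_compat_l (INR (csize Pe))) in Ht2; [|exact Hcs].
    assert (H6 : INR n = y * Rpower (INR n) (e0 / 2)).
    { unfold y. rewrite <- Rpower_plus. replace (1 - e0 / 2 + e0 / 2) with 1 by ring.
      rewrite Rpower_1; lra. }
    assert (y * (8 * INR (csize Pe) * Rabs C) < y * Rpower (INR n) (e0 / 2))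
      by (apply Rmult_lt_compat_l; auto).
    lra.
Qed.

Local Close Scope R_scope.

Theorem theorem9 (a k : nat -> nat)
    (ha : forall n, 1 <= n -> 1 <= a n <= n)
    (hk : forall n, 1 <= n -> 1 <= k n <= n)
    (ca : poly_time_computable a)
    (ck : poly_time_computable k)
    (OVC : OV_conjecture) :
  ~ exists eps : R, (0 < eps)%R /\
      ED_solvable a k
        (fun n => Rpower (INR (n + k n * Nat.min n (a n * k n))) (1 - eps)).
Proof.
  intros (eps & Heps & H). exact (ED_unsolvable a k eps ha hk ca ck OVC Heps H).
Qed.
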